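(* Let $\mathcal A,\mathcal A'$ be generic systems of 4-cycle algebras with algebraic direct limits $A$ and $A'$ respectively. Then $A$ and $A'$ are star extendibly isomorphic if and only if $\mathcal A$ and $\mathcal A'$ are regularly isomorphic.
   Context: 4-cycle algebras. For positive integers $n_1,\dots,n_4$ with $r=\sum n_i$, the 4-cycle algebra with these block sizes is the algebra $A\subseteq M_r(\mathbb C)$ of block matrices $(a_{ij})$, $a_{ij}\in M_{n_i,n_j}(\mathbb C)$, with $a_{ij}=0$ unless $i=j$ or ($i\in\{1,2\}$, $j\in\{3,4\}$). $Q_1,\dots,Q_4$ denote the block projections. $C^*(A)=M_r(\mathbb C)$. An embedding (injective homomorphism) $\phi:A\to A'$ is star extendible if it extends to a $*$-homomorphism $C^*(A)\to C^*(A')$; its multiplicity is that of the extension. It is regular if it is a direct sum (sum with mutually orthogonal ranges) of multiplicity one star extendible embeddings. A multiplicity one star extendible embedding is rigid of type $\theta$ if $\theta$ is a permutation of $\{1,2,3,4\}$ preserving $\{1,2\}$ and $\{3,4\}$ and $\phi(Q_iAQ_j)\subseteq Q'_{\theta(i)}A'Q'_{\theta(j)}$ for all $i,j$ (four types: $\mathrm{id},(12),(34),(12)(34)$). A rigid embedding is a sum of multiplicity one rigid embeddings with mutually orthogonal ranges; it is generic if all four types occur. A generic system is a direct system $\mathcal A=(A_k,\alpha_k)$ of 4-cycle algebras with all $\alpha_k$ generic. A star extendible isomorphism $A\to A'$ of the algebraic limits is an algebra isomorphism extending to a $*$-isomorphism of the generated self-adjoint algebras $\varinjlim C^*(A_k)\to\varinjlim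 C^*(A'_k)$ (algebraic limits). Two systems are regularly isomorphic if there are subsequences and regular star extendible crossover embeddings $A_{n_1}\to A'_{m_1}\to A_{n_2}\to A'_{m_2}\to\cdots$ such that the composition of any two consecutive crossover maps is the given embedding $A_{n_i}\to A_{n_{i+1}}$ or $A'_{m_i}\to A'_{m_{i+1}}$. *)

(* Defs.v *)
From HB Require Import structures.
From mathcomp Require Import all_boot all_order all_algebra.
From mathcomp Require Import perm generic_quotient.
From mathcomp Require Import boolp.

Set Implicit Arguments.
Unset Strict Implicit.
Unset Printing Implicit Defensive.

Import Order.TTheory GRing.Theory Num.Theory.
Local Open Scope ring_scope.
Local Open Scope sesquilinear_scope.
Local Open Scope quotient_scope.

(* Algebraic direct limits of sequences X 0 -> X 1 -> ... of vector spaces.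
   The connecting maps need not preserve any unit, so the limit of a sequence
   of algebras is not a unital ring: its product is the lift [dl_op2] to the
   limit of the products of the X k, and likewise for an involution. *)
Section DirectLimit.
Variables (K : pzRingType) (X : nat -> lmodType K).
Variable f : forall k, {linear X k -> X k.+1}.

Fixpoint push d k (x : X k) : X (d + k) :=
  if d is d'.+1 then f (d' + k) (push d' x) else x.

Definition transition k l (le_kl : (k <= l)%N) (x : X k) : X l :=
  ecast i (X i) (subnK le_kl) (push (l - k) x).

Lemma transitionE d k l (e : (d + k)%N = l) (le_kl : (k <= l)%N) (x : X k) :
  transition le_kl x = ecast i (X i) e (push d x).
Proof.
have dE : (l - k)%N = d by rewrite -e addnK.
rewrite /transition; move: (subnK le_kl); rewrite dE => e'.
by rewrite (eq_irrelevance e' e).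
Qed.

Lemma transition_refl k (le_kk : (k <= k)%N) (x : X k) : transition le_kk x = x.
Proof. by rewrite (@transitionE 0 _ _ erefl). Qed.

Lemma transitionS k l (le_kl : (k <= l)%N) (le_klS : (k <= l.+1)%N) (x : X k) :
  transition le_klS x = f l (transition le_kl x).
Proof.
have castS m (e : m = l) (eS : m.+1 = l.+1) (y : X m) :
    ecast i (X i) eS (f m y) = f l (ecast i (X i) e y).
  by case: l / e {le_kl le_klS} eS => eS; rewrite (eq_irrelevance eS erefl).
have e := subnK le_kl; have eS : ((l - k).+1 + k)%N = l.+1 by rewrite addSn e.
by rewrite (transitionE e) (transitionE eS) /= (castS _ e).
Qed.

Lemma transition_trans k l m (le_kl : (k <= l)%N) (le_lm : (l <= m)%N)
    (le_km : (k <= m)%N) (x : X k) :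
  transition le_lm (transition le_kl x) = transition le_km x.
Proof.
elim: m le_lm le_km => [|m IHm] le_lm le_km.
  case: l le_kl le_lm => // le_kl le_lm.
  by rewrite transition_refl (bool_irrelevance le_kl le_km).
have [le_lm'|lt_ml] := leqP l m.
  have le_km' := leq_trans le_kl le_lm'.
  by rewrite (transitionS le_lm') (transitionS le_km') (IHm le_lm' le_km').
have eqlm : l = m.+1 by apply/eqP; rewrite eqn_leq le_lm lt_ml.
case: _ / eqlm in le_lm le_km *.
by rewrite transition_refl (bool_irrelevance le_kl le_km).
Qed.

Lemma transition_linear k l (le_kl : (k <= l)%N) : linear (transition le_kl).
Proof.
elim: l le_kl => [|l IHl] le_kl a x y.
  by case: k le_kl x y => // le_kl x y; rewrite !transition_refl.
have [le_kl'|lt_lk] := leqP k l.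
  by rewrite !(transitionS le_kl') IHl linearP.
have eqkl : k = l.+1 by apply/eqP; rewrite eqn_leq le_kl lt_lk.
by case: _ / eqkl in IHl le_kl x y lt_lk *; rewrite !transition_refl.
Qed.

Definition eventually_eq (u v : {k : nat & X k}) : bool :=
  `[< exists l (le_u : (tag u <= l)%N) (le_v : (tag v <= l)%N),
      transition le_u (tagged u) = transition le_v (tagged v) >].

Lemma eventually_eq_refl : reflexive eventually_eq.
Proof. by move=> u; apply/asboolP; exists (tag u), (leqnn _), (leqnn _). Qed.

Lemma eventually_eq_sym : symmetric eventually_eq.
Proof.
by move=> u v; apply/asboolP/asboolP=> -[l [lu [lv e]]]; exists l, lv, lu.
Qed.

Lemma eventually_eq_trans : transitive eventually_eq.
Proof.
move=> v u w /asboolP[l [lu [lv e]]] /asboolP[m [mv [mw e']]]; apply/asboolP.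
have ll := leq_maxl l m; have lm := leq_maxr l m.
exists (maxn l m), (leq_trans lu ll), (leq_trans mw lm).
rewrite -(transition_trans lu ll) -(transition_trans mw lm) e -e'.
by rewrite !(transition_trans _ _ (leq_trans lv ll)).
Qed.

Canonical eventually_eq_equiv :=
  EquivRel eventually_eq
    eventually_eq_refl eventually_eq_sym eventually_eq_trans.

Definition dirlim := {eq_quot eventually_eq}.
HB.instance Definition _ := Choice.on dirlim.

Definition dl_in k (x : X k) : dirlim := \pi_dirlim (Tagged X x).

Definition dl_op1 (op : forall k, X k -> X k) (u : dirlim) : dirlim :=
  dl_in (op _ (tagged (repr u))).

Definition dl_op2 (op : forall k, X k -> X k -> X k) (u v : dirlim) : dirlim :=
  let s := repr u in let t := repr v in
  dl_in (op (maxn (tag s) (tag t))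
    (transition (leq_maxl _ _) (tagged s))
    (transition (leq_maxr _ _) (tagged t))).

Lemma dl_inP k l (x : X k) (y : X l) :
  dl_in x = dl_in y <-> exists m (le_k : (k <= m)%N) (le_l : (l <= m)%N),
    transition le_k x = transition le_l y.
Proof.
have E := @eqmodP _ eventually_eq_equiv (Tagged X x) (Tagged X y).
by split=> [/E/asboolP|e] //; apply/E/asboolP.
Qed.

Lemma dl_in_transition k l (le_kl : (k <= l)%N) (x : X k) :
  dl_in (transition le_kl x) = dl_in x.
Proof.
by apply/dl_inP; exists l, (leqnn l), le_kl; rewrite transition_refl.
Qed.

Lemma dl_in_step k (x : X k) : dl_in (f k x) = dl_in x.
Proof.
rewrite -(dl_in_transition (leqnSn k) x).
by rewrite (transitionS (leqnn k)) transition_refl.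
Qed.

Lemma dl_in_repr (u : dirlim) : dl_in (tagged (repr u)) = u.
Proof. by rewrite /dl_in -[RHS]reprK; case: (repr u). Qed.

Lemma dl_in_surj (u : dirlim) : exists k (x : X k), u = dl_in x.
Proof. by exists (tag (repr u)), (tagged (repr u)); rewrite dl_in_repr. Qed.

Lemma dl_in_surj2 (u v : dirlim) :
  exists k (x y : X k), u = dl_in x /\ v = dl_in y.
Proof.
have [k [x ->]] := dl_in_surj u; have [l [y ->]] := dl_in_surj v.
exists (maxn k l), (transition (leq_maxl k l) x), (transition (leq_maxr k l) y).
by rewrite !dl_in_transition.
Qed.

Lemma dl_in_surj3 (u v w : dirlim) :
  exists k (x y z : X k), [/\ u = dl_in x, v = dl_in y & w = dl_in z].
Proof.
have [k [x [y [-> ->]]]] := dl_in_surj2 u v; have [l [z ->]] := dl_in_surj w.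
exists (maxn k l), (transition (leq_maxl k l) x),
  (transition (leq_maxl k l) y), (transition (leq_maxr k l) z).
by rewrite !dl_in_transition.
Qed.

Lemma transition_morph1 (op : forall k, X k -> X k) :
    (forall k x, f k (op k x) = op k.+1 (f k x)) ->
  forall k l (le_kl : (k <= l)%N) x,
  transition le_kl (op k x) = op l (transition le_kl x).
Proof.
move=> fop k l; elim: l => [|l IHl] le_kl x.
  by case: k le_kl x => // le_kl x; rewrite !transition_refl.
have [le_kl'|lt_lk] := leqP k l.
  by rewrite !(transitionS le_kl') IHl fop.
have eqkl : k = l.+1 by apply/eqP; rewrite eqn_leq le_kl lt_lk.
by case: _ / eqkl in IHl le_kl x lt_lk *; rewrite !transition_refl.
Qed.

Lemma transition_morph2 (op : forall k, X k -> X k -> X k) :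
    (forall k x y, f k (op k x y) = op k.+1 (f k x) (f k y)) ->
  forall k l (le_kl : (k <= l)%N) x y,
  transition le_kl (op k x y) = op l (transition le_kl x) (transition le_kl y).
Proof.
move=> fop k l; elim: l => [|l IHl] le_kl x y.
  by case: k le_kl x y => // le_kl x y; rewrite !transition_refl.
have [le_kl'|lt_lk] := leqP k l.
  by rewrite !(transitionS le_kl') IHl fop.
have eqkl : k = l.+1 by apply/eqP; rewrite eqn_leq le_kl lt_lk.
by case: _ / eqkl in IHl le_kl x y lt_lk *; rewrite !transition_refl.
Qed.

Lemma dl_op1E (op : forall k, X k -> X k) :
    (forall k x, f k (op k x) = op k.+1 (f k x)) ->
  forall k (x : X k), dl_op1 op (dl_in x) = dl_in (op k x).
Proof.
move=> fop k x; rewrite /dl_op1; set s := repr _.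
have /dl_inP[m [lek [lel e]]] : dl_in (tagged s) = dl_in x by exact: dl_in_repr.
by apply/dl_inP; exists m, lek, lel; rewrite !(transition_morph1 fop) e.
Qed.

Lemma dl_op2E (op : forall k, X k -> X k -> X k) :
    (forall k x y, f k (op k x y) = op k.+1 (f k x) (f k y)) ->
  forall k (x y : X k), dl_op2 op (dl_in x) (dl_in y) = dl_in (op k x y).
Proof.
move=> fop k x y; rewrite /dl_op2 /=; set s := repr _; set t := repr _.
have /dl_inP[m [ms [mk es]]] : dl_in (tagged s) = dl_in x by exact: dl_in_repr.
have /dl_inP[n [nt [nk et]]] : dl_in (tagged t) = dl_in y by exact: dl_in_repr.
pose N := maxn m n; have mN : (m <= N)%N := leq_maxl m n.
have nN : (n <= N)%N := leq_maxr m n.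
have stN : (maxn (tag s) (tag t) <= N)%N.
  by rewrite geq_max (leq_trans ms mN) (leq_trans nt nN).
apply/dl_inP; exists N, stN, (leq_trans mk mN).
rewrite !(transition_morph2 fop); congr (op N _ _).
  rewrite (transition_trans _ _ (leq_trans ms mN)) -(transition_trans ms mN) es.
  by rewrite (transition_trans _ _ (leq_trans mk mN)).
rewrite (transition_trans _ _ (leq_trans nt nN)) -(transition_trans nt nN) et.
by rewrite (transition_trans _ _ (leq_trans mk mN)).
Qed.

Definition dl_add : dirlim -> dirlim -> dirlim := dl_op2 (fun k => +%R).
Definition dl_opp : dirlim -> dirlim := dl_op1 (fun k => -%R).
Definition dl_scale (c : K) : dirlim -> dirlim := dl_op1 (fun k => *:%R c).

Lemma dl_addE k (x y : X k) : dl_add (dl_in x) (dl_in y) = dl_in (x + y).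
Proof. by apply: dl_op2E => *; rewrite raddfD. Qed.

Lemma dl_oppE k (x : X k) : dl_opp (dl_in x) = dl_in (- x).
Proof. by apply: (dl_op1E (op := fun k => -%R)) => *; rewrite raddfN. Qed.

Lemma dl_scaleE c k (x : X k) : dl_scale c (dl_in x) = dl_in (c *: x).
Proof. by apply: (dl_op1E (op := fun k => *:%R c)) => *; rewrite linearZ. Qed.

Lemma dl_in0 k : dl_in (0 : X k) = dl_in (0 : X 0).
Proof.
rewrite -(dl_in_transition (leq0n k) 0); congr dl_in.
by elim: k => [|k IHk]; rewrite ?transition_refl // (transitionS (leq0n k)) -IHk
  raddf0.
Qed.

Lemma dl_addA : associative dl_add.
Proof.
move=> u v w; have [k [x [y [z [-> -> ->]]]]] := dl_in_surj3 u v w.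
by rewrite !dl_addE addrA.
Qed.

Lemma dl_addC : commutative dl_add.
Proof.
move=> u v; have [k [x [y [-> ->]]]] := dl_in_surj2 u v.
by rewrite !dl_addE addrC.
Qed.

Lemma dl_add0 : left_id (dl_in (0 : X 0)) dl_add.
Proof.
by move=> u; have [k [x ->]] := dl_in_surj u; rewrite -(dl_in0 k) dl_addE add0r.
Qed.

Lemma dl_addN : left_inverse (dl_in (0 : X 0)) dl_opp dl_add.
Proof.
move=> u; have [k [x ->]] := dl_in_surj u.
by rewrite dl_oppE dl_addE addNr dl_in0.
Qed.

HB.instance Definition _ :=
  GRing.isZmodule.Build dirlim dl_addA dl_addC dl_add0 dl_addN.

Lemma dl_inD k (x y : X k) : dl_in (x + y) = dl_in x + dl_in y.
Proof. by rewrite -dl_addE. Qed.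

Lemma dl_scaleA a b v : dl_scale a (dl_scale b v) = dl_scale (a * b) v.
Proof. by have [k [x ->]] := dl_in_surj v; rewrite !dl_scaleE scalerA. Qed.

Lemma dl_scale1 : left_id 1 dl_scale.
Proof. by move=> v; have [k [x ->]] := dl_in_surj v; rewrite dl_scaleE scale1r. Qed.

Lemma dl_scaleDr : right_distributive dl_scale +%R.
Proof.
move=> a u v; have [k [x [y [-> ->]]]] := dl_in_surj2 u v.
by rewrite -dl_inD !dl_scaleE scalerDr dl_inD.
Qed.

Lemma dl_scaleDl v : {morph dl_scale^~ v : a b / a + b}.
Proof.
move=> a b; have [k [x ->]] := dl_in_surj v.
by rewrite /= !dl_scaleE scalerDl dl_inD.
Qed.

HB.instance Definition _ :=
  GRing.Zmodule_isLmodule.Build K dirlim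
    dl_scaleA dl_scale1 dl_scaleDr dl_scaleDl.

Lemma dl_in_linear k : linear (@dl_in k).
Proof. by move=> a x y; rewrite dl_inD -dl_scaleE. Qed.

End DirectLimit.

Section DirectLimitMap.
Variables (K : pzRingType) (X Y : nat -> lmodType K).
Variable f : forall k, {linear X k -> X k.+1}.
Variable g : forall k, {linear Y k -> Y k.+1}.
Variable h : forall k, X k -> Y k.

Definition dl_map (u : dirlim f) : dirlim g := dl_in g (h (tagged (repr u))).

Lemma dl_mapE : (forall k x, g k (h x) = h (f k x)) ->
  forall k (x : X k), dl_map (dl_in f x) = dl_in g (h x).
Proof.
move=> gh k x; rewrite /dl_map; set s := repr _.
have /dl_inP[m [lek [lel e]]] : dl_in f (tagged s) = dl_in f x.
  exact: dl_in_repr.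
apply/dl_inP; exists m, lek, lel.
have trh i j (le : (i <= j)%N) (z : X i) :
    transition g le (h z) = h (transition f le z).
  elim: j le z => [|j IHj] le z.
    by case: i le z => // le z; rewrite !transition_refl.
  have [le'|lt] := leqP i j; first by rewrite !(transitionS _ le') IHj gh.
  have eqij : i = j.+1 by apply/eqP; rewrite eqn_leq le lt.
  by case: _ / eqij in IHj le z lt *; rewrite !transition_refl.
by rewrite !trh e.
Qed.

End DirectLimitMap.

Record blockSizes := BlockSizes {
  bsize :> 'I_4 -> nat;
  bsize_gt0 : forall i, (0 < bsize i)%N }.

(* Blocks are numbered from 0: the off-diagonal corners (i, j) allowed to be
   nonzero are those with i in {0, 1} and j in {2, 3}. *)
Definition block_allowed (i j : 'I_4) : bool :=
  (i == j) || ((i < 2) && (2 <= j))%N.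


Lemma block_allowed_trans : transitive block_allowed.
Proof.
move=> j i k; rewrite /block_allowed => /orP[/eqP-> //|/andP[i2 j2]].
move=> /orP[/eqP<-|/andP[j2' _]]; first by rewrite i2 j2 orbT.
by rewrite ltnNge j2 in j2'.
Qed.

Section FourCycle.
Variable C : numClosedFieldType.

Local Notation fullmx n := 'M[C]_(\sum_i bsize n i).

Section Algebra.
Variable n : blockSizes.

Definition in_cycle4 : {pred fullmx n} := fun a =>
  [forall i, forall j, ~~ block_allowed i j ==> (submxblock a i j == 0)].

Lemma in_cycle4P (a : fullmx n) :
  reflect (forall i j, ~~ block_allowed i j -> submxblock a i j = 0)
          (a \in in_cycle4).
Proof.
apply: (iffP forallP) => [H i j na|H i]; last first.
  by apply/forallP=> j; apply/implyP=> na; rewrite H.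
by have /forallP/(_ j)/implyP/(_ na)/eqP := H i.
Qed.

Lemma in_cycle4_entryP (a : fullmx n) :
  reflect (forall s t, ~~ block_allowed (tagnat.sig1 s) (tagnat.sig1 t) ->
             a s t = 0)
          (a \in in_cycle4).
Proof.
apply: (iffP (in_cycle4P a)) => [H s t na|H i j na].
  have /matrixP/(_ (tagnat.sig2 s) (tagnat.sig2 t)) := H _ _ na.
  by rewrite !mxE !tagnat.sig2K.
by apply/matrixP=> s t; rewrite !mxE H // !tagnat.Rank1K.
Qed.

Lemma cycle4_subring : subring_closed in_cycle4.
Proof.
split=> [|a b /in_cycle4P Ha /in_cycle4P Hb|a b /in_cycle4P Ha /in_cycle4P Hb].
- apply/in_cycle4_entryP=> s t na; rewrite mxE; case: eqP => // est.
  by rewrite est /block_allowed eqxx in na.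
- by apply/in_cycle4P=> i j na; rewrite submxblockB Ha // Hb // subr0.
apply/in_cycle4P=> i j na.
rewrite -[a]submxblockK -[b]submxblockK [_ * _]mul_mxblock mxblockK.
rewrite big1 // => k _.
have [aik|naik] := boolP (block_allowed i k); last by rewrite Ha // mul0mx.
have [akj|nakj] := boolP (block_allowed k j); last by rewrite Hb // mulmx0.
by rewrite (block_allowed_trans aik akj) in na.
Qed.

Lemma cycle4_scale : scaler_closed in_cycle4.
Proof.
move=> c a /in_cycle4_entryP Ha; apply/in_cycle4_entryP=> s t na.
by rewrite mxE Ha // mulr0.
Qed.

HB.instance Definition _ :=
  GRing.isSubringClosed.Build (fullmx n) in_cycle4 cycle4_subring.
HB.instance Definition _ :=
  GRing.isScaleClosed.Build C (fullmx n) in_cycle4 cycle4_scale.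

Record cycle4 := Cycle4 {
  cycle4_val :> fullmx n;
  cycle4_valP : cycle4_val \in in_cycle4 }.
HB.instance Definition _ := [isSub for cycle4_val].
HB.instance Definition _ := [Choice of cycle4 by <:].
HB.instance Definition _ := 
  GRing.SubChoice_isSubPzRing.Build _ _ cycle4 (subringClosedP in_cycle4).
HB.instance Definition _ := [SubZmodule_isSubLmodule of cycle4 by <:].

Definition block_projmx (i : 'I_4) : fullmx n := \mxdiag_j (j == i)%:R%:M.

Lemma block_projmx_in i : block_projmx i \in in_cycle4.
Proof.
apply/in_cycle4P=> j k na; rewrite mxblockK; case: eqP => // ejk.
by rewrite ejk /block_allowed eqxx in na.
Qed.

Definition block_proj i : cycle4 := Cycle4 (block_projmx_in i).

End Algebra.

Definition star_hom n n' (F : {linear fullmx n -> fullmx n'}) : Prop :=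
  {morph F : a b / a *m b} /\ {morph F : a / a^t*}.

Definition star_extends n n' (phi : cycle4 n -> cycle4 n')
    (F : {linear fullmx n -> fullmx n'}) : Prop :=
  star_hom F /\ forall a : cycle4 n, F a = phi a.

(* Algebra homomorphisms and *-homomorphisms are not required to preserve the unit. *)
Record starEmb n n' := StarEmb {
  semb :> {linear cycle4 n -> cycle4 n'};
  sembM : {morph semb : a b / a * b};
  semb_inj : injective semb;
  semb_extendible : exists F, star_extends semb F }.

Section Embeddings.
Variables n n' : blockSizes.
Implicit Types phi psi : starEmb n n'.

(* The extension to C*(A), the full matrix algebra, is unique by
   [star_ext_unique], so this choice is harmless. *)
Definition star_ext phi : {linear fullmx n -> fullmx n'} :=
  projT1 (cid (semb_extendible phi)).

Lemma star_extP phi : star_extends phi (star_ext phi).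
Proof. exact: (projT2 (cid (semb_extendible phi))). Qed.

Lemma star_ext_unique (phi : cycle4 n -> cycle4 n') F G :
  star_extends phi F -> star_extends phi G -> F =1 G.
Proof.
move=> [[FM Fs] Fphi] [[GM Gs] Gphi].
pose u0 : 'I_(\sum_i n i) := tagnat.Rank ord0 (Ordinal (bsize_gt0 n ord0)).
pose v0 : 'I_(\sum_i n i) := tagnat.Rank ord_max (Ordinal (bsize_gt0 n ord_max)).
have u0E : tagnat.sig1 u0 = ord0 by rewrite tagnat.Rank1K.
have v0E : tagnat.sig1 v0 = ord_max by rewrite tagnat.Rank1K.
have eqA s t : block_allowed (tagnat.sig1 s) (tagnat.sig1 t) ->
    F (delta_mx s t) = G (delta_mx s t).
  move=> ast; suff in4 : (delta_mx s t : fullmx n) \in @in_cycle4 n.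
    by rewrite (Fphi (Cycle4 in4)) -(Gphi (Cycle4 in4)).
  apply/in_cycle4_entryP=> s' t' na; rewrite mxE.
  by case: eqP => // es; case: eqP => // et; rewrite es et ast in na.
have starD (s t : 'I_(\sum_i n i)) :
    (delta_mx s t : fullmx n)^t* = delta_mx t s.
  by apply/matrixP=> i j; rewrite !mxE conjC_nat andbC.
have eqM a b : F a = G a -> F b = G b -> F (a *m b) = G (a *m b).
  by move=> ea eb; rewrite FM GM ea eb.
have eqS a : F a = G a -> F (a^t*) = G (a^t*) by move=> ea; rewrite Fs Gs ea.
have equ0 t : F (delta_mx u0 t) = G (delta_mx u0 t).
  have [t2|t2] := leqP 2 (tagnat.sig1 t).
    by apply: eqA; rewrite /block_allowed u0E t2 orbT.
  rewrite -(mul_delta_mx v0); apply: eqM.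
    by apply: eqA; rewrite /block_allowed u0E v0E.
  rewrite -starD; apply/eqS/eqA.
  by rewrite /block_allowed v0E t2 orbT.
move=> a; rewrite [a]matrix_sum_delta !linear_sum; apply: eq_bigr => s _.
rewrite !linear_sum; apply: eq_bigr => t _; rewrite !linearZ; congr (_ *: _).
by rewrite -(mul_delta_mx u0); apply: eqM; rewrite // -starD; apply: eqS.
Qed.

(* A *-homomorphism between full matrix algebras is, up to unitary equivalence,
   a |-> a (+) ... (+) a (+) 0; its multiplicity is the number of copies of a.
   The columns of the isometries V k carry these copies. *)
Definition has_multiplicity (F : fullmx n -> fullmx n') (m : nat) : Prop :=
  exists V : 'I_m -> 'M[C]_(\sum_i n' i, \sum_i n i),
    (forall k l, (V k)^t* *m V l = (k == l)%:R%:M) /\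
    (forall a, F a = \sum_(k < m) V k *m a *m (V k)^t*).

Definition multiplicity_one phi : Prop := has_multiplicity (star_ext phi) 1.

(* Orthogonality of operators x, y: x^* y = 0 and x y^* = 0. *)
Definition orthogonal_ranges phi psi : Prop :=
  forall a b, (phi a)^t* *m psi b = 0 /\ phi a *m (psi b)^t* = 0.

Definition orthogonal_sum m (psi : 'I_m -> starEmb n n') phi : Prop :=
  (forall k l, k != l -> orthogonal_ranges (psi k) (psi l)) /\
  (forall a, phi a = \sum_(k < m) psi k a).

Definition regular phi : Prop :=
  exists m (psi : 'I_m -> starEmb n n'),
    (forall k, multiplicity_one (psi k)) /\ orthogonal_sum psi phi.

(* theta preserves {0, 1}, hence also {2, 3}. *)
Definition admissible_type (theta : 'S_4) : Prop :=
  forall i : 'I_4, (theta i < 2)%N = (i < 2)%N.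

Definition rigid_of_type (theta : 'S_4) phi : Prop :=
  [/\ multiplicity_one phi, admissible_type theta &
      forall i j (a : cycle4 n), exists b : cycle4 n',
        phi (block_proj n i * a * block_proj n j) =
        block_proj n' (theta i) * b * block_proj n' (theta j)].

Definition rigid_decomposition m (psi : 'I_m -> starEmb n n')
    (theta : 'I_m -> 'S_4) phi : Prop :=
  (forall k, rigid_of_type (theta k) (psi k)) /\ orthogonal_sum psi phi.

Definition generic phi : Prop :=
  exists m (psi : 'I_m -> starEmb n n') (theta : 'I_m -> 'S_4),
    rigid_decomposition psi theta phi /\
    (forall tau, admissible_type tau -> exists k, theta k = tau).

End Embeddings.

Record genericSystem := GenericSystem {
  gs_size : nat -> blockSizes;
  gs_map : forall k, starEmb (gs_size k) (gs_size k.+1);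
  gs_generic : forall k, generic (gs_map k) }.

Section Limits.
Variable S : genericSystem.

Definition gs_alg (k : nat) : lmodType C := cycle4 (gs_size S k).
Definition gs_star_alg (k : nat) : lmodType C := fullmx (gs_size S k).

Definition gs_lin k : {linear gs_alg k -> gs_alg k.+1} := gs_map S k.
Definition gs_star_lin k : {linear gs_star_alg k -> gs_star_alg k.+1} :=
  star_ext (gs_map S k).

Definition gs_trans k l (le_kl : (k <= l)%N) :
  cycle4 (gs_size S k) -> cycle4 (gs_size S l) := transition gs_lin le_kl.

(* [lim_star_alg] is the limit of the C*(A_k), i.e. of the full matrix
   algebras, and [lim_incl] the inclusion of the limit of the A_k in it. *)
Definition lim_alg : lmodType C := dirlim gs_lin.
Definition lim_star_alg : lmodType C := dirlim gs_star_lin.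

Definition lim_mul : lim_alg -> lim_alg -> lim_alg :=
  dl_op2 (fun k (a b : cycle4 (gs_size S k)) => a * b).

Definition lim_star_mul : lim_star_alg -> lim_star_alg -> lim_star_alg :=
  dl_op2 (fun k (a b : fullmx (gs_size S k)) => a *m b).

Definition lim_star : lim_star_alg -> lim_star_alg :=
  dl_op1 (fun k (a : fullmx (gs_size S k)) => a^t*).

Definition lim_incl : lim_alg -> lim_star_alg :=
  dl_map gs_star_lin (fun k (a : cycle4 (gs_size S k)) => cycle4_val a).

Lemma lim_mulE k (a b : cycle4 (gs_size S k)) :
  lim_mul (dl_in gs_lin a) (dl_in gs_lin b) = dl_in gs_lin (a * b : cycle4 _).
Proof.
by apply: (dl_op2E (op := fun k (a b : cycle4 (gs_size S k)) => a * b))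
  => *; apply: sembM.
Qed.

Lemma lim_star_mulE k (a b : fullmx (gs_size S k)) :
  lim_star_mul (dl_in gs_star_lin a) (dl_in gs_star_lin b) =
  dl_in gs_star_lin (a *m b : fullmx _).
Proof.
apply: (dl_op2E (op := fun k (a b : fullmx (gs_size S k)) => a *m b)) => l x y.
by have [[FM _] _] := star_extP (gs_map S l); apply: FM.
Qed.

Lemma lim_starE k (a : fullmx (gs_size S k)) :
  lim_star (dl_in gs_star_lin a) = dl_in gs_star_lin (a^t* : fullmx _).
Proof.
apply: (dl_op1E (op := fun k (a : fullmx (gs_size S k)) => a^t*)) => l x.
by have [[_ Fs] _] := star_extP (gs_map S l); apply: Fs.
Qed.

Lemma lim_inclE k (a : cycle4 (gs_size S k)) :
  lim_incl (dl_in gs_lin a) = dl_in gs_star_lin (cycle4_val a).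
Proof.
apply: (dl_mapE (h := fun k (a : cycle4 (gs_size S k)) => cycle4_val a)) => l x.
by have [_ Fphi] := star_extP (gs_map S l); apply: Fphi.
Qed.

End Limits.

Definition star_extendibly_isomorphic (S S' : genericSystem) : Prop :=
  exists (h : {linear lim_alg S -> lim_alg S'})
         (H : {linear lim_star_alg S -> lim_star_alg S'}),
    [/\ bijective h /\ (forall u v, h (lim_mul u v) = lim_mul (h u) (h v)),
        bijective H,
        forall u v, H (lim_star_mul u v) = lim_star_mul (H u) (H v),
        forall u, H (lim_star u) = lim_star (H u) &
        forall u, H (lim_incl u) = lim_incl (h u)].

Definition regularly_isomorphic (S S' : genericSystem) : Prop :=
  exists (p q : nat -> nat)
         (p_incr : forall i, (p i < p i.+1)%N)
         (q_incr : forall i, (q i < q i.+1)%N)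
         (f : forall i, starEmb (gs_size S (p i)) (gs_size S' (q i)))
         (g : forall i, starEmb (gs_size S' (q i)) (gs_size S (p i.+1))),
    [/\ forall i, regular (f i),
        forall i, regular (g i),
        forall i a, g i (f i a) = gs_trans (ltnW (p_incr i)) a &
        forall i a, f i.+1 (g i a) = gs_trans (ltnW (q_incr i)) a].

End FourCycle.

(* Main.v *)
(* An embedding of multiplicity m has the form [a |-> V (a (x) 1_m) V^*] with V an
   isometry, and it is determined, up to a unitary of the block diagonal of the
   codomain, by the projections E i j on C^m that describe how the i-th block meets
   the j-th one.  It is regular exactly when these projections commute.

   Suppose that a composite of two embeddings is rigid.  Comparing its projections
   G i k = \sum_j E i j (x) F j k with those of a rigid embedding shows that each
   factor preserves the partition {0, 1}, {2, 3}, and that its projections come from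
   two symmetries s (blocks 0, 1) and t (blocks 2, 3).  The symmetries of the
   composite are s (x) s' and t (x) t'.  Since these commute, s t = c t s and
   s' t' = c t' s' with the same sign c.  Hence either both factors are regular, or
   the symmetries anticommute in both.

   A star extendible isomorphism of the limits yields crossover embeddings, and
   eventually all of them have the same sign.  If c = 1 they are regular.  If c = -1
   then s, t and s t are traceless, so s and t can be replaced by commuting symmetries
   with the same traces as soon as 4 divides the multiplicity.  The traces of s, t and
   s t classify pairs of commuting symmetries up to unitary equivalence, so the
   replaced crossover maps can be corrected one after the other by block diagonal
   unitaries until the diagram commutes again. *)
From HB Require Import structures.
Require Import Defs.
From mathcomp Require Import all_boot all_order all_algebra.
From mathcomp Require Import reals complex.
From mathcomp Require Import perm boolp.
From mathcomp Require mxtens.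
From mathcomp Require Import ring.

Set Implicit Arguments.
Unset Strict Implicit.
Unset Printing Implicit Defensive.

Import Order.TTheory GRing.Theory Num.Theory.
Local Open Scope ring_scope.
Local Open Scope sesquilinear_scope.

(** * Adjoints and projections *)

(** The sign [c] exists because equal elementary tensors have proportional factors: st (x) s't' = ts
    (x) t's' forces st = c ts, and conjugation by s exchanges st and ts, so c^2 = 1. Signs multiply
    under composition and connecting maps have sign 1, so comparing a late crossover map with a
    fixed early one gives the same sign everywhere. The constant 4 counts the joint eigenspaces of a
    commuting pair, which all have dimension m/4 when s, t and st are traceless. Anticommutation
    alone yields an even m only; crossing over three times in a row supplies the missing factor
    without changing the direction. For sign -1 a replaced crossover map need not represent the
    given isomorphism any more; only the composites of consecutive maps are preserved. This is
    possible because both the old and the new composite have commuting symmetries, the old one as a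
    connecting map and the new one because its factors do, and because traces multiply under tensor
    products, so that the two composites have the same invariants. *)

Section Adjoint.
Variable C : numClosedFieldType.

Lemma trmxC_mul m n p (A : 'M[C]_(m, n)) (B : 'M_(n, p)) :
  (A *m B)^t* = B^t* *m A^t*.
Proof. by rewrite trmx_mul map_mxM. Qed.

Lemma trmxCD m n (A B : 'M[C]_(m, n)) : (A + B)^t* = A^t* + B^t*.
Proof. by rewrite linearD map_mxD. Qed.

Lemma trmxCB m n (A B : 'M[C]_(m, n)) : (A - B)^t* = A^t* - B^t*.
Proof. by rewrite linearB /= map_mxB. Qed.

Lemma trmxC_sum m n (I : finType) (P : pred I) (A : I -> 'M[C]_(m, n)) :
  (\sum_(i | P i) A i)^t* = \sum_(i | P i) (A i)^t*.
Proof. by rewrite linear_sum /= map_mx_sum. Qed.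

Lemma trmxCZ m n c (A : 'M[C]_(m, n)) : (c *: A)^t* = c^* *: A^t*.
Proof. by rewrite linearZ /= map_mxZ. Qed.

Lemma trmxC0 m n : (0 : 'M[C]_(m, n))^t* = 0.
Proof. by rewrite trmx0 map_mx0. Qed.

Lemma trmxC1 n : (1%:M : 'M[C]_n)^t* = 1%:M.
Proof. by rewrite trmx1 map_mx1. Qed.

Lemma trmxC_delta m n (i : 'I_m) (j : 'I_n) :
  (delta_mx i j : 'M[C]_(m, n))^t* = delta_mx j i.
Proof. by rewrite trmx_delta map_delta_mx. Qed.

Lemma mulCmx_eq0 m n (A : 'M[C]_(m, n)) : A^t* *m A = 0 -> A = 0.
Proof.
move=> A0; apply/matrixP=> a b; rewrite mxE; apply/eqP.
have /matrixP/(_ b b) := A0; rewrite !mxE => /eqP.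
rewrite psumr_eq0; last by move=> c _; rewrite !mxE mulrC mul_conjC_ge0.
by move=> /allP/(_ a); rewrite mem_index_enum !mxE mulrC mul_conjC_eq0; apply.
Qed.

Definition is_proj n (p : 'M[C]_n) := p^t* = p /\ p *m p = p.

(** Orthonormalizing a row base of [p] gives [S] with the same row space. Hence [S *m p = S] and
    [p *m (S^t* *m S) = p]; the adjoint of the latter reads [S^t* *m S = p]. *)
Lemma proj_isometry n (p : 'M[C]_n) : is_proj p ->
  exists m (X : 'M[C]_(n, m)), X^t* *m X = 1%:M /\ X *m X^t* = p.
Proof.
case=> ph pp; pose S := schmidt (row_base p).
have Su : S *m S^t* = 1%:M.
  by apply/unitarymxP/schmidt_unitarymx/rank_leq_col.
have Sp : (S :=: p)%MS.
  apply: eqmx_trans (eq_row_base p); apply: eqmx_schmidt_free.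
  exact: row_base_free.
exists (\rank p), (S^t*); rewrite trmxCK; split=> //.
have SpS : S *m p = S.
  have [D SD] : exists D, S = D *m p by apply/submxP; rewrite Sp.
  by rewrite SD -mulmxA pp.
have [D pD] : exists D, p = D *m S by apply/submxP; rewrite Sp.
have pq : p *m (S^t* *m S) = p.
  by rewrite {1}pD -mulmxA (mulmxA S) Su mul1mx -pD.
have := congr1 (fun A => A^t*) pq.
by rewrite !trmxC_mul trmxCK ph -mulmxA SpS.
Qed.

Lemma tr_proj_nat n (p : 'M[C]_n) : is_proj p ->
  exists m : nat, \tr p = m%:R.
Proof.
move=> /proj_isometry[m [X [XX <-]]]; exists m.
by rewrite mxtrace_mulC XX mxtrace1.
Qed.

(** In characteristic zero the trace of a projection is its rank, so equal traces give isometries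
    [X], [Y] of the same width, and [Y *m X^t*] is the partial isometry between the two ranges. *)
Lemma proj_tr_equiv n (p q : 'M[C]_n) : is_proj p -> is_proj q ->
  \tr p = \tr q -> exists u : 'M[C]_n, u^t* *m u = p /\ u *m u^t* = q.
Proof.
move=> /proj_isometry[m [X [XX Xp]]] /proj_isometry[m' [Y [YY Yq]]].
rewrite -Xp -Yq (mxtrace_mulC X) (mxtrace_mulC Y) XX YY !mxtrace1 => /eqP.
rewrite eqr_nat => /eqP mm; case: _ / mm in Y YY Yq *.
exists (Y *m X^t*); rewrite trmxC_mul trmxCK; split.
  by rewrite mulmxA -(mulmxA X) YY mulmx1.
by rewrite mulmxA -(mulmxA Y) XX mulmx1.
Qed.

(** Sum of the partial isometries from [p i] to [q i]; orthogonality kills the cross terms. The sums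
    of the families stay unevaluated because the lemma serves both for decompositions of 1, where
    [u] is unitary, and for complements of ranges, where it is only a partial isometry. *)
Lemma proj_family_equiv n (I : finType) (p q : I -> 'M[C]_n) :
    (forall i, is_proj (p i)) -> (forall i, is_proj (q i)) ->
    (forall i j, i != j -> p i *m p j = 0) ->
    (forall i j, i != j -> q i *m q j = 0) ->
    (forall i, \tr (p i) = \tr (q i)) ->
  exists u : 'M[C]_n, [/\ u^t* *m u = \sum_i p i, u *m u^t* = \sum_i q i
    & forall i, u *m p i = q i *m u].
Proof.
move=> pP qP pO qO tpq.
have /fin_all_exists[u uP] i := proj_tr_equiv (pP i) (qP i) (tpq i).
have up i : u i *m p i = u i.
  have [u1 u2] := uP i; apply/eqP; rewrite -subr_eq0; apply/eqP/mulCmx_eq0.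
  rewrite trmxCB trmxC_mul (pP i).1 mulmxBl !mulmxBr -!(mulmxA (p i)).
  by rewrite !(mulmxA (_^t* )) u1 !(pP i).2 !subrr.
have qu i : q i *m u i = u i.
  by have [u1 u2] := uP i; rewrite -u2 -mulmxA u1 up.
have upj i j : u i *m p j = if i == j then u i else 0.
  by case: eqP => [<-|/eqP/pO ij]; rewrite ?up // -{1}(up i) -mulmxA ij mulmx0.
have quj i j : q j *m u i = if i == j then u i else 0.
  case: eqP => [<-|/eqP ij]; first by rewrite qu.
  by rewrite -{1}(qu i) mulmxA qO ?mul0mx // eq_sym.
exists (\sum_i u i); split=> [||i].
- rewrite trmxC_sum mulmx_suml; apply: eq_bigr => i _.
  rewrite mulmx_sumr (bigD1 i) //= big1 ?addr0; first by have [] := uP i.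
  move=> j ji; rewrite -{1}(qu i) trmxC_mul (qP i).1 -mulmxA quj.
  by rewrite (negPf ji) mulmx0.
- rewrite trmxC_sum mulmx_suml; apply: eq_bigr => i _.
  rewrite mulmx_sumr (bigD1 i) //= big1 ?addr0; first by have [] := uP i.
  move=> j ji; rewrite -{1}(up j) trmxC_mul (pP j).1 mulmxA upj.
  by rewrite eq_sym (negPf ji) mul0mx.
rewrite mulmx_suml mulmx_sumr; apply: eq_bigr => j _.
by rewrite upj quj.
Qed.

End Adjoint.

(** * Symmetries *)

Section Symmetries.
Variables (C : numClosedFieldType) (n : nat).
Implicit Types s t p : 'M[C]_n.

Lemma half_double p : 2^-1 *: (p + p) = p.
Proof. by rewrite -mulr2n -scaler_nat scalerA mulVf ?scale1r // pnatr_eq0. Qed.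

Definition is_symmetry s := s^t* = s /\ s *m s = 1%:M.

(** For a symmetry, the spectral projection at the eigenvalue [(-1) ^+ a]. *)
Definition sym_proj s (a : bool) : 'M[C]_n := 2^-1 *: (1%:M + (-1) ^+ a *: s).

Lemma sym_proj_commr s a x : s *m x = x *m s -> sym_proj s a *m x = x *m sym_proj s a.
Proof.
by move=> sx; rewrite -scalemxAl -scalemxAr mulmxDl mulmxDr mul1mx mulmx1
  -scalemxAl -scalemxAr sx.
Qed.

Lemma mul_sym_proj s a : is_symmetry s -> s *m sym_proj s a = (-1) ^+ a *: sym_proj s a.
Proof.
case=> _ ss; rewrite -scalemxAr mulmxDr mulmx1 -scalemxAr ss scalerA mulrC -scalerA.
by congr (_ *: _); rewrite scalerDr scalerA -expr2 sqrr_sign scale1r addrC.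
Qed.

Lemma sum_sym_proj s : sym_proj s false + sym_proj s true = 1%:M.
Proof.
rewrite -scalerDr expr0 expr1 scale1r scaleN1r addrACA subrr addr0.
exact: half_double.
Qed.

Lemma sym_projK s : sym_proj s false - sym_proj s true = s.
Proof.
rewrite -scalerBr expr0 expr1 scale1r scaleN1r opprD opprK addrACA subrr add0r.
exact: half_double.
Qed.

Lemma sym_proj_mul s a b : is_symmetry s ->
  sym_proj s a *m sym_proj s b = if a == b then sym_proj s a else 0.
Proof.
move=> ss; rewrite [sym_proj s a]/sym_proj -scalemxAl mulmxDl mul1mx.
rewrite -scalemxAl mul_sym_proj // scalerA.
case: eqP => [<-|/eqP ab]; first by rewrite -expr2 sqrr_sign scale1r half_double.
suff -> : (-1) ^+ a * (-1) ^+ b = -1 :> C by rewrite scaleN1r subrr scaler0.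
by case: a b ab => [] [] //; rewrite ?expr0 ?expr1 ?mulr1 ?mul1r.
Qed.

Lemma sym_proj_proj s a : is_symmetry s -> is_proj (sym_proj s a).
Proof.
move=> ss; split; last by rewrite sym_proj_mul // eqxx.
rewrite trmxCZ trmxCD trmxC1 trmxCZ ss.1 fmorphV rmorph_nat.
by rewrite rmorphXn rmorphN1.
Qed.

Lemma tr_sym_proj s a : \tr (sym_proj s a) = 2^-1 * (n%:R + (-1) ^+ a * \tr s).
Proof. by rewrite mxtraceZ mxtraceD mxtrace1 mxtraceZ. Qed.

Lemma sym_proj_sym p : is_proj p -> is_symmetry (p + p - 1%:M).
Proof.
case=> ph pp; split; first by rewrite trmxCB trmxCD trmxC1 ph.
rewrite mulmxBr mulmx1 mulmxDr mulmxBl mul1mx mulmxDl pp addrK.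
by rewrite opprB addrCA subrr addr0.
Qed.

(** The joint spectral projections are (1 + a s + b t + ab st) / 4 with signs a, b. The three traces
    thus determine their ranks, and [proj_family_equiv] matches them one by one. *)
Lemma sympair_equiv s t s' t' :
    is_symmetry s -> is_symmetry t -> is_symmetry s' -> is_symmetry t' ->
    s *m t = t *m s -> s' *m t' = t' *m s' ->
    \tr s = \tr s' -> \tr t = \tr t' -> \tr (s *m t) = \tr (s' *m t') ->
  exists u : 'M[C]_n, [/\ u^t* *m u = 1%:M, u *m u^t* = 1%:M,
    u *m s = s' *m u & u *m t = t' *m u].
Proof.
move=> ss st ss' st' cst cst' trs trt trst.
pose e (x y : 'M[C]_n) (i : bool * bool) := sym_proj x i.1 *m sym_proj y i.2.
have eC x y a b : x *m y = y *m x ->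
    sym_proj x a *m sym_proj y b = sym_proj y b *m sym_proj x a.
  by move=> xy; apply/sym_proj_commr/esym/sym_proj_commr.
have eP x y i : is_symmetry x -> is_symmetry y -> x *m y = y *m x -> is_proj (e x y i).
  move=> sx sy cxy; have [xh xx] := sym_proj_proj i.1 sx.
  have [yh yy] := sym_proj_proj i.2 sy; split; first by rewrite trmxC_mul xh yh eC.
  by rewrite /e -mulmxA (mulmxA (sym_proj y _)) -(eC x y) // !mulmxA xx -mulmxA yy.
have eO x y i j : is_symmetry x -> is_symmetry y -> x *m y = y *m x ->
    i != j -> e x y i *m e x y j = 0.
  move=> sx sy cxy; rewrite /e -mulmxA (mulmxA (sym_proj y _)) -(eC x y) // -mulmxA.
  rewrite mulmxA !sym_proj_mul //.
  case: i j => [a b] [c d]; rewrite xpair_eqE negb_and /=.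
  by case: eqP => // _; case: eqP; rewrite ?mulmx0 ?mul0mx.
have eS x y : \sum_i e x y i = 1%:M.
  rewrite -(pair_bigA _ (fun a b => sym_proj x a *m sym_proj y b)) /=.
  have sum1 z : \sum_a sym_proj z a = 1%:M by rewrite big_bool /= addrC sum_sym_proj.
  by rewrite -[RHS](sum1 x); apply: eq_bigr => a _; rewrite -mulmx_sumr sum1 mulmx1.
have etr x y i : \tr (e x y i) =
    4^-1 * (n%:R + (-1) ^+ i.1 * \tr x + (-1) ^+ i.2 * \tr y
      + (-1) ^+ i.1 * (-1) ^+ i.2 * \tr (x *m y)).
  rewrite /e -scalemxAl -scalemxAr scalerA mulmxDl mul1mx mulmxDr mulmx1.
  rewrite -scalemxAl -scalemxAr scalerA mxtraceZ !mxtraceD mxtrace1 !mxtraceZ.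
  by field.
have etr2 i : \tr (e s t i) = \tr (e s' t' i) by rewrite !etr trs trt trst.
have [u [uu uu' ue]] := proj_family_equiv (fun i => eP s t i ss st cst)
   (fun i => eP s' t' i ss' st' cst') (fun i j => @eO s t i j ss st cst)
   (fun i j => @eO s' t' i j ss' st' cst') etr2.
rewrite !eS in uu uu'; exists u; split=> //.
- have sE x y : is_symmetry x -> x = \sum_(i : bool * bool) (-1) ^+ i.1 *: e x y i.
    move=> sx; rewrite -{1}[x]mulmx1 -(eS x y) mulmx_sumr; apply: eq_bigr => i _.
    by rewrite mulmxA mul_sym_proj // scalemxAl.
  rewrite {1}(sE s t ss) (sE s' t' ss') mulmx_sumr mulmx_suml.
  by apply: eq_bigr => i _; rewrite -scalemxAr -scalemxAl ue.
have tE x y : is_symmetry y -> x *m y = y *m x ->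
    y = \sum_(i : bool * bool) (-1) ^+ i.2 *: e x y i.
  move=> sy cxy; rewrite -{1}[y]mulmx1 -(eS x y) mulmx_sumr; apply: eq_bigr => i _.
  by rewrite /e eC // mulmxA mul_sym_proj // scalemxAl.
rewrite {1}(tE s t st cst) (tE s' t' st' cst') mulmx_sumr mulmx_suml.
by apply: eq_bigr => i _; rewrite -scalemxAr -scalemxAl ue.
Qed.

(** As [s] and [t] commute, s + i t is normal. A unitary that diagonalizes it also diagonalizes its
    adjoint s - i t, hence [s] and [t], which are linear combinations of the two. *)
Lemma sympair_diag s t : is_symmetry s -> is_symmetry t -> s *m t = t *m s ->
  exists u : 'M[C]_n, [/\ u^t* *m u = 1%:M, u *m u^t* = 1%:M,
    is_diag_mx (u^t* *m s *m u) & is_diag_mx (u^t* *m t *m u)].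
Proof.
move=> [sh ss] [th tt] cst; pose N := s + 'i *: t.
have Nh : N^t* = s - 'i *: t by rewrite trmxCD trmxCZ sh th conjCi scaleNr.
have Nn : N \is normalmx.
  apply/normalmxP; rewrite Nh !mulmxDl !mulmxDr !mulmxN !mulNmx -!scalemxAl -!scalemxAr.
  by rewrite cst !addrA subrK addrK.
have [Pu D] := (spectral_unitarymx N, orthomx_spectralP Nn).
set P := spectralmx N in Pu D; rewrite invmx_unitary // in D.
have PP : P *m P^t* = 1%:M by apply/unitarymxP.
have PP' : P^t* *m P = 1%:M by apply: mulmx1C.
have diagN : is_diag_mx (P *m N *m P^t* ).
  by rewrite D !mulmxA PP mul1mx -mulmxA PP mulmx1 diag_mx_is_diag.
have diagN' : is_diag_mx (P *m N^t* *m P^t* ).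
  have -> : P *m N^t* *m P^t* = (P *m N *m P^t* )^t* by rewrite !trmxC_mul trmxCK mulmxA.
  by apply/is_diag_mxP=> i j ij; rewrite 2!mxE (is_diag_mxP diagN) ?conjC0 // eq_sym.
have lin c d : is_diag_mx (P *m (c *: N + d *: N^t* ) *m P^t* ).
  apply/is_diag_mxP=> i j ij; rewrite mulmxDr mulmxDl -!scalemxAr -!scalemxAl.
  rewrite mxE [X in X + _]mxE [X in _ + X]mxE.
  by rewrite (is_diag_mxP diagN) // mulr0 add0r (is_diag_mxP diagN') // mulr0.
exists (P^t* ); rewrite trmxCK; split=> //.
  have -> : s = 2^-1 *: N + 2^-1 *: N^t*.
    by rewrite Nh -scalerDr addrACA subrr addr0 (half_double s).
  exact: lin.
have -> : t = (2^-1 * - 'i) *: N + (2^-1 * 'i) *: N^t*.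
  rewrite Nh -!scalerA -scalerDr !scalerDr addrACA !scaleNr scalerN addNr add0r.
  rewrite !scalerA -expr2 sqrCi !scaleN1r !opprK scalerN scalerA -mulrA -expr2 sqrCi.
  by rewrite mulrN1 scaleNr opprK -scalerDr half_double.
exact: lin.
Qed.

(** The eigenvalue 1 has multiplicity n / 2, and this is a natural number. *)
Lemma symmetry_tr0_even s : is_symmetry s -> \tr s = 0 -> ~~ odd n.
Proof.
move=> ss s0; have [m] := tr_proj_nat (sym_proj_proj false ss).
rewrite tr_sym_proj s0 mulr0 addr0 => /(congr1 ( *%R 2)).
rewrite mulrA divff ?pnatr_eq0 // mul1r -natrM => /eqP.
by rewrite eqr_nat => /eqP->; rewrite oddM.
Qed.

(** Conjugation by [t] turns [s] into [- s]. *)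
Lemma anticomm_tr0 s t : is_symmetry s -> is_symmetry t -> s *m t = - (t *m s) ->
  \tr s = 0.
Proof.
move=> [_ ss] [_ tt] st; apply/eqP; rewrite -[_ == 0](mulrn_eq0 _ 2) mulr2n.
rewrite -{1}[s]mulmx1 -tt mulmxA st mulNmx raddfN /= mxtrace_mulC mulmxA tt mul1mx.
by rewrite addNr.
Qed.

Lemma anticomm_tr_mul0 s t : s *m t = - (t *m s) -> \tr (s *m t) = 0.
Proof.
move=> st; apply/eqP; rewrite -[_ == 0](mulrn_eq0 _ 2) mulr2n {1}st.
by rewrite raddfN /= mxtrace_mulC addNr.
Qed.

End Symmetries.

(** The signs of the two diagonal matrices are the last two binary digits of the index. Each run of
    four indices shows all four pairs of signs, so [s], [t] and their product sum to zero on it. *)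
Lemma standard_sympair (C : numClosedFieldType) n : (4 %| n)%N ->
  exists s t : 'M[C]_n, [/\ is_symmetry s, is_symmetry t, s *m t = t *m s &
   [/\ \tr s = 0, \tr t = 0 & \tr (s *m t) = 0]].
Proof.
pose d (e : nat -> bool) : 'M[C]_n := diag_mx (\row_(k < n) (-1) ^+ e k).
have dM e e' : d e *m d e' = d (fun k => e k (+) e' k).
  rewrite mulmx_diag; congr diag_mx; apply/rowP=> k.
  by rewrite !mxE signr_addb.
have dS e : is_symmetry (d e).
  split; last by rewrite dM /d -diag_const_mx; congr diag_mx; apply/rowP=> k; rewrite !mxE addbb.
  rewrite tr_diag_mx map_diag_mx; congr diag_mx; apply/rowP=> k.
  by rewrite !mxE rmorphXn rmorphN1.
have dtr e : \tr (d e) = \sum_(0 <= k < n) (-1) ^+ e k.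
  by rewrite mxtrace_diag big_mkord; apply: eq_bigr => k _; rewrite mxE.
move=> /dvdnP[q nE].
have tr0 (e : nat -> bool) : (forall k, e k.+4 = e k) ->
    (-1) ^+ e 0 + (-1) ^+ e 1 + (-1) ^+ e 2 + (-1) ^+ e 3 = 0 :> C -> \tr (d e) = 0.
  move=> e4 e0; rewrite dtr nE; elim: q {nE} => [|q IHq]; first by rewrite big_nil.
  have eq4 j : e (q * 4 + j)%N = e j by elim: (q) => // i; rewrite mulSn -addnA e4.
  rewrite mulSn addnC !addnS addn0 !big_nat_recr ?leq_addr //= IHq add0r.
  rewrite -{1}[(q * 4)%N]addn0 -[X in e X.+1]addn0 -[X in e X.+2]addn0.
  by rewrite -[X in e X.+3]addn0 -!addnS !eq4.
exists (d odd), (d (fun k => odd k./2)); split => //; try exact: dS.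
  by rewrite !dM; congr d; apply/funext=> k; rewrite addbC.
have od k : odd (uphalf k) = (odd k./2 (+) odd k) by rewrite uphalf_half oddD addbC; case: (odd k).
rewrite dM; split; apply: tr0 => [k|] /=; rewrite ?expr0 ?expr1 ?negbK //; try by ring.
Qed.

(** * Tensor products *)

Notation mxtens_index := mxtens.mxtens_index.
Notation "A *t B" := (mxtens.tensmx A B)
  (at level 40, left associativity, format "A  *t  B").

Section Tensor.
Variable C : numClosedFieldType.

Lemma tensmx_eqP m n p q (A B : 'M[C]_(m * p, n * q)) :
  (forall i j k l, A (mxtens_index (i, k)) (mxtens_index (j, l)) =
     B (mxtens_index (i, k)) (mxtens_index (j, l))) <-> A = B.
Proof.
split=> [AB|-> //]; apply/matrixP=> x y.
case: (mxtens.mxtens_indexP x) => i k; case: (mxtens.mxtens_indexP y) => j l.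
exact: AB.
Qed.

Lemma trmxC_tens m n p q (A : 'M[C]_(m, n)) (B : 'M_(p, q)) :
  (A *t B)^t* = A^t* *t B^t*.
Proof. by rewrite mxtens.trmx_tens mxtens.map_mxT. Qed.

Lemma tensmx_mul m n p q m' n' (A : 'M[C]_(m, n)) (A' : 'M_(n, p))
    (B : 'M_(q, m')) (B' : 'M_(m', n')) :
  (A *t B) *m (A' *t B') = (A *m A') *t (B *m B').
Proof. exact: mxtens.tensmx_mul. Qed.

Lemma tensmxDl m n p q (A A' : 'M[C]_(m, n)) (B : 'M_(p, q)) :
  (A + A') *t B = A *t B + A' *t B.
Proof. by apply/tensmx_eqP=> i j k l; rewrite !(mxE, mxtens.mxtens_indexK) mulrDl. Qed.

Lemma tensmxDr m n p q (A : 'M[C]_(m, n)) (B B' : 'M_(p, q)) :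
  A *t (B + B') = A *t B + A *t B'.
Proof. by apply/tensmx_eqP=> i j k l; rewrite !(mxE, mxtens.mxtens_indexK) mulrDr. Qed.

Lemma tensmxZl m n p q c (A : 'M[C]_(m, n)) (B : 'M_(p, q)) :
  (c *: A) *t B = c *: (A *t B).
Proof. by apply/tensmx_eqP=> i j k l; rewrite !(mxE, mxtens.mxtens_indexK) mulrA. Qed.

Lemma tensmxZr m n p q c (A : 'M[C]_(m, n)) (B : 'M_(p, q)) :
  A *t (c *: B) = c *: (A *t B).
Proof. by apply/tensmx_eqP=> i j k l; rewrite !(mxE, mxtens.mxtens_indexK) mulrCA. Qed.

Lemma tensmxNl m n p q (A : 'M[C]_(m, n)) (B : 'M_(p, q)) : (- A) *t B = - (A *t B).
Proof. by rewrite -!scaleN1r tensmxZl. Qed.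

Lemma tensmxNr m n p q (A : 'M[C]_(m, n)) (B : 'M_(p, q)) : A *t (- B) = - (A *t B).
Proof. by rewrite -!scaleN1r tensmxZr. Qed.

Lemma tensmx_suml m n p q (I : finType) (P : pred I) (A : I -> 'M[C]_(m, n)) (B : 'M_(p, q)) :
  (\sum_(i | P i) A i) *t B = \sum_(i | P i) A i *t B.
Proof.
elim/big_rec2: _ => [|i x y _ <-]; first exact: mxtens.tens0mx.
exact: tensmxDl.
Qed.

Lemma tensmx_sumr m n p q (I : finType) (P : pred I) (A : 'M[C]_(m, n)) (B : I -> 'M_(p, q)) :
  A *t (\sum_(i | P i) B i) = \sum_(i | P i) A *t B i.
Proof.
elim/big_rec2: _ => [|i x y _ <-]; first exact: mxtens.tensmx0.
exact: tensmxDr.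
Qed.

Lemma tensmx11 m n : (1%:M : 'M[C]_m) *t (1%:M : 'M_n) = 1%:M.
Proof.
apply/tensmx_eqP=> i j k l.
rewrite mxtens.tensmxE !mxE (inj_eq (can_inj (@mxtens.mxtens_indexK _ _))).
by rewrite -natrM mulnb xpair_eqE.
Qed.

Lemma tensmx_eq0 m n p q (A : 'M[C]_(m, n)) (B : 'M_(p, q)) :
  A *t B = 0 -> A = 0 \/ B = 0.
Proof.
move=> AB; have [->|/matrix0Pn[k [l Bkl]]] := eqVneq B 0; first by right.
left; apply/matrixP=> i j; apply/eqP; rewrite mxE -(mulIr_eq0 _ (mulIf Bkl)).
have /tensmx_eqP/(_ i j k l) := AB.
by rewrite mxtens.tensmxE mxE => ->.
Qed.

Lemma mxtrace_tens m n (A : 'M[C]_m) (B : 'M_n) : \tr (A *t B) = \tr A * \tr B.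
Proof.
rewrite /mxtrace big_distrlr pair_big /=.
rewrite (reindex (@mxtens_index m n)) /=; last first.
  by exists (@mxtens.mxtens_unindex m n) => x _;
     [apply: mxtens.mxtens_indexK | apply: mxtens.mxtens_unindexK].
by apply: eq_bigr => -[i j] _; rewrite mxtens.tensmxE.
Qed.

Lemma tensmxA m1 n1 m2 n2 m3 n3 (A : 'M[C]_(m1, n1)) (B : 'M_(m2, n2)) (D : 'M_(m3, n3)) :
  castmx (esym (mulnA m1 m2 m3), esym (mulnA n1 n2 n3)) ((A *t B) *t D) = A *t (B *t D).
Proof.
have castE m n p (i : 'I_m) (j : 'I_n) (k : 'I_p) :
    cast_ord (esym (esym (mulnA m n p))) (mxtens_index (i, mxtens_index (j, k))) =
    mxtens_index (mxtens_index (i, j), k).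
  by apply/val_inj; rewrite /= mulnDl mulnA addnA.
apply/tensmx_eqP=> i1 j1 x y.
case: (mxtens.mxtens_indexP x) => i2 i3; case: (mxtens.mxtens_indexP y) => j2 j3.
by rewrite castmxE /= !castE !mxtens.tensmxE mulrA.
Qed.

End Tensor.

(** * Block projections *)

Section BlockProj.
Variables (C : numClosedFieldType) (n : blockSizes).
Local Notation r := (\sum_i bsize n i)%N.
Local Notation Q := (block_projmx C n).

Lemma block_projmxE i s t : Q i s t = ((s == t) && (tagnat.sig1 s == i))%:R.
Proof.
pose B : 'M[C]_r := \matrix_(s, t) ((s == t) && (tagnat.sig1 s == i))%:R.
suff -> : Q i = B by rewrite mxE.
rewrite -[B]submxblockK; apply/eq_mxblock => j k; apply/matrixP=> a b.
rewrite !mxE tagnat.Rank1K; case: eqP => [jk|jk].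
  case: _ / jk in b *; rewrite conform_mx_id !mxE.
  have -> : (tagnat.Rank j a == tagnat.Rank j b) = (a == b).
    by rewrite /tagnat.Rank (inj_eq (@tagnat.rank_inj _ _)) eq_Tagged.
  by rewrite mulrb; case: (a == b).
rewrite mxE; case: eqP => // /(congr1 (fun x => tagnat.sig1 x)).
by rewrite !tagnat.Rank1K.
Qed.

Lemma block_projmxC i : (Q i)^t* = Q i.
Proof.
apply/matrixP=> s t; rewrite 2!mxE !block_projmxE conjC_nat eq_sym.
by case: eqP => // ->.
Qed.

Lemma block_proj_mul i (A : 'M[C]_r) s t : (Q i *m A) s t = (tagnat.sig1 s == i)%:R * A s t.
Proof.
rewrite mxE (bigD1 s) //= [X in _ + X]big1 ?addr0 ?block_projmxE ?eqxx //= => k ks.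
by rewrite block_projmxE eq_sym (negPf ks) mul0r.
Qed.

Lemma mul_block_proj i (A : 'M[C]_r) s t : (A *m Q i) s t = A s t * (tagnat.sig1 t == i)%:R.
Proof.
rewrite mxE (bigD1 t) //= [X in _ + X]big1 ?addr0 ?block_projmxE ?eqxx //= => k ks.
by rewrite block_projmxE (negPf ks) mulr0.
Qed.

Lemma block_projM i j : Q i *m Q j = if i == j then Q i else 0.
Proof.
apply/matrixP=> s t; rewrite block_proj_mul block_projmxE.
have [<-|ne] := eqVneq i j; first by rewrite block_projmxE -natrM mulnb andbCA andbb.
rewrite mxE; have [->|] := eqVneq (tagnat.sig1 s) i; last by rewrite mul0r.
by rewrite (negPf ne) andbF mulr0.
Qed.

Lemma sum_block_proj : \sum_i Q i = 1%:M.
Proof.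
apply/matrixP=> s t; rewrite summxE (bigD1 (tagnat.sig1 s)) //= [X in _ + X]big1 => [|i ne].
  by rewrite addr0 block_projmxE eqxx andbT mxE.
by rewrite block_projmxE [tagnat.sig1 s == i]eq_sym (negPf ne) andbF.
Qed.

Definition block_index (i : 'I_4) : 'I_r := tagnat.Rank i (Ordinal (bsize_gt0 n i)).

Lemma sig1_block_index i : tagnat.sig1 (block_index i) = i.
Proof. by rewrite /block_index tagnat.Rank1K. Qed.

Lemma block_projP (a : 'M[C]_r) :
  reflect (forall i j, ~~ block_allowed i j -> Q i *m a *m Q j = 0) (a \in @in_cycle4 C n).
Proof.
apply: (iffP (in_cycle4_entryP a)) => [H i j na|H s t na].
  apply/matrixP=> s t; rewrite mul_block_proj block_proj_mul mxE.
  case: eqP => [si|]; last by rewrite !mul0r.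
  case: eqP => [tj|]; last by rewrite mulr0.
  by rewrite H ?si ?tj // mulr0 mul0r.
have /matrixP/(_ s t) := H _ _ na.
by rewrite mul_block_proj block_proj_mul !eqxx mul1r mulr1 mxE.
Qed.

(** [block_allowed] holds in both directions only on the diagonal, so a matrix that lies in the
    algebra together with its adjoint is block diagonal. *)
Lemma cycle4_diag_comm (a : 'M[C]_r) j :
  a \in @in_cycle4 C n -> a^t* \in @in_cycle4 C n -> Q j *m a = a *m Q j.
Proof.
move=> /in_cycle4_entryP aA /in_cycle4_entryP aA'; apply/matrixP=> s t.
rewrite block_proj_mul mul_block_proj.
have [->|ne] := eqVneq (tagnat.sig1 s) (tagnat.sig1 t); first by rewrite mulrC.
suff -> : a s t = 0 by rewrite mul0r mulr0.
have [|] := boolP (block_allowed (tagnat.sig1 s) (tagnat.sig1 t)); last exact: aA.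
rewrite /block_allowed (negPf ne) /= => /andP[s2 t2]; apply/eqP.
have := aA' t s; rewrite 2!mxE => /(_ _)/eqP; rewrite conjC_eq0; apply.
by rewrite /block_allowed eq_sym (negPf ne) /= ltnNge t2.
Qed.

Lemma cycle4_delta s t : block_allowed (tagnat.sig1 s) (tagnat.sig1 t) ->
  (delta_mx s t : 'M[C]_r) \in @in_cycle4 C n.
Proof.
move=> ast; apply/in_cycle4_entryP=> s' t' na; rewrite mxE.
by case: eqP => // es; case: eqP => // et; rewrite es et ast in na.
Qed.

Lemma block_tens_inj m (A B : 'I_4 -> 'M[C]_m) :
  \sum_i Q i *t A i = \sum_i Q i *t B i -> A =1 B.
Proof.
move=> AB i; apply/matrixP=> k l.
have /tensmx_eqP/(_ (block_index i) (block_index i) k l) := AB.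
suff E D : (\sum_j Q j *t D j) (mxtens_index (block_index i, k)) (mxtens_index (block_index i, l))
  = (D i : 'M[C]_m) k l by rewrite !E.
rewrite summxE (bigD1 i) //= [X in _ + X]big1 => [|j ji].
  by rewrite addr0 mxtens.tensmxE block_projmxE sig1_block_index !eqxx mul1r.
by rewrite mxtens.tensmxE block_projmxE sig1_block_index [i == j]eq_sym (negPf ji) andbF mul0r.
Qed.

Lemma block_tens_mul m (A B : 'I_4 -> 'M[C]_m) :
  (\sum_i Q i *t A i) *m (\sum_i Q i *t B i) = \sum_i Q i *t (A i *m B i).
Proof.
rewrite mulmx_suml; apply: eq_bigr => i _; rewrite mulmx_sumr [LHS](bigD1 i) //=.
rewrite [X in _ + X]big1 => [|j ji]; rewrite tensmx_mul block_projM ?eqxx ?addr0 //.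
by rewrite eq_sym (negPf ji) mxtens.tens0mx.
Qed.

Lemma block_tensC m (A : 'I_4 -> 'M[C]_m) :
  (\sum_i Q i *t A i)^t* = \sum_i Q i *t (A i)^t*.
Proof.
by rewrite trmxC_sum; apply: eq_bigr => i _; rewrite trmxC_tens block_projmxC.
Qed.

Lemma block_tens1 m : \sum_i Q i *t (1%:M : 'M[C]_m) = 1%:M.
Proof. by rewrite -tensmx_suml sum_block_proj tensmx11. Qed.

(** Commuting with [delta_mx s s] kills the coefficients between different basis vectors; commuting
    with [delta_mx s t] makes those at [s] and [t] equal, so one matrix per block remains. *)
Lemma block_diag_commutant m (M : 'M[C]_(r * m)) :
    (forall s t, tagnat.sig1 s = tagnat.sig1 t ->
       (delta_mx s t *t 1%:M) *m M = M *m (delta_mx s t *t 1%:M)) ->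
  exists E : 'I_4 -> 'M[C]_m, M = \sum_i Q i *t E i.
Proof.
move=> comm.
have lE s t s' t' k l : ((delta_mx s t *t 1%:M) *m M)
    (mxtens_index (s', k)) (mxtens_index (t', l)) =
    (s' == s)%:R * M (mxtens_index (t, k)) (mxtens_index (t', l)).
  rewrite mxE (bigD1 (mxtens_index (t, k))) //= [X in _ + X]big1 => [|x].
    by rewrite addr0 mxtens.tensmxE !mxE !eqxx andbT mulr1.
  case: (mxtens.mxtens_indexP x) => a b.
  rewrite (inj_eq (can_inj (@mxtens.mxtens_indexK _ _))) xpair_eqE mxtens.tensmxE !mxE => ab.
  case: (s' =P s) => _; rewrite ?mul0r //=; case: (a =P t) ab => //= _ bk; rewrite ?mul0r //.
  by rewrite eq_sym (negPf bk) mulr0 mul0r.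
have rE s t s' t' k l : (M *m (delta_mx s t *t 1%:M))
    (mxtens_index (s', k)) (mxtens_index (t', l)) =
    M (mxtens_index (s', k)) (mxtens_index (s, l)) * (t' == t)%:R.
  rewrite mxE (bigD1 (mxtens_index (s, l))) //= [X in _ + X]big1 => [|x].
    by rewrite addr0 mxtens.tensmxE !mxE !eqxx mulr1.
  case: (mxtens.mxtens_indexP x) => a b.
  rewrite (inj_eq (can_inj (@mxtens.mxtens_indexK _ _))) xpair_eqE mxtens.tensmxE !mxE => ab.
  case: (t' =P t) => _; rewrite ?andbF ?mul0r ?mulr0 //= andbT.
  case: (a =P s) ab => //= _ bl; rewrite ?mul0r ?mulr0 //.
  by rewrite (negPf bl) mulr0 mulr0.
have E1 s t k l : tagnat.sig1 s = tagnat.sig1 t ->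
    M (mxtens_index (t, k)) (mxtens_index (t, l)) = M (mxtens_index (s, k)) (mxtens_index (s, l)).
  move=> /comm/tensmx_eqP/(_ s t k l); rewrite lE rE !eqxx mul1r mulr1 //.
have E0 s t k l : s != t -> M (mxtens_index (s, k)) (mxtens_index (t, l)) = 0.
  move=> st; have /tensmx_eqP/(_ s t k l) := comm s s erefl.
  by rewrite lE rE !eqxx mul1r eq_sym (negPf st) mulr0.
exists (fun i => \matrix_(k, l)
  M (mxtens_index (block_index i, k)) (mxtens_index (block_index i, l))).
apply/tensmx_eqP => s t k l; rewrite summxE [RHS](bigD1 (tagnat.sig1 s)) //=.
rewrite [X in _ + X]big1 => [|j js].
  rewrite addr0 mxtens.tensmxE block_projmxE eqxx andbT mxE.
  have [<-|st] := eqVneq s t; last by rewrite mul0r E0.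
  by rewrite mul1r; apply: E1; rewrite sig1_block_index.
by rewrite mxtens.tensmxE block_projmxE [_ == j]eq_sym (negPf js) andbF mul0r.
Qed.

End BlockProj.

(** * Embeddings as amplifications *)

Section Structure.
Variable C : numClosedFieldType.

(** The operator e_i^* (x) 1, typed with [p] rows in place of [1 * p]. *)
Definition tens_row m p (i : 'I_m) : 'M[C]_(p, m * p) :=
  \matrix_(k, x) (x == mxtens_index (i, k))%:R.

Lemma mul_tens_row m n p q (A : 'M[C]_(m, n)) (B : 'M_(p, q)) i j :
  tens_row p i *m (A *t B) *m (tens_row q j)^t* = A i j *: B.
Proof.
apply/matrixP=> k l; rewrite mxE [LHS](bigD1 (mxtens_index (j, l))) //=.
rewrite [X in _ + X]big1 => [|x ne]; last by rewrite !mxE (negPf ne) conjC0 mulr0.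
rewrite addr0 [X in _ * X]mxE [X in Num.conj X]mxE [X in Num.conj X]mxE eqxx conjC1 mulr1 mxE.
rewrite [LHS](bigD1 (mxtens_index (i, k))) //=.
rewrite [X in _ + X]big1 => [|x ne]; last by rewrite mxE (negPf ne) mul0r.
by rewrite addr0 mxtens.tensmxE !mxE eqxx mul1r.
Qed.

Lemma sum_tens_row m p : \sum_i (tens_row p i)^t* *m tens_row p i = 1%:M :> 'M_(m * p).
Proof.
apply/matrixP=> x y; rewrite summxE.
case: (mxtens.mxtens_indexP x) => a b; case: (mxtens.mxtens_indexP y) => c d.
rewrite [LHS](bigD1 a) //= [X in _ + X]big1 => [|i ia].
  rewrite addr0 mxE [LHS](bigD1 b) //= [X in _ + X]big1 => [|k kb].
    by rewrite addr0 !mxE eqxx conjC1 mul1r eq_sym.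
  rewrite !mxE (inj_eq (can_inj (@mxtens.mxtens_indexK _ _))) xpair_eqE.
  by rewrite [b == k]eq_sym (negPf kb) andbF conjC0 mul0r.
rewrite mxE [LHS]big1 // => k _.
rewrite !mxE (inj_eq (can_inj (@mxtens.mxtens_indexK _ _))) xpair_eqE.
by rewrite [a == i]eq_sym (negPf ia) conjC0 mul0r.
Qed.

(** Let [X] be an isometry onto the range of the projection [F (delta_mx u u)]. The partial isometry
    [F (delta_mx t u)] carries this range to that of [F (delta_mx t t)], and the pieces for all [t]
    assemble to [V]; the multiplicity is the rank of [F (delta_mx u u)]. *)
Lemma star_hom_isometry N N' (F : {linear 'M[C]_N -> 'M[C]_N'}) :
    (0 < N)%N -> {morph F : a b / a *m b} -> {morph F : a / a^t*} ->
  exists m (V : 'M[C]_(N', N * m)),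
    V^t* *m V = 1%:M /\ forall a, F a = V *m (a *t 1%:M) *m V^t*.
Proof.
case: N F => // N F _ FM Fs; pose u : 'I_N.+1 := ord0.
have Fd s t u' v : F (delta_mx s t) *m F (delta_mx u' v) = (t == u')%:R *: F (delta_mx s v).
  by rewrite -FM mul_delta_mx_cond -linearZ /= scaler_nat.
have pP : is_proj (F (delta_mx u u)).
  by split; rewrite -?Fs ?trmxC_delta // Fd eqxx scale1r.
have [m [X [XX Xp]]] := proj_isometry pP.
exists m, (\sum_t F (delta_mx t u) *m X *m tens_row m t); split.
  rewrite trmxC_sum mulmx_suml -sum_tens_row; apply: eq_bigr => s _.
  rewrite mulmx_sumr [LHS](bigD1 s) //= [X in _ + X]big1 => [|t ts].
    rewrite addr0 !trmxC_mul -Fs trmxC_delta !mulmxA -(mulmxA (_ *m X^t* )) Fd eqxx scale1r -Xp.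
    by rewrite -!mulmxA (mulmxA (X^t* )) XX mul1mx !mulmxA -(mulmxA _ (X^t* )) XX mulmx1.
  rewrite !trmxC_mul -Fs trmxC_delta !mulmxA -(mulmxA (_ *m X^t* )) Fd eq_sym (negPf ts).
  by rewrite scale0r mulmx0 !mul0mx.
move=> a; rewrite {1}[a]matrix_sum_delta linear_sum /= !mulmx_suml.
apply: eq_bigr => s _; rewrite linear_sum trmxC_sum mulmx_sumr; apply: eq_bigr => t _.
rewrite !trmxC_mul !mulmxA -(mulmxA _ (tens_row m s)) -(mulmxA _ (_ *m _) ((tens_row m t)^t* )).
rewrite mul_tens_row linearZ /= -scalemxAr mulmx1 -!scalemxAl; congr (_ *: _).
by rewrite -!mulmxA (mulmxA X) Xp -Fs trmxC_delta mulmxA Fd eqxx scale1r Fd eqxx scale1r.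
Qed.

End Structure.

Section Amplification.
Variable C : numClosedFieldType.
Variables N N' m : nat.
Variable V : 'M[C]_(N', N * m).

Definition amplify (a : 'M[C]_N) : 'M[C]_N' := V *m (a *t 1%:M) *m V^t*.

Lemma amplify_is_linear : linear amplify.
Proof.
move=> c a b; rewrite /amplify tensmxDl tensmxZl mulmxDr mulmxDl.
by rewrite -scalemxAr -scalemxAl.
Qed.
HB.instance Definition _ := GRing.isLinear.Build C 'M[C]_N 'M[C]_N' _ amplify amplify_is_linear.

Hypothesis Viso : V^t* *m V = 1%:M.

Lemma amplifyM : {morph amplify : a b / a *m b}.
Proof.
move=> a b; rewrite /amplify -{1}[1%:M]mulmx1 -tensmx_mul !mulmxA.
by rewrite -[X in _ = X *m _ *m _]mulmxA Viso mulmx1.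
Qed.

Lemma amplifyC : {morph amplify : a / a^t*}.
Proof. by move=> a; rewrite /amplify !trmxC_mul trmxCK trmxC_tens trmxC1 mulmxA. Qed.

Lemma amplifyK a : V^t* *m amplify a *m V = a *t 1%:M.
Proof. by rewrite /amplify !mulmxA Viso mul1mx -mulmxA Viso mulmx1. Qed.

End Amplification.

Section Models.
Variable C : numClosedFieldType.
Local Notation fullmx n := 'M[C]_(\sum_i bsize n i).
Local Notation r n := (\sum_i bsize n i)%N.
Local Notation Q n := (block_projmx C n).

(** [phi] is a bare function, so that composites have models without being repackaged as
    [starEmb]. *)
Record model n n' (phi : cycle4 C n -> cycle4 C n') m (V : 'M[C]_(r n', r n * m))
    (E : 'I_4 -> 'I_4 -> 'M[C]_m) : Prop := Model {
  model_iso : V^t* *m V = 1%:M;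
  modelE : forall a, phi a = amplify V a :> fullmx n';
  model_coef : forall j, V^t* *m Q n' j *m V = \sum_i Q n i *t E i j }.

Lemma amplify_star_hom n n' m (V : 'M[C]_(r n', r n * m)) : V^t* *m V = 1%:M ->
  star_hom (amplify V : {linear fullmx n -> fullmx n'}).
Proof. by move=> Viso; split; [exact: amplifyM | exact: amplifyC]. Qed.

Lemma star_extE n n' (phi : starEmb C n n') m (V : 'M[C]_(r n', r n * m)) :
    V^t* *m V = 1%:M -> (forall a, phi a = amplify V a :> fullmx n') ->
  star_ext phi =1 amplify V.
Proof.
move=> Viso VE; apply: star_ext_unique (star_extP phi) _.
by split; [exact: amplify_star_hom | move=> a /=; rewrite VE].
Qed.

Lemma sum_bsize_gt0 (n : blockSizes) : (0 < r n)%N.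
Proof. by apply: leq_ltn_trans (ltn_ord (block_index n ord0)). Qed.

(** Images of block diagonal matrix units lie in the algebra together with their adjoints, hence
    commute with [Q n' j]. The compression of [Q n' j] by [V] therefore commutes with the amplified
    block diagonal, and [block_diag_commutant] gives its coefficients. *)
Lemma model_exists n n' (phi : starEmb C n n') : exists m V E, @model n n' phi m V E.
Proof.
have [[FM Fs] Fphi] := star_extP phi.
have [m [V [Viso FV]]] := star_hom_isometry (sum_bsize_gt0 n) FM Fs.
have /fin_all_exists[E EP] j : exists E : 'I_4 -> 'M[C]_m,
    V^t* *m Q n' j *m V = \sum_i Q n i *t E i.
  apply: block_diag_commutant => s t st.
  have Fin x y : tagnat.sig1 x = tagnat.sig1 y -> star_ext phi (delta_mx x y) \in @in_cycle4 C n'.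
    move=> xy; have a : block_allowed (tagnat.sig1 x) (tagnat.sig1 y).
      by rewrite xy /block_allowed eqxx.
    by rewrite (Fphi (Cycle4 (cycle4_delta C a))) cycle4_valP.
  have := @cycle4_diag_comm _ _ (star_ext phi (delta_mx s t)) j (Fin s t st).
  rewrite -Fs trmxC_delta => /(_ (Fin t s (esym st))); rewrite FV => c.
  have := congr1 (fun x => V^t* *m x *m V) c.
  by rewrite /= !mulmxA Viso mul1mx -!mulmxA Viso mulmx1 !mulmxA => ->.
exists m, V, (fun i j => E j i); split=> // a.
by rewrite -Fphi FV.
Qed.

Lemma model_gt0 n n' (phi : starEmb C n n') m V E : @model n n' phi m V E -> (0 < m)%N.
Proof.
case=> _ VE _; rewrite lt0n; apply/eqP=> m0.
have phi1 : phi 1 = phi 0.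
  apply/val_inj; rewrite -![\val _]/(cycle4_val _) !VE /amplify; congr (_ *m _ *m _).
  apply/tensmx_eqP=> i j k; have := ltn_ord k; by rewrite {2}m0.
have /(congr1 (fun x : cycle4 C n =>
  (x : fullmx n) (block_index n ord0) (block_index n ord0))) := semb_inj phi1.
by rewrite !mxE eqxx => /eqP; rewrite oner_eq0.
Qed.

Section OneModel.
Variables (n n' : blockSizes) (phi : cycle4 C n -> cycle4 C n') (m : nat).
Variables (V : 'M[C]_(r n', r n * m)) (E : 'I_4 -> 'I_4 -> 'M[C]_m).
Hypothesis mV : model phi V E.

Lemma amplify1 : amplify V 1%:M = V *m V^t*.
Proof. by rewrite /amplify tensmx11 mulmx1. Qed.

Lemma amplify_in a : a \in @in_cycle4 C n -> amplify V a \in @in_cycle4 C n'.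
Proof. by move=> aA; rewrite -(modelE mV (Cycle4 aA)) cycle4_valP. Qed.

(** [V *m V^t*] is the image of 1: it is self-adjoint and lies in the algebra. *)
Lemma model_range_comm j : Q n' j *m (V *m V^t* ) = V *m V^t* *m Q n' j.
Proof.
apply: cycle4_diag_comm; rewrite -amplify1 -?amplifyC ?trmxC1;
  by apply: amplify_in; exact: rpred1.
Qed.

Lemma model_proj j : Q n' j *m V = V *m \sum_i Q n i *t E i j.
Proof.
rewrite -(model_coef mV) !mulmxA -model_range_comm -!mulmxA (model_iso mV).
by rewrite mulmx1.
Qed.

Lemma model_sum i : \sum_j E i j = 1%:M.
Proof.
suff : (fun i => \sum_j E i j) =1 (fun=> 1%:M) by apply.
apply: (@block_tens_inj _ n); rewrite block_tens1 -(model_iso mV).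
rewrite -[X in _ = _ *m X]mul1mx -sum_block_proj.
rewrite mulmx_suml mulmx_sumr.
transitivity (\sum_i \sum_j Q n i *t E i j).
  by apply: eq_bigr => k _; rewrite tensmx_sumr.
by rewrite exchange_big; apply: eq_bigr => j _; rewrite mulmxA (model_coef mV).
Qed.

Lemma model_herm i j : (E i j)^t* = E i j.
Proof.
suff : (fun i => (E i j)^t* ) =1 E^~ j by apply.
apply: (@block_tens_inj _ n); rewrite -block_tensC -(model_coef mV).
by rewrite !trmxC_mul trmxCK block_projmxC mulmxA.
Qed.

Lemma model_mul i j k : E i j *m E i k = if j == k then E i j else 0.
Proof.
suff : (fun i => E i j *m E i k) =1 (fun i => if j == k then E i j else 0) by apply.
apply: (@block_tens_inj _ n); rewrite -block_tens_mul -[X in X *m _](model_coef mV).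
rewrite -!mulmxA -model_proj !mulmxA -(mulmxA _ (Q n' j)) block_projM.
case: eqP => _; first by rewrite (model_coef mV).
by rewrite mulmx0 mul0mx [RHS]big1 // => i' _; rewrite mxtens.tensmx0.
Qed.

(** Compressing the vanishing corner (k, l) of the image of a matrix unit from the corner (i, j)
    leaves this unit tensored with [E i k *m E j l]. *)
Lemma model_allowed i j k l : block_allowed i j -> ~~ block_allowed k l ->
  E i k *m E j l = 0.
Proof.
move=> ij kl; pose d : fullmx n := delta_mx (block_index n i) (block_index n j).
have /amplify_in/block_projP/(_ k l kl) : d \in @in_cycle4 C n.
  by apply: cycle4_delta; rewrite !sig1_block_index.
move=> /(congr1 (fun x => V^t* *m x *m V)).
rewrite /= mulmx0 mul0mx /amplify !mulmxA -!mulmxA 2!mulmxA (mulmxA (V^t* )) !(model_coef mV).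
move=> /(congr1 (fun x => (Q n i *t 1%:M) *m x *m (Q n j *t 1%:M))).
have selL i' (A : 'I_4 -> 'M[C]_m) : (Q n i' *t 1%:M) *m (\sum_i Q n i *t A i) = Q n i' *t A i'.
  rewrite mulmx_sumr [LHS](bigD1 i') //= [X in _ + X]big1 => [|h hi];
    rewrite tensmx_mul mul1mx block_projM.
    by rewrite eqxx addr0.
  by rewrite eq_sym (negPf hi) mxtens.tens0mx.
have selR i' (A : 'I_4 -> 'M[C]_m) : (\sum_i Q n i *t A i) *m (Q n i' *t 1%:M) = Q n i' *t A i'.
  rewrite mulmx_suml [LHS](bigD1 i') //= [X in _ + X]big1 => [|h hi];
    rewrite tensmx_mul mulmx1 block_projM.
    by rewrite eqxx addr0.
  by rewrite (negPf hi) mxtens.tens0mx.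
rewrite /= mulmx0 mul0mx !mulmxA selL -!mulmxA selR !tensmx_mul mul1mx.
move=> /tensmx_eq0[/matrixP/(_ (block_index n i) (block_index n j))|//].
rewrite block_proj_mul mul_block_proj !sig1_block_index !eqxx !mxE !eqxx mul1r mulr1 => /eqP.
by rewrite oner_eq0.
Qed.

End OneModel.
End Models.

Section Restrict.
Variables (C : numClosedFieldType) (n n' : blockSizes).
Local Notation fullmx n := 'M[C]_(\sum_i bsize n i).
Variable F : {linear fullmx n -> fullmx n'}.
Hypothesis F_in : forall a, a \in @in_cycle4 C n -> F a \in @in_cycle4 C n'.

Definition cycle4_restrict (a : cycle4 C n) : cycle4 C n' := Cycle4 (F_in (cycle4_valP a)).

Lemma cycle4_restrict_is_linear : linear cycle4_restrict.
Proof. by move=> c a b; apply/val_inj; rewrite /= linearP. Qed.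
HB.instance Definition _ :=
  GRing.isLinear.Build C (cycle4 C n) (cycle4 C n') _ cycle4_restrict cycle4_restrict_is_linear.

Lemma starEmb_restrict : star_hom F -> injective F ->
  exists phi : starEmb C n n', forall a, phi a = F a :> fullmx n'.
Proof.
move=> Fs Finj.
have M : {morph cycle4_restrict : a b / a * b}.
  by move=> a b; apply/val_inj; exact: Fs.1.
have I : injective cycle4_restrict by move=> a b /(congr1 val)/Finj/val_inj.
have X : exists G, star_extends cycle4_restrict G by exists F.
by exists (StarEmb M I X).
Qed.

End Restrict.

Section ModelOps.
Variable C : numClosedFieldType.
Local Notation fullmx n := 'M[C]_(\sum_i bsize n i).
Local Notation r n := (\sum_i bsize n i)%N.
Local Notation Q n := (block_projmx C n).

Lemma amplify_inj N N' m (V : 'M[C]_(N', N * m)) : (0 < m)%N -> V^t* *m V = 1%:M ->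
  injective (amplify V).
Proof.
move=> m0 Viso a b /(congr1 (fun x => V^t* *m x *m V)); rewrite /= !amplifyK //.
move=> /tensmx_eqP ab; apply/matrixP=> i j; have := ab i j (Ordinal m0) (Ordinal m0).
by rewrite !mxtens.tensmxE !mxE !mulr1.
Qed.

Lemma block_tens_sandwich n m (A B : 'I_4 -> 'M[C]_m) (a : fullmx n) :
  (\sum_i Q n i *t A i) *m (a *t 1%:M) *m (\sum_j Q n j *t B j) =
  \sum_i \sum_j (Q n i *m a *m Q n j) *t (A i *m B j).
Proof.
rewrite !mulmx_suml; apply: eq_bigr => i _; rewrite mulmx_sumr; apply: eq_bigr => j _.
by rewrite !tensmx_mul mulmx1.
Qed.

(** Converse of [model_exists]: the relations on the coefficients are what makes [amplify V] carry
    one 4-cycle algebra into the other. *)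
Lemma model_emb n n' m (V : 'M[C]_(r n', r n * m)) (E : 'I_4 -> 'I_4 -> 'M[C]_m) :
    (0 < m)%N -> V^t* *m V = 1%:M ->
    (forall j, V^t* *m Q n' j *m V = \sum_i Q n i *t E i j) ->
    (forall i j, E i j *m E i j = E i j) ->
    (forall i j k l, block_allowed i j -> ~~ block_allowed k l -> E i k *m E j l = 0) ->
  exists phi : starEmb C n n', model phi V E.
Proof.
move=> m0 Viso VQ EE Eall.
have Sh j : (V^t* *m Q n' j *m V)^t* = V^t* *m Q n' j *m V.
  by rewrite !trmxC_mul trmxCK block_projmxC mulmxA.
have QV j : Q n' j *m V = V *m \sum_i Q n i *t E i j.
  (* As S = V^* Q' V is idempotent, the difference D = Q' V - V S satisfies D^* D = S - S - S + S =
     0. *)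
  rewrite -VQ; set S := _ *m _ *m V; apply/eqP; rewrite -subr_eq0; apply/eqP/mulCmx_eq0.
  have SS : S *m S = S.
    by rewrite /S VQ block_tens_mul; apply: eq_bigr => i _; rewrite EE.
  have W1 : (Q n' j *m V)^t* *m (Q n' j *m V) = S.
    by rewrite trmxC_mul block_projmxC !mulmxA -(mulmxA _ (Q n' j) (Q n' j)) block_projM eqxx.
  have W2 : V^t* *m (Q n' j *m V) = S by rewrite mulmxA.
  have W3 : (Q n' j *m V)^t* *m V = S by rewrite trmxC_mul block_projmxC.
  rewrite trmxCB (trmxC_mul V) Sh mulmxBl !mulmxBr W1 (mulmxA _ V) W3.
  by rewrite -!(mulmxA S) W2 (mulmxA _ V) Viso mul1mx SS !subrr.
have F_in a : a \in @in_cycle4 C n -> amplify V a \in @in_cycle4 C n'.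
  move=> /block_projP aA; apply/block_projP=> k l kl.
  have VQ' : V^t* *m Q n' l = (\sum_i Q n i *t E i l) *m V^t*.
    by rewrite -[LHS]trmxCK trmxC_mul trmxCK block_projmxC QV trmxC_mul -VQ Sh.
  rewrite /amplify !mulmxA QV -!mulmxA VQ' !(mulmxA _ _ (V^t* )) (mulmxA (\sum_i _)).
  suff -> : (\sum_i Q n i *t E i k) *m (a *t 1%:M) *m (\sum_i Q n i *t E i l) = 0.
    by rewrite mulmx0 mul0mx.
  rewrite block_tens_sandwich; apply: big1 => i _; apply: big1 => j _.
  have [ij|/aA ->] := boolP (block_allowed i j); last exact: mxtens.tens0mx.
  by rewrite Eall // mxtens.tensmx0.
have [phi phiE] := starEmb_restrict F_in (amplify_star_hom Viso) (amplify_inj m0 Viso).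
by exists phi; split.
Qed.

Lemma castmx_iso N k k' (e : k = k') (X : 'M[C]_(N, k)) : X^t* *m X = 1%:M ->
  (castmx (erefl N, e) X)^t* *m castmx (erefl N, e) X = 1%:M.
Proof. by case: _ / e. Qed.

Definition compose_isometry N N' N'' m m' (V : 'M[C]_(N', N * m)) (W : 'M[C]_(N'', N' * m')) :
    'M[C]_(N'', N * (m * m')) :=
  W *m castmx (erefl, esym (mulnA N m m')) (V *t (1%:M : 'M_m')).

Lemma model_comp n n' n'' (phi : cycle4 C n -> cycle4 C n') (psi : cycle4 C n' -> cycle4 C n'')
    m m' V W (E : 'I_4 -> 'I_4 -> 'M_m) (F : 'I_4 -> 'I_4 -> 'M_m') :
  model phi V E -> model psi W F ->
  model (psi \o phi) (compose_isometry V W) (fun i j => \sum_h E i h *t F h j).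
Proof.
move=> mV mW; rewrite /compose_isometry; set e := esym (mulnA _ m m').
have cst1 k k' (e' : k = k') a b (X : 'M[C]_(a, k)) (Y : 'M[C]_(a, b)) (Z : 'M[C]_(b, k)) :
    (castmx (erefl, e') X)^t* *m (Y *m castmx (erefl, e') Z) = castmx (e', e') (X^t* *m Y *m Z).
  by case: _ / e'; rewrite !castmx_id mulmxA.
have cst2 k k' (e' : k = k') a (X Z : 'M[C]_(a, k)) (Y : 'M[C]_k) :
    castmx (erefl, e') X *m castmx (e', e') Y *m (castmx (erefl, e') Z)^t* = X *m Y *m Z^t*.
  by case: _ / e'; rewrite !castmx_id.
have cstS k k' (e' : k = k') (I : finType) (X : I -> 'M[C]_k) :
    castmx (e', e') (\sum_i X i) = \sum_i castmx (e', e') (X i).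
  by case: _ / e'; rewrite castmx_id; apply: eq_bigr => i _; rewrite castmx_id.
split.
- rewrite trmxC_mul mulmxA -(mulmxA _ (W^t* )) (model_iso mW) mulmx1.
  by apply: castmx_iso; rewrite trmxC_tens tensmx_mul (model_iso mV) trmxC1 mulmx1 tensmx11.
- move=> a; rewrite /= (modelE mW) (modelE mV) /amplify trmxC_mul.
  rewrite -(tensmx11 C m m') -tensmxA !mulmxA -!(mulmxA W) cst2.
  by rewrite trmxC_tens trmxC1 !tensmx_mul !mulmx1.
move=> j; rewrite trmxC_mul -!mulmxA (mulmxA (Q n'' j)) (mulmxA (W^t* )) (mulmxA (W^t* )).
rewrite (model_coef mW) cst1 mulmx_sumr mulmx_suml cstS.
transitivity (\sum_h \sum_i Q n i *t (E i h *t F h j)).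
  apply: eq_bigr => h _; rewrite trmxC_tens trmxC1 !tensmx_mul mul1mx mulmx1.
  by rewrite (model_coef mV) tensmx_suml cstS; apply: eq_bigr => i _; rewrite tensmxA.
by rewrite exchange_big; apply: eq_bigr => i _; rewrite tensmx_sumr.
Qed.

(** [M] is rectangular because two models of one map may a priori have different multiplicities. *)
Lemma scalar_commutant n p q (M : 'M[C]_(r n * p, r n * q)) :
  (forall a : fullmx n, (a *t 1%:M) *m M = M *m (a *t 1%:M)) ->
  exists u : 'M[C]_(p, q), M = 1%:M *t u.
Proof.
move=> Mcomm; pose i0 := block_index n ord0.
have delta_row k (i j : 'I_(r n)) :
    tens_row C k i *m (delta_mx i j *t 1%:M) = tens_row C k j.
  apply/matrixP=> x y; case: (mxtens.mxtens_indexP y) => a b; rewrite mxE.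
  rewrite [LHS](bigD1 (mxtens_index (i, x))) //= [X in _ + X]big1 => [|z zx].
    rewrite mxtens.tensmxE !mxE !eqxx addr0 mul1r.
    by rewrite (inj_eq (can_inj (@mxtens.mxtens_indexK _ _))) xpair_eqE -natrM mulnb [x == b]eq_sym.
  by rewrite mxE (negPf zx) mul0r.
pose u := tens_row C p i0 *m M *m (tens_row C q i0)^t*.
have TM i j : tens_row C p i *m M *m (tens_row C q j)^t* = (i == j)%:R *: u.
  rewrite -(delta_row p i0 i) -(mulmxA _ _ M) Mcomm -!mulmxA.
  have -> : (delta_mx i0 i *t 1%:M) *m (tens_row C q j)^t* =
      (i == j)%:R *: (tens_row C q i0)^t*.
    rewrite -(delta_row q i0 j) !trmxC_mul mulmxA !trmxC_tens trmxC1 trmxC_delta tensmx_mul.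
    rewrite mul_delta_mx_cond mulmx1 -scaler_nat tensmxZl -scalemxAl; congr (_ *: _).
    by rewrite -[LHS]trmxCK trmxC_mul trmxCK trmxC_tens trmxC1 trmxC_delta delta_row.
  by rewrite -!scalemxAr !mulmxA.
exists u; rewrite -[LHS]mul1mx -[LHS]mulmx1 -[RHS]mul1mx -[RHS]mulmx1.
rewrite -!sum_tens_row !mulmx_suml; apply: eq_bigr => i _.
rewrite !mulmx_sumr; apply: eq_bigr => j _; rewrite !mulmxA; congr (_ *m _).
rewrite -!mulmxA; congr (_ *m _); rewrite !mulmxA TM.
by rewrite mul_tens_row mxE.
Qed.

(** Both amplifications are the unique extension of [phi], so [W^t* *m V] commutes with every
    [a *t 1%:M] and has the form 1 (x) u. It is unitary because [V] and [W] have the same range,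
    that of the image of 1. *)
Lemma model_change n n' (phi : cycle4 C n -> cycle4 C n') m m' V W
    (E : 'I_4 -> 'I_4 -> 'M_m) (F : 'I_4 -> 'I_4 -> 'M_m') :
  model phi V E -> model phi W F ->
  exists u : 'M[C]_(m', m), [/\ u^t* *m u = 1%:M, u *m u^t* = 1%:M &
    forall i j, E i j = u^t* *m F i j *m u].
Proof.
move=> mV mW; pose M := W^t* *m V.
have VW : amplify V =1 amplify W.
  apply: (@star_ext_unique _ _ _ phi).
    by split; [exact: amplify_star_hom (model_iso mV) | move=> a; rewrite (modelE mV)].
  by split; [exact: amplify_star_hom (model_iso mW) | move=> a; rewrite (modelE mW)].
have Mcomm a : (a *t 1%:M) *m M = M *m (a *t 1%:M).
  have := congr1 (fun x => W^t* *m x *m V) (VW a).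
  rewrite /amplify /= !mulmxA (model_iso mW) mul1mx -!mulmxA (model_iso mV) mulmx1.
  by rewrite mulmxA => ->.
have [u Mu] : exists u : 'M[C]_(m', m), M = 1%:M *t u by exact: scalar_commutant.
have eV : V = W *m M.
  have := congr1 (fun x => x *m V) (VW 1%:M); rewrite /= !amplify1 -!mulmxA.
  by rewrite (model_iso mV) mulmx1.
have eW : W = V *m M^t*.
  have := congr1 (fun x => x *m W) (VW 1%:M); rewrite /= !amplify1 -!mulmxA.
  by rewrite (model_iso mW) mulmx1 trmxC_mul trmxCK.
have tens1_inj p (A B : 'M[C]_p) : (1%:M : fullmx n) *t A = 1%:M *t B -> A = B.
  by rewrite -!sum_block_proj !tensmx_suml => /block_tens_inj/(_ ord0).
exists u; split.
- apply: tens1_inj; rewrite -[X in X *t _]mul1mx -tensmx_mul -{1}trmxC1 -trmxC_tens -Mu.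
  by rewrite tensmx11 -(model_iso mV) {2}eV /M mulmxA trmxC_mul trmxCK.
- apply: tens1_inj; rewrite -[X in X *t _]mul1mx -tensmx_mul -{2}trmxC1 -trmxC_tens -Mu.
  by rewrite tensmx11 -(model_iso mW) {2}eW mulmxA.
move=> i j; suff : E^~ j =1 (fun i => u^t* *m F i j *m u) by apply.
apply: (@block_tens_inj _ n); rewrite -(model_coef mV) eV trmxC_mul -!mulmxA.
rewrite (mulmxA (Q n' j)) (mulmxA (W^t* )) (mulmxA (W^t* )) (model_coef mW) Mu.
rewrite mulmx_suml mulmx_sumr; apply: eq_bigr => k _.
by rewrite trmxC_tens trmxC1 !tensmx_mul mul1mx mulmx1 mulmxA.
Qed.

End ModelOps.

(** * Factorizations of rigid embeddings *)

Section Sides.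

Definition side (i : 'I_4) : bool := (i < 2)%N.

Definition partner (i : 'I_4) : 'I_4 := inord (if odd i then i.-1 else i.+1).

Definition side_base (b : bool) : 'I_4 := if b then ord0 else ord_max.

Lemma side_partner i : side (partner i) = side i.
Proof. by rewrite /side /partner; case: i => [[|[|[|[|//]]]] ?]; rewrite inordK. Qed.

Lemma partner_neq i : partner i != i.
Proof. by rewrite -val_eqE /partner; case: i => [[|[|[|[|//]]]] ?] /=; rewrite inordK. Qed.

Lemma same_side i j : side j = side i -> j != i -> j = partner i.
Proof.
move=> ji nji; apply/val_inj; rewrite /partner; move: ji nji; rewrite -val_eqE /side.
by case: i => [[|[|[|[|//]]]] ?]; case: j => [[|[|[|[|//]]]] ?]; rewrite //= inordK.
Qed.

Lemma partnerK i : partner (partner i) = i.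
Proof.
by apply/esym/same_side; rewrite ?side_partner // eq_sym partner_neq.
Qed.

Lemma side_side_base b : side (side_base b) = b.
Proof. by case: b. Qed.

Lemma big_side (V : nmodType) (F : 'I_4 -> V) i : (forall j, side j != side i -> F j = 0) ->
  \sum_j F j = F i + F (partner i).
Proof.
move=> F0; rewrite (bigD1 i) //= (bigD1 (partner i)) ?partner_neq //= big1 ?addr0 //.
move=> j /andP[ji jp]; apply: F0; apply: contra jp => /eqP ij.
exact/eqP/same_side.
Qed.

End Sides.

Section Factor.
Variable C : numClosedFieldType.

(** The relations between the coefficients of a model, detached from the embedding: factorizations
    can then be studied by matrix algebra alone. *)
Record coefs m (E : 'I_4 -> 'I_4 -> 'M[C]_m) : Prop := Coefs {
  coefs_sum : forall i, \sum_j E i j = 1%:M;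
  coefs_herm : forall i j, (E i j)^t* = E i j;
  coefs_mul : forall i j k, E i j *m E i k = if j == k then E i j else 0;
  coefs_allowed : forall i j k l, block_allowed i j -> ~~ block_allowed k l ->
    E i k *m E j l = 0 }.

Lemma model_coefs n n' (phi : cycle4 C n -> cycle4 C n') m V E :
  @model C n n' phi m V E -> coefs E.
Proof.
move=> mV; split; [exact: model_sum mV | exact: model_herm mV
  | exact: model_mul mV | exact: model_allowed mV].
Qed.

(** Across the sides [coefs_allowed] covers only [i] in {0, 1} and [j] in {2, 3}; taking adjoints
    reverses the product and covers the opposite order. *)
Lemma coefs_cross m (E : 'I_4 -> 'I_4 -> 'M[C]_m) i j k l : coefs E -> side i != side j ->
  k != l -> ~~ ((side k == side i) && (side l == side j)) -> E i k *m E j l = 0.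
Proof.
move=> cE ij kl nkl.
have na i' j' : side i' -> ~~ side j' -> block_allowed i' j'.
  by rewrite /block_allowed /side -leqNgt => -> ->; rewrite orbT.
have nna k' l' : k' != l' -> ~~ (side k' && ~~ side l') -> ~~ block_allowed k' l'.
  by rewrite /block_allowed /side -leqNgt => /negPf->.
case si : (side i) ij nkl; case sj : (side j) => // _; rewrite ?eqbF_neg ?eqb_id => nkl.
  by apply: (coefs_allowed cE); [apply: na; rewrite ?si ?sj | apply: nna].
rewrite -[LHS]trmxCK trmxC_mul !(coefs_herm cE) (coefs_allowed cE) ?trmxC0 //.
  by apply: na; rewrite ?si ?sj.
by apply: nna; rewrite 1?eq_sym // andbC.
Qed.

Lemma mx1_neq0 m : (0 < m)%N -> (1%:M : 'M[C]_m) <> 0.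
Proof.
move=> m0 /matrixP/(_ (Ordinal m0) (Ordinal m0)); rewrite !mxE eqxx => /eqP.
by rewrite oner_eq0.
Qed.

Lemma idem_double_neq1 m (p : 'M[C]_m) : (0 < m)%N -> p *m p = p -> p + p <> 1%:M.
Proof.
move=> m0 pp p2; apply: (mx1_neq0 m0).
have p1 : p = 1%:M by rewrite -[LHS]mulmx1 -p2 mulmxDr pp p2.
by move: p2; rewrite p1 => /eqP; rewrite -subr_eq0 addrK => /eqP.
Qed.

(** With [coefs_sum], the coefficients inside a side are p, 1 - p, 1 - p, p: the range of p keeps
    the two blocks of the side in place, its complement exchanges them. Rigid embeddings have this
    pattern, and both factors of a composite inherit it. *)
Definition side_flip m (E : 'I_4 -> 'I_4 -> 'M[C]_m) :=
  (forall i j, side i != side j -> E i j = 0) /\ (forall i, E i i + E (partner i) i = 1%:M).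

Section Compose.
Variables (m m' : nat) (E : 'I_4 -> 'I_4 -> 'M[C]_m) (F : 'I_4 -> 'I_4 -> 'M[C]_m').
Let G i k := \sum_j E i j *t F j k.
Hypotheses (m_gt0 : (0 < m)%N) (m'_gt0 : (0 < m')%N) (cE : coefs E) (cF : coefs F).
Hypothesis fG : side_flip G.

(** Multiplication by [E i j *t 1%:M] isolates one term of [G i k]. *)
Lemma factor_zero i j k : E i j <> 0 -> side i != side k -> F j k = 0.
Proof.
move=> Eij ik; have : (E i j *t 1%:M) *m G i k = 0 by rewrite fG.1 ?mulmx0.
rewrite mulmx_sumr (bigD1 j) //= [X in _ + X]big1 => [|h hj].
  by rewrite addr0 tensmx_mul (coefs_mul cE) eqxx mul1mx => /tensmx_eq0[].
by rewrite tensmx_mul (coefs_mul cE) eq_sym (negPf hj) mxtens.tens0mx.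
Qed.

Lemma factor_nonzero h : (forall k, F h k = 0) -> False.
Proof. by move=> F0; apply: (mx1_neq0 m'_gt0); rewrite -(coefs_sum cF h) big1. Qed.

(** A nonzero [E i j] across the sides confines the rows of [F] at [j] and at the blocks on the side
    of [i] to the columns on the side of [i]. The opposite block [i'] then has no coefficient at
    these positions, and what remains of [E i j] is killed by [coefs_cross]. *)
Lemma factor_left_side i j : side i != side j -> E i j = 0.
Proof.
move=> ij; apply/eqP; apply: contraT => /eqP Eij; exfalso.
have Fj k : side k != side i -> F j k = 0.
  by move=> ki; apply: factor_zero Eij _; rewrite eq_sym.
have Fh h k : side h = side i -> side k != side i -> F h k = 0.
  move=> hi ki; rewrite -[LHS]mulmx1 -(coefs_sum cF j) mulmx_sumr big1 // => l _.
  have [li|li] := eqVneq (side l) (side i); last by rewrite Fj ?mulmx0.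
  apply: (coefs_cross cF); rewrite ?hi //; last by rewrite (negPf ki).
  by apply: contraNneq ki => ->; rewrite li.
pose i' := side_base (~~ side i).
have i'i : side i' != side i by rewrite side_side_base; case: side.
(* Otherwise row [h] of [F] would vanish on both sides, although it sums to 1. *)
have Ei' h : (h == j) || (side h == side i) -> E i' h = 0.
  move=> hE; apply/eqP; apply: contraT => /eqP/factor_zero Fi'.
  exfalso; apply: (@factor_nonzero h) => k.
  have [ki|ki] := eqVneq (side k) (side i); first by apply: Fi'; rewrite ki.
  by case/orP: hE => [/eqP->|/eqP hi]; [exact: Fj | exact: Fh].
apply: Eij; rewrite -[LHS]mulmx1 -(coefs_sum cE i') mulmx_sumr big1 // => h _.
have [/Ei'->|] := boolP ((h == j) || (side h == side i)); first by rewrite mulmx0.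
rewrite negb_or => /andP[hj hi]; apply: (coefs_cross cE); rewrite 1?eq_sym //.
by rewrite negb_and ij.
Qed.

(** Let e, e', f, f' be the coefficients into block [i]. The condition on [G] becomes (e + e') (x)
    (f - f') = 1 (x) (1 - 2 f'). As 1 - 2 f' is nonzero, e + e' is a scalar c and c (f - f') = 1 - 2
    f'. Idempotence of e = c - e' gives (c - 1)(c - 2 e') = 0, and c = 1 yields both claims. *)
Lemma factor_flip i : E i i + E (partner i) i = 1%:M /\ F i i + F (partner i) i = 1%:M.
Proof.
set i' := partner i; have i'i : i' != i by exact: partner_neq.
have E1 h : side h = side i -> E h i' = 1%:M - E h i.
  move=> hi; have S : \sum_j E h j = E h i + E h i'.
    by apply: big_side => k kh; apply: factor_left_side; rewrite hi eq_sym.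
  by rewrite -(coefs_sum cE h) S addrAC subrr add0r.
have GE h : side h = side i -> G h i = E h i *t F i i + E h i' *t F i' i.
  move=> hi; apply: big_side => k kh.
  by rewrite factor_left_side ?mxtens.tens0mx // hi eq_sym.
have := fG.2 i; rewrite !GE ?side_partner // !E1 ?side_partner //.
set e := E i i; set e' := E i' i; set f := F i i; set f' := F i' i => fsum.
have ee : e *m e = e by rewrite (coefs_mul cE) eqxx.
have ee' : e' *m e' = e' by rewrite (coefs_mul cE) eqxx.
have ff : f *m f = f by rewrite (coefs_mul cF) eqxx.
have ff' : f' *m f' = f' by rewrite (coefs_mul cF) eqxx.
have XD : (e + e') *t (f - f') = 1%:M *t (1%:M - (f' + f')).
  have cancel (V : zmodType) (a b c d o : V) :
      a - b + (c - d) = a + (o - b) + (c + (o - d)) - (o + o).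
    by rewrite (addrCA a) (addrCA c) (addrACA o) [RHS]addrC addKr.
  rewrite [RHS]tensmxDr tensmx11 -fsum !tensmxDl !tensmxDr !tensmxNl !tensmxNr tensmxDr.
  exact: cancel.
have f2 g : g *m g = g -> 1%:M - (g + g) <> 0 :> 'M[C]_m'.
  by move=> gg /eqP; rewrite subr_eq0 eq_sym => /eqP; apply: idem_double_neq1.
have one_inj (A B : 'M[C]_m') : (1%:M : 'M[C]_m) *t A = 1%:M *t B -> A = B.
  move=> AB; have : (1%:M : 'M[C]_m) *t (A - B) = 0 by rewrite tensmxDr tensmxNr AB subrr.
  by move=> /tensmx_eq0[/(mx1_neq0 m_gt0)//|/eqP]; rewrite subr_eq0 => /eqP.
have /eqP/matrix0Pn[k [l Dkl]] : f - f' <> 0.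
  move=> D0; move: XD; rewrite D0 mxtens.tensmx0 => /esym/tensmx_eq0[|].
    exact: mx1_neq0.
  exact: f2.
pose c := (1%:M - (f' + f')) k l / (f - f') k l.
have Xc : e + e' = c%:M.
  apply/matrixP=> x y; have /tensmx_eqP/(_ x y k l) := XD.
  rewrite !mxtens.tensmxE => XDkl; apply: (mulIf Dkl); rewrite XDkl.
  rewrite ![_%:M x y]mxE; case: (x == y); last by rewrite !mulr0n !mul0r.
  by rewrite !mulr1n mul1r /c divfK.
have cD : c *: (f - f') = 1%:M - (f' + f').
  by apply: one_inj; rewrite -XD Xc tensmxZr -tensmxZl scale_scalar_mx mulr1.
have c1 : (c - 1) *: (c%:M - (e' + e')) = 0.
  move: ee; rewrite (_ : e = c%:M - e'); last by rewrite -Xc addrK.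
  rewrite mulmxBr !mulmxBl ee' !mul_mx_scalar mul_scalar_mx => H.
  rewrite -(subrr (c%:M - e')) -{1}H !scalerBl !scalerBr scalerDr !scale1r.
  by apply/matrixP=> x y; rewrite !mxE; ring.
have [c_1|/eqP c_1] := eqVneq c 1.
  split; first by rewrite Xc c_1.
  by move: cD; rewrite c_1 scale1r => /(congr1 (+%R^~ (f' + f'))); rewrite /= subrK addrA subrK.
(* If 2 e' = c, idempotence of e' gives c^2 = 2 c. The value 0 would imply 2 f' = 1 and the value 2
   would imply 2 f = 1, impossible for idempotents. *)
have ce : e' + e' = c%:M.
  apply/eqP; rewrite eq_sym -subr_eq0; apply/eqP; move: c1 => /eqP.
  by rewrite scaler_eq0 subr_eq0 => /orP[/eqP//|/eqP].
have h : c *: e' = c%:M by rewrite -mul_scalar_mx -ce mulmxDl ee'.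
have c2 : c * c = c + c.
  have : c *: c%:M = c%:M + c%:M :> 'M[C]_m by rewrite -{1}ce scalerDr h.
  move=> /matrixP/(_ (Ordinal m_gt0) (Ordinal m_gt0)).
  by rewrite !mxE eqxx !mulr1n.
have [c0|c0] := eqVneq c 0.
  by move: cD; rewrite c0 scale0r => /esym/f2; case.
have {c2}c2 : c = 1 + 1 by apply: (mulfI c0); rewrite c2 mulrDr mulr1.
case: (idem_double_neq1 m'_gt0 ff); move: cD; rewrite c2 scalerDl scale1r.
move=> /(congr1 (+%R^~ (f' + f'))); rewrite /= subrK => <-.
by apply/matrixP=> x y; rewrite !mxE; ring.
Qed.

Lemma factor_left_side_flip : side_flip E.
Proof. by split=> [|i]; [exact: factor_left_side | exact: (factor_flip i).1]. Qed.

(** Since [E j j] and [E (partner j) j] sum to 1, one of them is nonzero, and [factor_zero] applies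
    through it. *)
Lemma factor_right_side_flip : side_flip F.
Proof.
split=> [j k jk|i]; last exact: (factor_flip i).2.
have [Ej|/eqP Ej] := eqVneq (E j j) 0; last by apply: factor_zero Ej _.
have Ej' : E (partner j) j <> 0.
  move=> Ej'; have := (factor_flip j).1; rewrite Ej Ej' addr0 => /esym.
  exact: mx1_neq0.
by apply: factor_zero Ej' _; rewrite side_partner.
Qed.

End Compose.

(** The eigenvalue 1 of the symmetry of a side keeps its blocks in place, the eigenvalue -1
    exchanges them. *)
Definition symE m (s t : 'M[C]_m) (i j : 'I_4) : 'M[C]_m :=
  if side i == side j then sym_proj (if side i then s else t) (i != j) else 0.

(** On each side all coefficients are p or 1 - p for one projection p, read at [side_base]; the
    symmetry is 2 p - 1. *)
Lemma side_flip_symE m (E : 'I_4 -> 'I_4 -> 'M[C]_m) : coefs E -> side_flip E ->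
  exists s t, [/\ is_symmetry s, is_symmetry t & forall i j, E i j = symE s t i j].
Proof.
move=> cE [Es Ef].
pose p b := E (side_base b) (side_base b).
have pP b : is_proj (p b) by split; [exact: coefs_herm | rewrite (coefs_mul cE) eqxx].
pose s b := p b + p b - 1%:M.
have sP b : is_symmetry (s b) by exact: sym_proj_sym.
have sp b : sym_proj (s b) false = p b.
  by rewrite /sym_proj expr0 scale1r addrC subrK half_double.
have sp' b : sym_proj (s b) true = 1%:M - p b.
  by rewrite -(sum_sym_proj (s b)) sp addrAC subrr add0r.
exists (s true), (s false); split=> // i j; rewrite /symE.
case: eqP => [ij|/eqP ij]; last exact: Es.
have -> : (if side i then s true else s false) = s (side i) by case: side.
have Ei' k : E k (partner k) = 1%:M - E k k.
  rewrite -(coefs_sum cE k) (_ : \sum_j E k j = E k k + E k (partner k)).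
    by rewrite addrAC subrr add0r.
  by apply: big_side => l lk; apply: Es; rewrite eq_sym.
have Ei k : E (partner k) k = 1%:M - E k k by rewrite -(Ef k) addrAC subrr add0r.
set b := side i; have bi : side (side_base b) = side i by rewrite side_side_base.
have alt k : side k = b -> k = side_base b \/ k = partner (side_base b).
  by move=> kb; have [->|/same_side ->] := eqVneq k (side_base b); rewrite ?bi; [left | right|].
have Epp k : E (partner k) (partner k) = E k k.
  by apply: oppr_inj; apply: (addrI 1%:M); rewrite -Ei -Ei' partnerK.
have [iE|iE] := alt i erefl; have [jE|jE] := alt j (esym ij); rewrite iE jE ?eqxx /=.
- by rewrite sp.
- by rewrite eq_sym partner_neq sp' Ei'.
- by rewrite partner_neq sp' Ei.
- by rewrite Epp sp.
Qed.

End Factor.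

(** * Commuting and anticommuting embeddings *)

Section SymModels.
Variable C : numClosedFieldType.
Local Notation fullmx n := 'M[C]_(\sum_i bsize n i).
Local Notation r n := (\sum_i bsize n i)%N.
Local Notation Q n := (block_projmx C n).

Lemma tens_symmetry m m' (s : 'M[C]_m) (s' : 'M[C]_m') :
  is_symmetry s -> is_symmetry s' -> is_symmetry (s *t s').
Proof.
case=> sh ss [sh' ss']; split; first by rewrite trmxC_tens sh sh'.
by rewrite tensmx_mul ss ss' tensmx11.
Qed.

Lemma sym_proj_tens m m' (s : 'M[C]_m) (s' : 'M[C]_m') a :
  sym_proj s false *t sym_proj s' a + sym_proj s true *t sym_proj s' (~~ a) =
  sym_proj (s *t s') a.
Proof.
rewrite [RHS]/sym_proj -tensmx11; apply/tensmx_eqP=> i j k l.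
rewrite [LHS]mxE [RHS]mxE [X in _ = _ * X]mxE [X in _ = _ * (_ + X)]mxE !mxtens.tensmxE.
rewrite !mxE; set d := (_ *+ _); set d' := (_ *+ _).
by case: a; rewrite /= ?expr0 ?expr1; field.
Qed.

(** Two exchanges cancel, so keeping and exchanging blocks compose like the product of the
    eigenvalues. *)
Lemma symE_comp m m' (s t : 'M[C]_m) (s' t' : 'M[C]_m') i k :
  \sum_h symE s t i h *t symE s' t' h k = symE (s *t s') (t *t t') i k.
Proof.
rewrite (@big_side _ _ i) => [|h hi]; last first.
  by rewrite /symE eq_sym (negPf hi) mxtens.tens0mx.
rewrite /symE side_partner !eqxx /= [i == partner i]eq_sym partner_neq.
have [ik|ik] := eqVneq (side i) (side k); last by rewrite !mxtens.tensmx0 addr0.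
rewrite (_ : (partner i != k) = ~~ (i != k)); first by case: side; rewrite sym_proj_tens.
have [<-|ki] := eqVneq i k; first by rewrite partner_neq.
by rewrite (_ : k = partner i) ?eqxx //; apply: same_side; rewrite // eq_sym.
Qed.

Lemma model_ext n n' (phi phi' : cycle4 C n -> cycle4 C n') m V E E' :
  phi =1 phi' -> (forall i j, E i j = E' i j) -> model phi (m := m) V E -> model phi' V E'.
Proof.
move=> pp EE [Viso VE VQ]; split=> // [a|j]; first by rewrite -pp.
by rewrite VQ; apply: eq_bigr => i _; rewrite EE.
Qed.

Definition symmodel n n' (phi : cycle4 C n -> cycle4 C n') m V (s t : 'M[C]_m) :=
  [/\ is_symmetry s, is_symmetry t & model phi V (symE s t)].

Lemma symmodel_comp n n' n'' (phi : cycle4 C n -> cycle4 C n') (psi : cycle4 C n' -> cycle4 C n'')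
    m m' V W (s t : 'M_m) (s' t' : 'M_m') :
  symmodel phi V s t -> symmodel psi W s' t' ->
  symmodel (psi \o phi) (compose_isometry V W) (s *t s') (t *t t').
Proof.
move=> [ss st mV] [ss' st' mW]; split; try exact: tens_symmetry.
by apply: model_ext (model_comp mV mW) => // i k; rewrite symE_comp.
Qed.

Lemma symE_base m (s t : 'M[C]_m) :
  symE s t ord0 ord0 + symE s t ord0 ord0 - 1%:M = s /\
  symE s t ord_max ord_max + symE s t ord_max ord_max - 1%:M = t.
Proof.
have E x : sym_proj x false + sym_proj x false - 1%:M = x :> 'M[C]_m.
  by rewrite -(sum_sym_proj x) opprD addrA addrK sym_projK.
by rewrite /symE !eqxx /=; split; rewrite E.
Qed.

Lemma double_sub1_comm m (p q : 'M[C]_m) : p *m q = q *m p ->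
  (p + p - 1%:M) *m (q + q - 1%:M) = (q + q - 1%:M) *m (p + p - 1%:M).
Proof.
have half x y : x *m y = y *m x -> x *m (y + y - 1%:M) = (y + y - 1%:M) *m x :> 'M[C]_m.
  by move=> xy; rewrite mulmxBr mulmxBl mulmxDr mulmxDl xy mulmx1 mul1mx.
by move=> pq; apply/esym/half/esym/half.
Qed.

(** The sign in additive form: [false] for commuting symmetries, [true] for anticommuting ones.
    Positivity of [m] makes the kind unique. *)
Definition has_kind (b : bool) n n' (phi : cycle4 C n -> cycle4 C n') :=
  exists m V (s t : 'M[C]_m), [/\ (0 < m)%N, symmodel phi V s t & s *m t = (-1) ^+ b *: (t *m s)].

Lemma symE_change n n' (phi : cycle4 C n -> cycle4 C n') m m' V W (s t : 'M_m) (s' t' : 'M_m') :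
    symmodel phi V s t -> symmodel phi W s' t' ->
  exists u : 'M[C]_(m', m), [/\ u^t* *m u = 1%:M, u *m u^t* = 1%:M,
    s = u^t* *m s' *m u & t = u^t* *m t' *m u].
Proof.
move=> [_ _ mV] [_ _ mW]; have [u [uu uu' uE]] := model_change mV mW.
exists u; split=> //.
  rewrite -(symE_base s t).1 -(symE_base s' t').1 uE.
  by rewrite mulmxBr mulmxBl mulmxDr mulmxDl mulmx1 uu.
rewrite -(symE_base s t).2 -(symE_base s' t').2 uE.
by rewrite mulmxBr mulmxBl mulmxDr mulmxDl mulmx1 uu.
Qed.

Lemma conj_mul m m' (u : 'M[C]_(m', m)) (x y : 'M[C]_m') : u *m u^t* = 1%:M ->
  (u^t* *m x *m u) *m (u^t* *m y *m u) = u^t* *m (x *m y) *m u.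
Proof. by move=> uu; rewrite !mulmxA -(mulmxA _ u) uu mulmx1. Qed.

(** A change of model conjugates both symmetries by one unitary and keeps their commutation sign. *)
Lemma has_kind_inj b c n n' (phi : cycle4 C n -> cycle4 C n') :
  has_kind b phi -> has_kind c phi -> b = c.
Proof.
move=> [m [V [s [t [m0 mV st]]]]] [m' [W [s' [t' [_ mW st']]]]].
have [u [uu uu' us ut]] := symE_change mV mW.
have : s *m t = (-1) ^+ c *: (t *m s).
  by rewrite us ut !conj_mul // st' -scalemxAr -scalemxAl.
have [[_ ss] [_ tt] _] := mV.
rewrite st => /(congr1 (fun x => x *m (s *m t))).
rewrite -!scalemxAl -(mulmxA t) (mulmxA s s) ss mul1mx tt.
move=> /matrixP/(_ (Ordinal m0) (Ordinal m0)); rewrite !mxE eqxx !mulr1.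
case: b c {st st'} => [] [] //= /eqP; rewrite ?expr0 ?expr1.
  by rewrite -subr_eq0 -opprD oppr_eq0 -mulr2n pnatr_eq0.
by rewrite -subr_eq0 opprK -mulr2n pnatr_eq0.
Qed.

Lemma has_kind_comp b c n n' n'' (phi : cycle4 C n -> cycle4 C n')
    (psi : cycle4 C n' -> cycle4 C n'') :
  has_kind b phi -> has_kind c psi -> has_kind (b (+) c) (psi \o phi).
Proof.
move=> [m [V [s [t [m0 mV st]]]]] [m' [W [s' [t' [m0' mW st']]]]].
exists (m * m')%N, (compose_isometry V W), (s *t s'), (t *t t'); split.
- by rewrite muln_gt0 m0.
- exact: symmodel_comp.
by rewrite !tensmx_mul st st' tensmxZl tensmxZr scalerA signr_addb.
Qed.

Lemma has_kind_ext b n n' (phi psi : cycle4 C n -> cycle4 C n') :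
  phi =1 psi -> has_kind b phi -> has_kind b psi.
Proof.
move=> e [m [V [s [t [m0 [ss st mV] cst]]]]]; exists m, V, s, t; split=> //.
by split=> //; apply: model_ext mV.
Qed.

(** Used with x = st, x' = ts, y = s't', y' = t's'. Proportionality of the factors gives x = c x',
    and conjugation by [s] turns this into x' = c x, whence c^2 = 1. *)
Lemma tens_sign m m' (x x' : 'M[C]_m) (y y' : 'M[C]_m') s :
  is_symmetry s -> s *m x *m s = x' -> x *m x' = 1%:M -> (0 < m)%N -> (0 < m')%N ->
  y *m y' = 1%:M -> x *t y = x' *t y' ->
  exists b : bool, x = (-1) ^+ b *: x' /\ y = (-1) ^+ b *: y'.
Proof.
move=> [_ ss] sxs xx m0 m0' yy xy.
have y0 : y != 0 by apply/eqP=> y0; apply: (mx1_neq0 (C := C) m0'); rewrite -yy y0 mul0mx.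
have x0 : x != 0 by apply/eqP=> x0; apply: (mx1_neq0 (C := C) m0); rewrite -xx x0 mul0mx.
have /matrix0Pn[k [l ykl]] := y0; pose c := y' k l / y k l.
have xc : x = c *: x'.
  apply/matrixP=> i j; have /tensmx_eqP/(_ i j k l) := xy; rewrite !mxtens.tensmxE => h.
  by apply: (mulIf ykl); rewrite h mxE /c mulrAC divfK // mulrC.
have x'c : x' = c *: x.
  have sx's : s *m x' *m s = x by rewrite -sxs !mulmxA ss mul1mx -mulmxA ss mulmx1.
  by rewrite -sxs {1}xc -scalemxAr -scalemxAl sx's.
have cc : c ^+ 2 = 1.
  move: (xc); rewrite {1}x'c scalerA -[LHS]scale1r => /eqP.
  by rewrite -subr_eq0 -scalerBl scaler_eq0 (negPf x0) orbF subr_eq0 expr2 => /eqP <-.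
have yc : y = c *: y'.
  apply/eqP; rewrite -subr_eq0; apply/eqP.
  have : x *t (y - c *: y') = 0.
    by rewrite tensmxDr tensmxNr tensmxZr -tensmxZl -x'c xy subrr.
  by move=> /tensmx_eq0[/eqP|//]; rewrite (negPf x0).
move: cc => /eqP; rewrite sqrf_eq1 => /orP[] /eqP c1; [exists false | exists true];
  by rewrite /= ?expr0 ?expr1 -c1; split.
Qed.

End SymModels.

Section Crossover.
Variable C : numClosedFieldType.
Local Notation fullmx n := 'M[C]_(\sum_i bsize n i).
Local Notation r n := (\sum_i bsize n i)%N.
Local Notation Q n := (block_projmx C n).

Lemma starEmb_comp n n' n'' (phi : starEmb C n n') (psi : starEmb C n' n'') :
  exists chi : starEmb C n n'', chi =1 psi \o phi.
Proof.
have M : {morph (psi \o phi) : a b / a * b} by move=> a b; rewrite /= !sembM.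
have I : injective (psi \o phi) by apply: inj_comp; apply: semb_inj.
have X : exists F, star_extends (psi \o phi) F.
  exists (star_ext psi \o star_ext phi); split; first split.
  - by move=> a b /=; rewrite (star_extP phi).1.1 (star_extP psi).1.1.
  - by move=> a /=; rewrite (star_extP phi).1.2 (star_extP psi).1.2.
  by move=> a /=; rewrite (star_extP phi).2 (star_extP psi).2.
by exists (@StarEmb _ _ _ (psi \o phi) M I X).
Qed.

Lemma symE_flip m (s t : 'M[C]_m) : side_flip (symE s t).
Proof.
split=> [i j ij|i]; first by rewrite /symE (negPf ij).
by rewrite /symE side_partner !eqxx partner_neq sum_sym_proj.
Qed.

Lemma sym_proj_conj m m' (u : 'M[C]_(m', m)) s a : u^t* *m u = 1%:M ->
  u^t* *m sym_proj s a *m u = sym_proj (u^t* *m s *m u) a.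
Proof.
move=> uu; rewrite /sym_proj -scalemxAr -scalemxAl mulmxDr mulmxDl mulmx1 uu.
by rewrite -scalemxAr -scalemxAl.
Qed.

Lemma symE_conj m m' (u : 'M[C]_(m', m)) s t i j : u^t* *m u = 1%:M ->
  u^t* *m symE s t i j *m u = symE (u^t* *m s *m u) (u^t* *m t *m u) i j.
Proof.
move=> uu; rewrite /symE; case: ifP => _; last by rewrite mulmx0 mul0mx.
by case: ifP => _; rewrite sym_proj_conj.
Qed.

(* [b = true] does occur: a regular embedding can factor through two embeddings
   that are not regular. *)
Lemma factor_kind n n' n'' (phi : starEmb C n n') (psi : starEmb C n' n'')
    (gamma : cycle4 C n -> cycle4 C n'') :
    (forall a, psi (phi a) = gamma a) -> has_kind false gamma ->
  exists b, has_kind b phi /\ has_kind b psi.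
Proof.
move=> pg [N [Y [S [T [N0 [symS symT mY] ST]]]]].
have [m [V [E mV]]] := model_exists phi; have [m' [W [F mW]]] := model_exists psi.
have m0 := model_gt0 mV; have m'0 := model_gt0 mW.
have mG := model_comp mV mW.
have mG' : model gamma (compose_isometry V W) (fun i j => \sum_h E i h *t F h j).
  by apply: model_ext mG.
have [u [uu uu' uE]] := model_change mG' mY.
(* Models are unique up to a unitary, so the coefficients of the composite inherit the side pattern
   of [gamma]. *)
have fG : side_flip (fun i j => \sum_h E i h *t F h j).
  have [f1 f2] := symE_flip S T; split=> [i j ij|i]; rewrite !uE.
    by rewrite f1 // mulmx0 mul0mx.
  by rewrite -mulmxDl -mulmxDr f2 mulmx1.
have [cE cF] := (model_coefs mV, model_coefs mW).
have [s [t [ss st Est]]] := side_flip_symE cE (factor_left_side_flip m0 m'0 cE cF fG).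
have [s' [t' [ss' st' Fst]]] := side_flip_symE cF (factor_right_side_flip m0 m'0 cE cF fG).
have kV : symmodel phi V s t by split=> //; apply: model_ext mV.
have kW : symmodel psi W s' t' by split=> //; apply: model_ext mW.
have [_ _ kG] := symmodel_comp kV kW.
have kG' : symmodel gamma (compose_isometry V W) (s *t s') (t *t t').
  by split; try exact: tens_symmetry; apply: model_ext kG.
have [v [vv vv' vs vt]] := symE_change kG' (And3 symS symT mY : symmodel gamma Y S T).
have cst : (s *t s') *m (t *t t') = (t *t t') *m (s *t s').
  by rewrite vs vt !conj_mul // ST expr0 scale1r.
rewrite !tensmx_mul in cst.
have [b [b1 b2]] : exists b : bool, s *m t = (-1) ^+ b *: (t *m s) /\
    s' *m t' = (-1) ^+ b *: (t' *m s').
  apply: (tens_sign ss) cst => //.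
  - by rewrite mulmxA ss.2 mul1mx.
  - by rewrite mulmxA -(mulmxA s) st.2 mulmx1 ss.2.
  - by rewrite mulmxA -(mulmxA s') st'.2 mulmx1 ss'.2.
by exists b; split; [exists m, V, s, t | exists m', W, s', t'].
Qed.

(** A constant unitary [U] only changes the model of the same map; letting [U] vary with the block
    leads in general to another embedding. *)
Lemma twist_isometry n n' m (V : 'M[C]_(r n', r n * m)) (E : 'I_4 -> 'I_4 -> 'M[C]_m)
   (U : 'I_4 -> 'M[C]_m) (V' := V *m \sum_i Q n i *t U i) :
    V^t* *m V = 1%:M -> (forall j, V^t* *m Q n' j *m V = \sum_i Q n i *t E i j) ->
    (forall i, (U i)^t* *m U i = 1%:M) ->
  V'^t* *m V' = 1%:M /\
  (forall j, V'^t* *m Q n' j *m V' = \sum_i Q n i *t ((U i)^t* *m E i j *m U i)).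
Proof.
move=> Viso VQ UU; split=> [|j]; rewrite trmxC_mul block_tensC.
  rewrite mulmxA -(mulmxA _ _ V) Viso mulmx1 block_tens_mul -[RHS](block_tens1 C n m).
  by apply: eq_bigr => i _; rewrite UU.
rewrite /V' !mulmxA -(mulmxA _ _ (Q n' j)) -(mulmxA _ _ V) VQ !block_tens_mul.
by [].
Qed.

(** For i = j both factors are spectral projections of the same symmetry, and distinct [k], [l] on
    its side belong to opposite eigenvalues. For [i], [j] on different sides, preservation of sides
    makes (k, l) allowed. No forbidden corner mixes [s] with [t], so the symmetries of the two sides
    can be chosen independently. *)
Lemma symE_allowed m (s t : 'M[C]_m) i j k l : is_symmetry s -> is_symmetry t ->
  block_allowed i j -> ~~ block_allowed k l -> symE s t i k *m symE s t j l = 0.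
Proof.
move=> ss st ij kl; rewrite /symE.
have [ik|] := eqVneq (side i) (side k); last by rewrite mul0mx.
have [jl|] := eqVneq (side j) (side l); last by rewrite mulmx0.
case/orP: ij => [/eqP ij|/andP[i2 j2]].
  case: _ / ij in jl *.
  have sy : is_symmetry (if side i then s else t) by case: ifP.
  rewrite sym_proj_mul //; case: eqP => // e; case/negP: kl.
  rewrite /block_allowed; apply/orP; left; apply/eqP; move: e.
  have [->|ki] := eqVneq i k; first by case: eqP.
  have [<-//|li] := eqVneq i l.
  move=> _; transitivity (partner i); last apply: esym; apply: same_side.
  - exact: esym ik.
  - by rewrite eq_sym.
  - exact: esym jl.
  - by rewrite eq_sym.
case/negP: kl; apply/orP; right; rewrite -[(k < 2)%N]/(side k) -ik /side i2 /=.
by rewrite leqNgt -[(l < 2)%N]/(side l) -jl /side -leqNgt.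
Qed.

Lemma symE_idem m (s t : 'M[C]_m) i j : is_symmetry s -> is_symmetry t ->
  symE s t i j *m symE s t i j = symE s t i j.
Proof.
move=> ss st; rewrite /symE; case: ifP => _; last exact: mulmx0.
by rewrite sym_proj_mul ?eqxx //; case: ifP.
Qed.

Lemma symmodel_emb n n' m (V : 'M[C]_(r n', r n * m)) (s t : 'M[C]_m) :
    (0 < m)%N -> is_symmetry s -> is_symmetry t -> V^t* *m V = 1%:M ->
    (forall j, V^t* *m Q n' j *m V = \sum_i Q n i *t symE s t i j) ->
  exists phi : starEmb C n n', symmodel phi V s t.
Proof.
move=> m0 ss st Viso VQ.
have [phi mV] := model_emb m0 Viso VQ (fun i j => symE_idem i j ss st)
  (fun i j k l => @symE_allowed m s t i j k l ss st).
by exists phi.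
Qed.

Lemma castmx_sandwich N k k' (e : k = k') (V : 'M[C]_(N, k)) (a : 'M[C]_k') :
  V *m castmx (esym e, esym e) a *m V^t* =
  castmx (erefl N, e) V *m a *m (castmx (erefl N, e) V)^t*.
Proof. by case: _ / e a => a; rewrite !castmx_id. Qed.

Lemma amplify_multiplicity_one n n' (phi : starEmb C n n') (V : 'M[C]_(r n', r n * 1)) :
  V^t* *m V = 1%:M -> (forall a, phi a = amplify V a :> fullmx n') -> multiplicity_one phi.
Proof.
move=> Viso VE; have FE := star_extE Viso VE.
exists (fun=> castmx (erefl, muln1 _) V); split=> [k l|a].
  by rewrite !ord1 eqxx castmx_iso.
by rewrite FE big_ord1 /amplify mxtens.tens_mx_scalar scale1r castmx_sandwich.
Qed.

(** A unitary that diagonalizes [s] and [t] splits C^m into coordinate lines. On each line the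
    symmetries are scalars 1 or -1, so the slice [W k] of the isometry gives an embedding of
    multiplicity one. *)
Lemma symmodel_regular n n' (phi : starEmb C n n') m V (s t : 'M[C]_m) :
  symmodel phi V s t -> s *m t = t *m s -> regular phi.
Proof.
move=> [ss st [Viso VE VQ]] cst; have [u [uu uu' ds dt]] := sympair_diag ss st cst.
have [] := twist_isometry Viso VQ (fun=> uu); rewrite -tensmx_suml sum_block_proj.
set V' := V *m _ => V'iso V'Q.
have V'E a : amplify V' a = amplify V a.
  rewrite /amplify trmxC_mul trmxC_tens trmxC1 !mulmxA -!(mulmxA V).
  by rewrite !tensmx_mul mul1mx !mulmx1 uu'.
clearbody V'.
pose e k : 'M[C]_(m, 1) := delta_mx k 0.
have ee k l : (e k)^t* *m e l = (k == l)%:R%:M.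
  rewrite trmxC_delta mul_delta_mx_cond; apply/matrixP=> i j.
  by case: (k == l); rewrite ?mulr1n ?mulr0n !ord1 !mxE ?eqxx ?mul0rn.
pose W k : 'M[C]_(r n', r n * 1) := V' *m (1%:M *t e k).
have WW k l : (W k)^t* *m W l = (k == l)%:R%:M.
  rewrite trmxC_mul mulmxA -(mulmxA _ _ V') V'iso mulmx1 trmxC_tens tensmx_mul ee trmxC1 mul1mx.
  by rewrite -[X in _ *t X]scalemx1 tensmxZr tensmx11 scalemx1.
have dsym k x : is_symmetry x -> is_diag_mx (u^t* *m x *m u) ->
    is_symmetry ((e k)^t* *m (u^t* *m x *m u) *m e k).
  move=> [xh xx] dx; split; first by rewrite !trmxC_mul !trmxCK xh !mulmxA.
  set y := u^t* *m x *m u in dx *.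
  have yy : y *m y = 1%:M by rewrite conj_mul // xx mulmx1.
  have e1 i j : e k i j = (i == k)%:R by rewrite mxE ord1 eqxx andbT.
  have yk : y *m e k = y k k *: e k.
    apply/colP=> i; rewrite mxE [LHS](bigD1 k) //= [X in _ + X]big1 => [|l lk].
      rewrite addr0 [RHS]mxE !e1 eqxx mulr1; have [->|ik] := eqVneq i k; first by rewrite mulr1.
      by rewrite (is_diag_mxP dx) // mulr0.
    by rewrite e1 (negPf lk) mulr0.
  have ykk : y k k * y k k = 1.
    have /colP/(_ k) : y *m (y *m e k) = e k by rewrite mulmxA yy mul1mx.
    by rewrite yk -scalemxAr yk scalerA [LHS]mxE !e1 !eqxx mulr1.
  have -> : (e k)^t* *m y *m e k = (y k k)%:M.
    by rewrite -mulmxA yk -scalemxAr ee eqxx scalemx1.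
  by rewrite -scalar_mxM ykk.
have /fin_all_exists[psi psiP] k : exists psi : starEmb C n n',
    model psi (W k) (symE ((e k)^t* *m (u^t* *m s *m u) *m e k)
      ((e k)^t* *m (u^t* *m t *m u) *m e k)).
  have ek : (e k)^t* *m e k = 1%:M by rewrite ee eqxx.
  have [] := @symmodel_emb n n' 1 (W k) _ _ isT (dsym k s ss ds) (dsym k t st dt).
  - by rewrite WW eqxx.
  - move=> j; rewrite /W trmxC_mul !mulmxA -(mulmxA _ _ (Q n' j)) -(mulmxA _ _ V') V'Q.
    rewrite trmxC_tens trmxC1 mulmx_sumr mulmx_suml; apply: eq_bigr => i _.
    by rewrite !tensmx_mul mul1mx mulmx1 symE_conj // symE_conj // !mulmxA.
  by move=> psi [_ _ mpsi]; exists psi.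
have WE a : amplify V' a = \sum_k amplify (W k) a.
  have sum_ee : \sum_k e k *m (e k)^t* = 1%:M.
    apply/matrixP=> i j; rewrite summxE [LHS](bigD1 i) //= [X in _ + X]big1 => [|l li].
      by rewrite addr0 trmxC_delta mul_delta_mx !mxE eqxx [j == i]eq_sym.
    by rewrite trmxC_delta mul_delta_mx mxE [i == l]eq_sym (negPf li).
  rewrite /amplify -sum_ee tensmx_sumr mulmx_sumr mulmx_suml; apply: eq_bigr => k _.
  rewrite trmxC_mul trmxC_tens trmxC1 !mulmxA -!(mulmxA V').
  by rewrite !tensmx_mul mul1mx !mulmx1.
clearbody W.
have psiE k a : psi k a = amplify (W k) a :> fullmx n' by rewrite (modelE (psiP k)).
exists m, psi; split=> [k|].
  by apply: (amplify_multiplicity_one (V := W k)) => //; rewrite WW eqxx.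
split=> [k l kl a b|a].
  have Wlk := WW _ _ : (W k)^t* *m W l = _; rewrite (negPf kl) raddf0 in Wlk.
  rewrite !psiE -!amplifyC; split; rewrite /amplify -!mulmxA.
    by rewrite (mulmxA ((W k)^t* )) Wlk mul0mx !mulmx0.
  by rewrite (mulmxA ((W k)^t* )) Wlk mul0mx !mulmx0.
apply/val_inj; rewrite raddf_sum -[LHS]/(cycle4_val _) VE -V'E WE; apply: eq_bigr => k _.
by rewrite -psiE.
Qed.

Lemma commutes_regular n n' (phi : starEmb C n n') : has_kind false phi -> regular phi.
Proof.
move=> [m [V [s [t [_ mV st]]]]]; apply: symmodel_regular mV _.
by rewrite st expr0 scale1r.
Qed.

End Crossover.

(** * Balanced embeddings *)

Section Balanced.
Variable C : numClosedFieldType.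
Local Notation fullmx n := 'M[C]_(\sum_i bsize n i).
Local Notation r n := (\sum_i bsize n i)%N.
Local Notation Q n := (block_projmx C n).

(* All four joint spectral projections of the two symmetries have the same rank. *)
Definition balanced_pair m (s t : 'M[C]_m) := [/\ \tr s = 0, \tr t = 0 & \tr (s *m t) = 0].

(** The multiplicity is a parameter because its divisibility by 4 permits a commuting
    replacement. *)
Definition balanced m n n' (phi : cycle4 C n -> cycle4 C n') :=
  exists V (s t : 'M[C]_m), [/\ (0 < m)%N, symmodel phi V s t & balanced_pair s t].

Definition balanced_regular m n n' (phi : cycle4 C n -> cycle4 C n') :=
  exists V (s t : 'M[C]_m),
    [/\ (0 < m)%N, symmodel phi V s t, balanced_pair s t & s *m t = t *m s].

Lemma balanced_pair_tens m m' (s t : 'M[C]_m) (s' t' : 'M[C]_m') :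
  balanced_pair s t -> balanced_pair (s *t s') (t *t t').
Proof.
by case=> s0 t0 st0; split; rewrite ?tensmx_mul mxtrace_tens ?s0 ?t0 ?st0 mul0r.
Qed.

Lemma balanced_comp m m' n n' n'' (phi : cycle4 C n -> cycle4 C n')
    (psi : cycle4 C n' -> cycle4 C n'') :
  balanced m phi -> balanced m' psi -> balanced (m * m') (psi \o phi).
Proof.
move=> [V [s [t [m0 mV bst]]]] [W [s' [t' [m0' mW _]]]].
exists (compose_isometry V W), (s *t s'), (t *t t').
split; [by rewrite muln_gt0 m0 | exact: symmodel_comp | exact: balanced_pair_tens].
Qed.

Lemma balanced_ext m n n' (phi psi : cycle4 C n -> cycle4 C n') :
  phi =1 psi -> balanced m phi -> balanced m psi.
Proof.
move=> e [V [s [t [m0 [ss st mV] bst]]]]; exists V, s, t; split=> //.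
by split=> //; apply: model_ext mV.
Qed.

Lemma anticommutes_balanced n n' (phi : cycle4 C n -> cycle4 C n') :
  has_kind true phi -> exists2 m, ~~ odd m & balanced m phi.
Proof.
move=> [m [V [s [t [m0 mV]]]]]; rewrite expr1 scaleN1r => st; have [ss st' _] := mV.
have ts : t *m s = - (s *m t) by rewrite st opprK.
have s0 := anticomm_tr0 ss st' st.
exists m; first exact: symmetry_tr0_even ss s0.
exists V, s, t; split=> //; split=> //; first exact: anticomm_tr0 ts.
exact: anticomm_tr_mul0.
Qed.

Lemma balanced_regular_kind m n n' (phi : cycle4 C n -> cycle4 C n') :
  balanced_regular m phi -> has_kind false phi.
Proof.
move=> [V [s [t [m0 mV _ st]]]]; exists m, V, s, t; split=> //.
by rewrite expr0 scale1r.
Qed.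

Lemma symmetry_equiv m (s s' : 'M[C]_m) : is_symmetry s -> is_symmetry s' -> \tr s = \tr s' ->
  exists u : 'M[C]_m, [/\ u^t* *m u = 1%:M, u *m u^t* = 1%:M & s *m u = u *m s'].
Proof.
move=> ss ss' e; have s1 : is_symmetry (1%:M : 'M[C]_m) by split; rewrite ?trmxC1 ?mulmx1.
have := sympair_equiv ss' s1 ss s1.
rewrite !mulmx1 !mul1mx => /(_ erefl erefl (esym e) erefl (esym e))[u [uu uu' us _]].
by exists u.
Qed.

(** Each symmetry is unitarily equivalent to its standard counterpart, but through separate
    unitaries [u] and [v]. Twisting by [u] on the blocks of one side and by [v] on the other
    achieves both at once. *)
Lemma balanced_twist m n n' (phi : cycle4 C n -> cycle4 C n') : balanced m phi -> (4 %| m)%N ->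
  exists V (s t : 'M[C]_m), [/\
    [/\ is_symmetry s, is_symmetry t, balanced_pair s t & s *m t = t *m s],
    V^t* *m V = 1%:M & forall j, V^t* *m Q n' j *m V = \sum_i Q n i *t symE s t i j].
Proof.
move=> [V [s0 [t0 [m0 [ss0 st0 [Viso VE VQ]] [trs0 trt0 _]]]]] m4.
have [s [t [ss st cst bst]]] := standard_sympair C m4.
have [trs trt _] := bst.
have [u [uu _ us]] := symmetry_equiv ss0 ss (etrans trs0 (esym trs)).
have [v [vv _ vt]] := symmetry_equiv st0 st (etrans trt0 (esym trt)).
have UU i : (if side i then u else v)^t* *m (if side i then u else v) = 1%:M by case: ifP.
have [V'iso V'Q] := twist_isometry Viso VQ UU.
exists (V *m \sum_i Q n i *t (if side i then u else v)), s, t; split=> // j.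
rewrite V'Q; apply: eq_bigr => i _; congr (_ *t _); rewrite /symE.
case: (side i == side j); last by rewrite mulmx0 mul0mx.
by case: (side i); rewrite sym_proj_conj // -mulmxA ?us ?vt mulmxA ?uu ?vv mul1mx.
Qed.

Lemma balanced_regular_exists m n n' (phi : cycle4 C n -> cycle4 C n') :
  balanced m phi -> (4 %| m)%N -> exists psi : starEmb C n n', balanced_regular m psi.
Proof.
move=> bphi m4; have m0 : (0 < m)%N by case: bphi => ? [? [? []]].
have [V [s [t [[ss st bst cst] Viso VQ]]]] := balanced_twist bphi m4.
have [psi mpsi] := symmodel_emb m0 ss st Viso VQ.
by exists psi, V, s, t.
Qed.

(* The partial isometry Y Z^* intertwines the block projections, and the blocks
   of the complements of its initial and final spaces have equal ranks. *)
Lemma isometries_conjugate n n' N (Y Z : 'M[C]_(r n', r n * N)) (E : 'I_4 -> 'I_4 -> 'M[C]_N) :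
    Y^t* *m Y = 1%:M -> Z^t* *m Z = 1%:M ->
    (forall j, Q n' j *m Y = Y *m \sum_i Q n i *t E i j) ->
    (forall j, Q n' j *m Z = Z *m \sum_i Q n i *t E i j) ->
  exists w : fullmx n', [/\ w^t* *m w = 1%:M, forall j, Q n' j *m w = w *m Q n' j & w *m Z = Y].
Proof.
move=> YY ZZ QY QZ.
have QSh j (X : 'M[C]_(r n', r n * N)) : X^t* *m X = 1%:M ->
    Q n' j *m X = X *m (\sum_i Q n i *t E i j) ->
    X^t* *m Q n' j = (\sum_i Q n i *t E i j) *m X^t*.
  move=> XX QX; have <- : X^t* *m (X *m \sum_i Q n i *t E i j) = \sum_i Q n i *t E i j.
    by rewrite mulmxA XX mul1mx.
  rewrite -QX; have := congr1 (fun M => M^t*) QX.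
  rewrite !trmxC_mul block_projmxC => ->.
  have -> : (\sum_i Q n i *t E i j)^t* = X^t* *m (Q n' j *m X).
    have <- : X^t* *m (Q n' j *m X) = \sum_i Q n i *t E i j by rewrite QX mulmxA XX mul1mx.
    by rewrite !trmxC_mul trmxCK block_projmxC mulmxA.
  by [].
(* The part of block [j] outside the range of [X]. *)
pose co (X : 'M[C]_(r n', r n * N)) j := Q n' j *m (1%:M - X *m X^t* ).
have coC X j : X^t* *m X = 1%:M -> Q n' j *m X = X *m (\sum_i Q n i *t E i j) ->
    co X j = (1%:M - X *m X^t* ) *m Q n' j.
  move=> XX QX; rewrite /co mulmxBr mulmxBl mulmx1 mul1mx mulmxA QX -!mulmxA.
  by rewrite (QSh j X XX QX).
have coK (X : 'M[C]_(r n', r n * N)) : X^t* *m X = 1%:M ->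
    (1%:M - X *m X^t* ) *m (1%:M - X *m X^t* ) = 1%:M - X *m X^t*.
  move=> XX; rewrite mulmxBr mulmx1 mulmxBl mul1mx -mulmxA (mulmxA (X^t* )) XX mul1mx.
  by rewrite subrr subr0.
have coP X j : X^t* *m X = 1%:M -> Q n' j *m X = X *m (\sum_i Q n i *t E i j) ->
    is_proj (co X j).
  move=> XX QX; split.
    by rewrite {2}(coC _ _ XX QX) /co trmxC_mul block_projmxC trmxCB trmxC1 trmxC_mul trmxCK.
  rewrite {1}(coC _ _ XX QX) {1}/co mulmxA -(mulmxA _ (Q n' j) (Q n' j)) block_projM eqxx.
  by rewrite -(coC _ _ XX QX) /co -mulmxA coK.
have coO X i j : X^t* *m X = 1%:M -> (forall j, Q n' j *m X = X *m (\sum_i Q n i *t E i j)) ->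
    i != j -> co X i *m co X j = 0.
  move=> XX QX ij; rewrite (coC _ i) // /co mulmxA -(mulmxA _ (Q n' i)) block_projM.
  by rewrite (negPf ij) mulmx0 mul0mx.
have cotr X j : X^t* *m X = 1%:M -> Q n' j *m X = X *m (\sum_i Q n i *t E i j) ->
    \tr (co X j) = \tr (Q n' j) - \tr (\sum_i Q n i *t E i j).
  move=> XX QX; rewrite /co mulmxBr mulmx1 mulmxA QX raddfB /= -mulmxA mxtrace_mulC.
  by rewrite -mulmxA XX mulmx1.
have coS X : \sum_j co X j = 1%:M - X *m X^t*.
  by rewrite -mulmx_suml sum_block_proj mul1mx.
(* The trace of [co X j] depends on [X] only through the common coefficients [E]. *)
have etr j : \tr (co Z j) = \tr (co Y j) by rewrite !cotr.
have [u [uu uu' uco]] := proj_family_equiv (fun j => coP Z j ZZ (QZ j))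
   (fun j => coP Y j YY (QY j)) (fun i j => coO Z i j ZZ QZ)
   (fun i j => coO Y i j YY QY) etr.
rewrite !coS in uu uu'.
have uZ : u *m Z = 0.
  apply: mulCmx_eq0; rewrite trmxC_mul mulmxA -(mulmxA _ _ u) uu mulmxBr mulmx1.
  by rewrite mulmxA ZZ mul1mx subrr mul0mx.
have uY : u^t* *m Y = 0.
  apply: mulCmx_eq0; rewrite trmxC_mul trmxCK mulmxA -(mulmxA _ u) uu' mulmxBr mulmx1.
  by rewrite mulmxA YY mul1mx subrr mul0mx.
have Yu : Y^t* *m u = 0 by rewrite -[LHS]trmxCK trmxC_mul trmxCK uY trmxC0.
exists (Y *m Z^t* + u); split.
- rewrite trmxCD trmxC_mul trmxCK mulmxDl !mulmxDr uu !mulmxA uY mul0mx add0r.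
  by rewrite -(mulmxA Z _ Y) YY mulmx1 -mulmxA Yu mulmx0 addr0 addrC subrK.
- move=> j; rewrite mulmxDr mulmxDl mulmxA QY -!mulmxA (QSh j Z) //; congr (_ + _).
  have := uco j; rewrite (coC Z) // /co mulmxBr !mulmxA mulmxBr mulmxA uZ mul0mx subr0 !mulmx1.
  by rewrite mulmxBl -(mulmxA _ (Y^t* )) Yu mulmx0 subr0.
by rewrite mulmxDl uZ addr0 -mulmxA ZZ mulmx1.
Qed.

(** A commuting replacement [chi] of [psi], composed with [phi'], has the same invariants as
    [psi \o phi]: both pairs of symmetries commute and are balanced. After a change of model the two
    composites have equal coefficients, so a block diagonal unitary carries one to the other;
    absorbed into [chi], it gives [psi']. *)
Lemma balanced_regular_factor m m' n n' n'' (phi : starEmb C n n') (psi : starEmb C n' n'')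
    (phi' : starEmb C n n') :
    balanced m phi -> balanced m' psi -> (4 %| m')%N -> has_kind false (psi \o phi) ->
    balanced_regular m phi' ->
  exists2 psi' : starEmb C n' n'', balanced_regular m' psi' & forall a, psi' (phi' a) = psi (phi a).
Proof.
move=> bphi bpsi m4 kG [V' [s1 [t1 [_ mV' bst1 cst1]]]].
have [V [s [t [m0 mV bst]]]] := bphi; have [W [s' [t' [m0' mW _]]]] := bpsi.
have [W' [s2 [t2 [[ss2 st2 bst2 cst2] W'iso W'Q]]]] := balanced_twist bpsi m4.
have [chi mchi] := symmodel_emb m0' ss2 st2 W'iso W'Q.
have kY := symmodel_comp mV mW; have kZ := symmodel_comp mV' mchi.
set Y := compose_isometry V W in kY; set Z := compose_isometry V' W' in kZ.
have [sY tY mY] := kY; have [sZ tZ mZ] := kZ.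
have cY : (s *t s') *m (t *t t') = (t *t t') *m (s *t s').
  have [N [X [S [T [_ mX ST]]]]] := kG.
  have [u [_ uu' -> ->]] := symE_change kY mX.
  by rewrite !conj_mul // ST expr0 scale1r.
have cZ : (s1 *t s2) *m (t1 *t t2) = (t1 *t t2) *m (s1 *t s2) by rewrite !tensmx_mul cst1 cst2.
have [trs trt trst] := balanced_pair_tens s' t' bst.
have [trs1 trt1 trst1] := balanced_pair_tens s2 t2 bst1.
have [u [uu uu' us ut]] := sympair_equiv sZ tZ sY tY cZ cY (etrans trs1 (esym trs))
  (etrans trt1 (esym trt)) (etrans trst1 (esym trst)).
(* A constant twist: [Y'] still describes [psi \o phi], now with the coefficients of [Z]. *)
have [Y'iso Y'Q] := twist_isometry (model_iso mY) (model_coef mY) (fun=> uu).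
rewrite -tensmx_suml sum_block_proj in Y'iso Y'Q.
set Y' := Y *m (1%:M *t u) in Y'iso Y'Q.
have Y'E a : amplify Y' a = amplify Y a.
  rewrite /amplify trmxC_mul trmxC_tens trmxC1 !mulmxA -!(mulmxA Y).
  by rewrite !tensmx_mul mul1mx !mulmx1 uu'.
have Y'Q' j : Y'^t* *m Q n'' j *m Y' = \sum_i Q n i *t symE (s1 *t s2) (t1 *t t2) i j.
  rewrite Y'Q; apply: eq_bigr => i _; rewrite symE_conj // -!mulmxA -us -ut.
  by rewrite !(mulmxA (u^t* )) uu !mul1mx.
clearbody Y'.
have pZ := model_proj mZ.
have pY' j : Q n'' j *m Y' = Y' *m \sum_i Q n i *t symE (s1 *t s2) (t1 *t t2) i j.
  rewrite -Y'Q'.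
  have := model_range_comm mY j; rewrite -amplify1 -Y'E amplify1 => comm.
  by rewrite !mulmxA -comm -!mulmxA Y'iso mulmx1.
have [w [ww wQ wZ]] := isometries_conjugate Y'iso (model_iso mZ) pY' pZ.
(* [w] commutes with the block projections, so [w *m W'] keeps the coefficients of [W']. *)
have [psi' mpsi'] : exists psi' : starEmb C n' n'', symmodel psi' (w *m W') s2 t2.
  apply: symmodel_emb => // [|j]; rewrite trmxC_mul mulmxA -(mulmxA _ _ w).
    by rewrite ww mulmx1.
  by rewrite -!mulmxA (mulmxA (Q n'' j)) wQ !mulmxA -(mulmxA _ _ w) ww mulmx1 W'Q.
exists psi'; first by exists (w *m W'), s2, t2.
move=> a; apply/val_inj.
have [_ _ mE] := symmodel_comp mV' mpsi'.
have := modelE mE a; rewrite /= => ->; have := modelE mY a; rewrite /= => ->.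
by rewrite -Y'E -wZ /compose_isometry mulmxA.
Qed.

End Balanced.

(** * Generic embeddings *)

Section Generic.
Variable C : numClosedFieldType.
Local Notation fullmx n := 'M[C]_(\sum_i bsize n i).
Local Notation r n := (\sum_i bsize n i)%N.
Local Notation Q n := (block_projmx C n).

Lemma multiplicity_one_amplify n n' (phi : starEmb C n n') : multiplicity_one phi ->
  exists V : 'M[C]_(r n', r n * 1),
    V^t* *m V = 1%:M /\ forall a, phi a = amplify V a :> fullmx n'.
Proof.
move=> [V [Viso VE]]; exists (castmx (erefl, esym (muln1 _)) (V ord0)); split.
  by apply: castmx_iso; rewrite Viso eqxx.
move=> a; rewrite -(star_extP phi).2 VE big_ord1 /amplify mxtens.tens_mx_scalar scale1r.
by rewrite castmx_sandwich castmx_comp /= castmx_id.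
Qed.

(** Rigidity at the unit puts the image of [Q n i] under [Q n' (theta i)], so [Q n' j] either fixes
    or kills it. *)
Lemma rigid_block_proj n n' theta (phi : starEmb C n n') (V : 'M[C]_(r n', r n * 1)) i j :
    rigid_of_type theta phi -> V^t* *m V = 1%:M ->
    (forall a, phi a = amplify V a :> fullmx n') ->
  Q n' j *m V *m (Q n i *t 1%:M) = (theta i == j)%:R *: (V *m (Q n i *t 1%:M)).
Proof.
move=> [_ _ H] Viso VE; have [b] := H i i 1.
move=> /(congr1 (@cycle4_val C n')); rewrite VE.
have -> : cycle4_val (block_proj C n i * 1 * block_proj C n i) = Q n i.
  by rewrite -[LHS]/(Q n i *m 1%:M *m Q n i) mulmx1 block_projM eqxx.
rewrite -[X in _ = X]/(Q n' (theta i) *m cycle4_val b *m Q n' (theta i)) => VQ.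
have QVQ : Q n' j *m amplify V (Q n i) = (theta i == j)%:R *: amplify V (Q n i).
  rewrite VQ !mulmxA block_projM eq_sym.
  by case: eqP => [->|_]; rewrite ?scale1r // !mul0mx scale0r.
have := congr1 (fun x => x *m V) QVQ; rewrite /amplify /= -scalemxAl.
by rewrite -!mulmxA Viso mulmx1 !mulmxA.
Qed.

(** Collecting the isometries [V k] in one model [W] makes all coefficients diagonal: the k-th entry
    of [E i j] records whether [theta k] sends [i] to [j]. Diagonal matrices commute. *)
Lemma rigid_decomposition_commutes n n' (phi : starEmb C n n') m
    (psi : 'I_m -> starEmb C n n') theta :
  rigid_decomposition psi theta phi -> has_kind false phi.
Proof.
move=> [rig [orth phiE]].
have /fin_all_exists[V VP] k : exists V : 'M[C]_(r n', r n * 1),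
    V^t* *m V = 1%:M /\ forall a, psi k a = amplify V a :> fullmx n'.
  by case: (rig k) => /multiplicity_one_amplify.
have VV k l : (V k)^t* *m V l = (k == l)%:R *: 1%:M.
  have [<-|kl] := eqVneq k l; first by rewrite scale1r (VP k).1.
  (* Orthogonality of the ranges is tested on the images of 1. *)
  rewrite scale0r; have [] := orth k l kl 1 1; rewrite (VP k).2 (VP l).2 -amplifyC trmxC1.
  rewrite !amplify1 => /(congr1 (fun x => (V k)^t* *m x *m V l)) + _.
  rewrite /= !mulmxA (VP k).1 mul1mx -!mulmxA (VP l).1 mulmx1.
  by rewrite mul0mx mulmx0.
pose E i j : 'M[C]_m := diag_mx (\row_k (theta k i == j)%:R).
have QV k j : Q n' j *m V k = V k *m \sum_i (theta k i == j)%:R *: (Q n i *t 1%:M).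
  rewrite -[LHS]mulmx1 -(block_tens1 C n 1) !mulmx_sumr; apply: eq_bigr => i _.
  by rewrite (rigid_block_proj i j (rig k) (VP k).1 (VP k).2) scalemxAr.
pose d (k : 'I_m) : 'M[C]_(r n * 1, r n * m) := 1%:M *t delta_mx 0 k.
pose W := \sum_k V k *m d k.
have dd k (A : fullmx n) : (d k)^t* *m (A *t 1%:M) *m d k = A *t delta_mx k k.
  by rewrite trmxC_tens trmxC1 trmxC_delta !tensmx_mul mul1mx !mulmx1 mul_delta_mx.
have WM A : W^t* *m A *m W = \sum_k \sum_l (d k)^t* *m ((V k)^t* *m A *m V l) *m d l.
  rewrite /W trmxC_sum !mulmx_suml; apply: eq_bigr => k _; rewrite mulmx_sumr.
  by apply: eq_bigr => l _; rewrite trmxC_mul !mulmxA.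
have WM1 A (B : 'I_m -> 'M[C]_(r n * 1)) :
    (forall k l, (V k)^t* *m A *m V l = (k == l)%:R *: B k) ->
    W^t* *m A *m W = \sum_k (d k)^t* *m B k *m d k.
  move=> AB; rewrite WM; apply: eq_bigr => k _; rewrite [LHS](bigD1 k) //=.
  rewrite [X in _ + X]big1 => [|l lk]; first by rewrite addr0 AB eqxx scale1r.
  by rewrite AB eq_sym (negPf lk) scale0r mulmx0 mul0mx.
have sum_delta (c : 'I_m -> C) : \sum_k c k *: delta_mx k k = diag_mx (\row_k c k).
  by rewrite diag_mx_sum_delta; apply: eq_bigr => k _; rewrite mxE.
have Wiso : W^t* *m W = 1%:M.
  rewrite -[W^t*]mulmx1 (WM1 _ (fun=> 1%:M)) => [|k l]; last by rewrite mulmx1 VV.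
  transitivity (\sum_k (1%:M : fullmx n) *t (delta_mx k k : 'M[C]_m)).
    by apply: eq_bigr => k _; rewrite -tensmx11 dd.
  rewrite -tensmx_sumr -[RHS]tensmx11; congr (_ *t _).
  transitivity (\sum_k (1 : C) *: delta_mx k k : 'M[C]_m).
    by apply: eq_bigr => k _; rewrite scale1r.
  by rewrite sum_delta -(diag_const_mx _ 1); congr diag_mx; apply/rowP=> k; rewrite !mxE.
have WE a : phi a = amplify W a :> fullmx n'.
  rewrite phiE -[LHS]/(\val _) raddf_sum /amplify {1}/W !mulmx_suml; apply: eq_bigr => k _.
  rewrite /W trmxC_sum mulmx_sumr [RHS](bigD1 k) //= [X in _ + X]big1 => [|l lk].
    rewrite addr0 -[LHS]/(cycle4_val _) (VP k).2 /amplify trmxC_mul !mulmxA -!(mulmxA (V k)).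
    rewrite /d trmxC_tens trmxC1 trmxC_delta !tensmx_mul mul1mx !mulmx1 mul_delta_mx.
    by have -> : delta_mx 0 0 = 1%:M :> 'M[C]_1 by apply/matrixP=> x y; rewrite !ord1 !mxE.
  rewrite trmxC_mul !mulmxA -!(mulmxA (V k)) /d trmxC_tens trmxC1 trmxC_delta !tensmx_mul.
  by rewrite !mulmx1 mul_delta_mx_cond eq_sym (negPf lk) mxtens.tensmx0 mul0mx mulmx0.
have WQ j : W^t* *m Q n' j *m W = \sum_i Q n i *t E i j.
  rewrite (WM1 _ (fun k => \sum_i (theta k i == j)%:R *: (Q n i *t 1%:M))) => [|k l]; last first.
    rewrite -mulmxA QV mulmxA VV -scalemxAl mul1mx.
    by have [->|] := eqVneq k l; rewrite ?scale1r ?scale0r.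
  transitivity (\sum_k \sum_i Q n i *t ((theta k i == j)%:R *: delta_mx k k : 'M[C]_m)).
    apply: eq_bigr => k _; rewrite mulmx_sumr mulmx_suml; apply: eq_bigr => i _.
    by rewrite -scalemxAr -scalemxAl dd tensmxZr.
  by rewrite exchange_big; apply: eq_bigr => i _; rewrite -tensmx_sumr sum_delta.
have mW : model phi W E by split.
have sth k i : side (theta k i) = side i by case: (rig k) => _ /(_ i).
have fE : side_flip E.
  split=> [i j ij|i]; apply/matrixP=> k l; rewrite !mxE.
    by rewrite (_ : (theta k i == j) = false) ?mul0rn //; apply: contra_neqF ij => /eqP <-.
  rewrite -mulrnDl; congr (_ *+ _).
  (* The preimage [x] of [i] under [theta k] is [i] or its partner, so exactly one of the two
     entries is 1. *)
  have [x ->] : exists x, i = theta k x by exists ((theta k)^-1%g i); rewrite permKV.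
  rewrite !(inj_eq perm_inj); have := sth k x; set y := theta k x => yx.
  have [<-|ne] := eqVneq y x; first by rewrite (negPf (partner_neq y)) addr0.
  have <- : x = partner y by apply: same_side => //; rewrite eq_sym.
  by rewrite eqxx add0r.
have cE := model_coefs mW; have [s [t [ss st Est]]] := side_flip_symE cE fE.
exists m, W, s, t; split; first exact: model_gt0 mW.
  by split=> //; apply: model_ext mW.
rewrite expr0 scale1r; have := symE_base s t; rewrite -!Est => -[<- <-].
by apply: double_sub1_comm; rewrite /E diag_mxC.
Qed.

Lemma generic_commutes n n' (phi : starEmb C n n') : generic phi -> has_kind false phi.
Proof.
by move=> [m [psi [theta [rig _]]]]; apply: rigid_decomposition_commutes rig.
Qed.

End Generic.

(** * Direct limits *)

Section DirectLimits.
Variable K : pzRingType.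

HB.instance Definition _ (X : nat -> lmodType K) (f : forall k, {linear X k -> X k.+1}) k l
  (le_kl : (k <= l)%N) :=
  GRing.isLinear.Build K (X k) (X l) _ (transition f le_kl) (transition_linear f le_kl).
HB.instance Definition _ (X : nat -> lmodType K) (f : forall k, {linear X k -> X k.+1}) k :=
  GRing.isLinear.Build K (X k) (dirlim f) _ (@dl_in K X f k) (@dl_in_linear K X f k).

Lemma linear_bij_inv (U V : lmodType K) (h : {linear U -> V}) : bijective h ->
  exists h' : {linear V -> U}, cancel h h' /\ cancel h' h.
Proof.
move=> [g hg gh].
have gl : linear g by move=> c x y; apply: (can_inj hg); rewrite linearP !gh.
pose gM := GRing.isLinear.Build K V U _ g gl.
pose gL : {linear V -> U} := HB.pack g gM.
by exists gL.
Qed.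

Section Increasing.
Variable p : nat -> nat.
Hypothesis p_incr : forall i, (p i < p i.+1)%N.

Lemma increasing_mono i j : (i <= j)%N -> (p i <= p j)%N.
Proof.
elim: j => [|j IHj]; first by rewrite leqn0 => /eqP->.
rewrite leq_eqVlt => /predU1P[-> //|]; rewrite ltnS => /IHj ij.
exact: leq_trans ij (ltnW (p_incr j)).
Qed.

Lemma increasing_ge i : (i <= p i)%N.
Proof. by elim: i => // i IHi; apply: leq_ltn_trans IHi (p_incr i). Qed.

Variables (X : nat -> lmodType K) (f : forall k, {linear X k -> X k.+1}).

Lemma dl_in_cofinal (u : dirlim f) : exists i (x : X (p i)), u = dl_in f x.
Proof.
have [k [x ->]] := dl_in_surj u; exists k, (transition f (increasing_ge k) x).
by rewrite dl_in_transition.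
Qed.

Lemma dl_in_cofinal2 (u v : dirlim f) :
  exists i (x y : X (p i)), u = dl_in f x /\ v = dl_in f y.
Proof.
have [i [x ->]] := dl_in_cofinal u; have [j [y ->]] := dl_in_cofinal v.
exists (maxn i j), (transition f (increasing_mono (leq_maxl i j)) x),
  (transition f (increasing_mono (leq_maxr i j)) y).
by rewrite !dl_in_transition.
Qed.

End Increasing.

Section HalfIntertwining.
Variables (X Y : nat -> lmodType K).
Variables (f : forall k, {linear X k -> X k.+1}) (g : forall k, {linear Y k -> Y k.+1}).
Variables (p q : nat -> nat).
Variables (p_incr : forall i, (p i < p i.+1)%N) (q_incr : forall i, (q i < q i.+1)%N).
Variables (a : forall i, {linear X (p i) -> Y (q i)}) (b : forall i, Y (q i) -> X (p i.+1)).
Hypothesis ba : forall i x, b (a i x) = transition f (ltnW (p_incr i)) x.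
Hypothesis ab : forall i y, a i.+1 (b y) = transition g (ltnW (q_incr i)) y.

(** One transition on the left is [b] after [a]; a further [a] turns the last two maps into a
    transition on the right, which the limit does not see. *)
Lemma intertwining_step i j (le_ij : (p i <= p j)%N) (x : X (p i)) : (i <= j)%N ->
  dl_in g (a j (transition f le_ij x)) = dl_in g (a i x).
Proof.
move=> ij; elim: j ij le_ij => [|j IHj] ij le_ij.
  by case: i x ij le_ij => // x _ le_ij; rewrite transition_refl.
have [e|ij'] := eqVneq i j.+1.
  by case: _ / e in IHj ij le_ij *; rewrite transition_refl.
have {ij'}ij : (i <= j)%N by rewrite -ltnS ltn_neqAle ij' ij.
rewrite -(transition_trans f (increasing_mono p_incr ij) (ltnW (p_incr j))) -ba ab.
by rewrite dl_in_transition IHj.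
Qed.

Lemma intertwining_wd i j (x : X (p i)) (y : X (p j)) :
  dl_in f x = dl_in f y -> dl_in g (a i x) = dl_in g (a j y).
Proof.
move=> /dl_inP[m [le_im [le_jm exy]]].
pose k := maxn m (maxn i j).
have ik : (i <= k)%N by rewrite (leq_trans (leq_maxl i j)) // leq_maxr.
have jk : (j <= k)%N by rewrite (leq_trans (leq_maxr i j)) // leq_maxr.
have mk : (m <= p k)%N by apply: leq_trans (leq_maxl _ _) (increasing_ge p_incr k).
rewrite -(intertwining_step (increasing_mono p_incr ik) x ik).
rewrite -(intertwining_step (increasing_mono p_incr jk) y jk).
by rewrite -(transition_trans f le_im mk) -(transition_trans f le_jm mk) exy.
Qed.

Lemma half_intertwining : exists h : {linear dirlim f -> dirlim g},
  forall i x, h (dl_in f x) = dl_in g (a i x).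
Proof.
have [h hP] : exists h : dirlim f -> dirlim g, forall i x, h (dl_in f x) = dl_in g (a i x).
  (* One value has to serve all representatives of [u]; [intertwining_wd] allows this. *)
  have /choice[h hP] u : exists v, forall i (x : X (p i)), u = dl_in f x -> v = dl_in g (a i x).
    have [i [x ->]] := dl_in_cofinal p_incr u.
    by exists (dl_in g (a i x)) => j y; apply: intertwining_wd.
  by exists h => i x; apply: hP.
have hl : linear h.
  move=> c u v; have [i [x [y [-> ->]]]] := dl_in_cofinal2 p_incr u v.
  by rewrite -linearP !hP linearP linearP.
pose hM := GRing.isLinear.Build K (dirlim f) (dirlim g) _ h hl.
by exists (HB.pack h hM : {linear dirlim f -> dirlim g}).
Qed.

End HalfIntertwining.

Lemma intertwining (X Y : nat -> lmodType K)
    (f : forall k, {linear X k -> X k.+1}) (g : forall k, {linear Y k -> Y k.+1})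
    (p q : nat -> nat) (p_incr : forall i, (p i < p i.+1)%N) (q_incr : forall i, (q i < q i.+1)%N)
    (a : forall i, {linear X (p i) -> Y (q i)}) (b : forall i, {linear Y (q i) -> X (p i.+1)}) :
    (forall i x, b i (a i x) = transition f (ltnW (p_incr i)) x) ->
    (forall i y, a i.+1 (b i y) = transition g (ltnW (q_incr i)) y) ->
  exists h : {linear dirlim f -> dirlim g},
    bijective h /\ forall i x, h (dl_in f x) = dl_in g (a i x).
Proof.
move=> ba ab; have [h hP] := half_intertwining (b := b) ba ab.
(* The inverse comes from the same ladder without its first map, which shifts [p] by one. *)
have [h' h'P] := half_intertwining (p := q) (q := p \o S) (p_incr := q_incr)
  (q_incr := fun i => p_incr i.+1) (a := b) (b := fun i => a i.+1) ab (fun i => ba i.+1).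
exists h; split=> //; exists h' => u.
  by have [i [x ->]] := dl_in_cofinal p_incr u; rewrite hP h'P ba dl_in_transition.
by have [i [x ->]] := dl_in_cofinal q_incr u; rewrite h'P /= hP ab dl_in_transition.
Qed.

Lemma transition_inj (X : nat -> lmodType K) (f : forall k, {linear X k -> X k.+1}) k l
  (le_kl : (k <= l)%N) : (forall i, injective (f i)) -> injective (transition f le_kl).
Proof.
move=> finj; elim: l le_kl => [|l IHl] le_kl x y.
  by case: k le_kl x y => // le_kl x y; rewrite !transition_refl.
have [le|lt] := leqP k l; first by rewrite !(transitionS f le) => /finj/IHl.
have e : k = l.+1 by apply/eqP; rewrite eqn_leq le_kl lt.
by case: _ / e in IHl le_kl x y lt *; rewrite !transition_refl.
Qed.

Lemma dl_in_inj (X : nat -> lmodType K) (f : forall k, {linear X k -> X k.+1}) k :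
  (forall i, injective (f i)) -> injective (@dl_in K X f k).
Proof.
move=> finj x y /dl_inP[m [le_k [le_k' e]]].
by apply: (transition_inj (le_kl := le_k) finj); rewrite e (bool_irrelevance le_k' le_k).
Qed.

Lemma dl_in_family (X : nat -> lmodType K) (f : forall k, {linear X k -> X k.+1})
    (I : finType) (u : I -> dirlim f) l0 :
  exists2 l, (l0 <= l)%N & exists x : I -> X l, forall i, u i = dl_in f (x i).
Proof.
have /fin_all_exists[z zP] i : exists z : {k & X k}, u i = dl_in f (tagged z).
  by have [k [x ->]] := dl_in_surj (u i); exists (Tagged X x).
pose l := maxn l0 (\max_i tag (z i)).
have zl i : (tag (z i) <= l)%N.
  exact: leq_trans (@leq_bigmax _ (fun i => tag (z i)) i) (leq_maxr _ _).
exists l; first exact: leq_maxl.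
by exists (fun i => transition f (zl i) (tagged (z i))) => i; rewrite dl_in_transition.
Qed.

End DirectLimits.

(** * Crossover embeddings *)

Section Systems.
Variable C : numClosedFieldType.
Local Notation fullmx n := 'M[C]_(\sum_i bsize n i).
Implicit Types S : genericSystem C.

Lemma star_ext_inj n n' (phi : starEmb C n n') : injective (star_ext phi).
Proof.
have [m [V [E mV]]] := model_exists phi.
have Finj := amplify_inj (model_gt0 mV) (model_iso mV).
by move=> a b; rewrite !(star_extE (model_iso mV) (modelE mV)) => /Finj.
Qed.

Lemma star_transition_val S k l (le_kl : (k <= l)%N) (a : cycle4 C (gs_size S k)) :
  transition (gs_star_lin S) le_kl (cycle4_val a : gs_star_alg S k) =
  cycle4_val (gs_trans le_kl a).
Proof.
elim: l le_kl a => [|l IHl] le_kl a.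
  by case: k le_kl a => // le_kl a; rewrite /gs_trans !transition_refl.
have [le|lt] := leqP k l.
  by rewrite /gs_trans !(transitionS _ le) IHl; apply: (star_extP (gs_map S l)).2.
have e : k = l.+1 by apply/eqP; rewrite eqn_leq le_kl lt.
by case: _ / e in IHl le_kl a lt *; rewrite /gs_trans !transition_refl.
Qed.

Lemma star_transition_extends S k l (le_kl : (k <= l)%N) :
  star_extends (gs_trans le_kl)
    (transition (gs_star_lin S) le_kl : {linear gs_star_alg S k -> gs_star_alg S l}).
Proof.
split=> [|a]; last exact: star_transition_val.
split=> [a b|a].
  apply: (@transition_morph2 _ _ (gs_star_lin S) (fun k (a b : fullmx (gs_size S k)) => a *m b)).
  by move=> i x y; apply: (star_extP (gs_map S i)).1.1.
apply: (@transition_morph1 _ _ (gs_star_lin S) (fun k (a : fullmx (gs_size S k)) => a^t* )).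
by move=> i x; apply: (star_extP (gs_map S i)).1.2.
Qed.

Lemma star_ext_comp n n' n'' (phi : starEmb C n n') (psi : starEmb C n' n'')
    (gamma : cycle4 C n -> cycle4 C n'') (G : {linear fullmx n -> fullmx n''}) :
    (forall a, psi (phi a) = gamma a) -> star_extends gamma G ->
  forall a, star_ext psi (star_ext phi a) = G a.
Proof.
move=> pg GE a; pose F : {linear fullmx n -> fullmx n''} := star_ext psi \o star_ext phi.
apply: (@star_ext_unique _ _ _ gamma F G _ GE a); split; first split.
- by move=> x y /=; rewrite (star_extP phi).1.1 (star_extP psi).1.1.
- by move=> x /=; rewrite (star_extP phi).1.2 (star_extP psi).1.2.
by move=> x /=; rewrite (star_extP phi).2 (star_extP psi).2 pg.
Qed.

(** Extensions to the full matrix algebras are unique, so the ladder of extensions commutes as well.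
    Both ladders induce isomorphisms of the limits, and compatibility is checked stage by stage. *)
Lemma regularly_isomorphic_star S S' :
  regularly_isomorphic S S' -> star_extendibly_isomorphic S S'.
Proof.
move=> [p [q [p_incr [q_incr [f [g [_ _ gf fg]]]]]]].
pose fa i : {linear gs_alg S (p i) -> gs_alg S' (q i)} := f i.
pose ga i : {linear gs_alg S' (q i) -> gs_alg S (p i.+1)} := g i.
have [h [hbij hE]] := @intertwining _ _ _ (gs_lin S) (gs_lin S') p q p_incr q_incr fa ga gf fg.
pose fs i : {linear gs_star_alg S (p i) -> gs_star_alg S' (q i)} := star_ext (f i).
pose gs i : {linear gs_star_alg S' (q i) -> gs_star_alg S (p i.+1)} := star_ext (g i).
have gfs i x : gs i (fs i x) = transition (gs_star_lin S) (ltnW (p_incr i)) x.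
  exact: (star_ext_comp (gf i) (star_transition_extends S (ltnW (p_incr i))) x).
have fgs i x : fs i.+1 (gs i x) = transition (gs_star_lin S') (ltnW (q_incr i)) x.
  exact: (star_ext_comp (fg i) (star_transition_extends S' (ltnW (q_incr i))) x).
have [H [Hbij HE]] := @intertwining _ _ _ (gs_star_lin S) (gs_star_lin S') p q p_incr q_incr
  fs gs gfs fgs.
exists h, H; split=> // [|u v|u|u].
- split=> // u v; have [i [x [y [-> ->]]]] := dl_in_cofinal2 p_incr u v.
  by rewrite lim_mulE !hE lim_mulE; congr (dl_in _ _); apply: sembM.
- have [i [x [y [-> ->]]]] := dl_in_cofinal2 p_incr u v.
  by rewrite lim_star_mulE !HE lim_star_mulE /fs (star_extP (f i)).1.1.
- have [i [x ->]] := dl_in_cofinal p_incr u.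
  by rewrite lim_starE !HE lim_starE /fs (star_extP (f i)).1.2.
have [i [x ->]] := dl_in_cofinal p_incr u.
by rewrite lim_inclE hE HE lim_inclE /fs (star_extP (f i)).2.
Qed.

Lemma gs_trans_emb S k l (le_kl : (k <= l)%N) : (k < l)%N ->
  exists2 tau : starEmb C (gs_size S k) (gs_size S l), tau =1 gs_trans le_kl & has_kind false tau.
Proof.
elim: l le_kl => // l IHl le_kl; rewrite ltnS leq_eqVlt => /orP[/eqP e|lt].
  case: _ / e in IHl le_kl *; exists (gs_map S k); last exact/generic_commutes/gs_generic.
  by move=> a; rewrite /gs_trans (transitionS _ (leqnn k)) transition_refl.
have [tau tauE kt] := IHl (ltnW lt) lt.
have [chi chiE] := starEmb_comp tau (gs_map S l).
exists chi => [a|].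
  by rewrite chiE /= tauE /gs_trans (transitionS _ (ltnW lt)).
have := has_kind_comp kt (generic_commutes (gs_generic S l)).
by apply: has_kind_ext => a; rewrite chiE.
Qed.

Definition lim_iso S S' (h : {linear lim_alg S -> lim_alg S'})
    (H : {linear lim_star_alg S -> lim_star_alg S'}) : Prop :=
  [/\ bijective h /\ (forall u v, h (lim_mul u v) = lim_mul (h u) (h v)),
      bijective H,
      forall u v, H (lim_star_mul u v) = lim_star_mul (H u) (H v),
      forall u, H (lim_star u) = lim_star (H u) &
      forall u, H (lim_incl u) = lim_incl (h u)].

Lemma lim_iso_inv S S' h H : @lim_iso S S' h H ->
  exists h' H', [/\ @lim_iso S' S h' H', cancel h h' & cancel h' h].
Proof.
move=> [[hbij hM] Hbij HM Hs Hi].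
have [h' [hh' h'h]] := linear_bij_inv hbij; have [H' [HH' H'H]] := linear_bij_inv Hbij.
exists h', H'; split=> //; split=> [|||u|u].
- by split=> [|u v]; [exists h | apply: (can_inj hh'); rewrite hM !h'h].
- by exists H.
- by move=> u v; apply: (can_inj HH'); rewrite HM !H'H.
- by apply: (can_inj HH'); rewrite Hs !H'H.
by apply: (can_inj HH'); rewrite Hi H'H h'h.
Qed.

Definition represents S S' (h : lim_alg S -> lim_alg S') k l
    (phi : starEmb C (gs_size S k) (gs_size S' l)) : Prop :=
  forall a, h (dl_in (gs_lin S) a) = dl_in (gs_lin S') (phi a).

Lemma gs_in_inj S k : injective (@dl_in _ _ (gs_lin S) k).
Proof. by apply: dl_in_inj => i; apply: semb_inj. Qed.

Lemma gs_star_in_inj S k : injective (@dl_in _ _ (gs_star_lin S) k).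
Proof. by apply: dl_in_inj => i; apply: star_ext_inj. Qed.

Lemma lim_incl_inj S : injective (@lim_incl C S).
Proof.
move=> u v; have [k [x [y [-> ->]]]] := dl_in_surj2 u v.
by rewrite !lim_inclE => /gs_star_in_inj/val_inj->.
Qed.

(** The images of the finitely many matrix units lie in one stage [l], and linear extension defines
    [F]. Since the stages embed into the limits, [F] inherits injectivity, products and adjoints
    from [H]. *)
Lemma represents_exists S S' h H k l0 : @lim_iso S S' h H ->
  exists2 l, (l0 <= l)%N & exists phi : starEmb C (gs_size S k) (gs_size S' l), represents h phi.
Proof.
move=> [[hbij hM] Hbij HM Hs Hi].
pose I := ('I_(\sum_i bsize (gs_size S k) i) * 'I_(\sum_i bsize (gs_size S k) i))%type.
pose d (i : I) : fullmx (gs_size S k) := delta_mx i.1 i.2.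
(* Units outside the algebra get the default value 0; only the others are used below. *)
pose dA (i : I) : cycle4 C (gs_size S k) := insubd 0 (d i).
have [l1 l01 [z zE]] := dl_in_family (fun i => h (dl_in (gs_lin S) (dA i))) l0.
have [l l1l [y yE]] := dl_in_family (fun i => H (dl_in (gs_star_lin S) (d i : gs_star_alg S k))) l1.
exists l; first exact: leq_trans l01 l1l.
pose F0 (a : fullmx (gs_size S k)) : fullmx (gs_size S' l) := \sum_s \sum_t a s t *: y (s, t).
have F0l : linear F0.
  move=> c a b; rewrite /F0 scaler_sumr -big_split; apply: eq_bigr => s _.
  rewrite scaler_sumr -big_split; apply: eq_bigr => t _.
  by rewrite !mxE scalerDl scalerA.
pose F : {linear fullmx (gs_size S k) -> fullmx (gs_size S' l)} :=
  HB.pack F0 (GRing.isLinear.Build _ _ _ _ F0 F0l).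
have HF a : H (dl_in (gs_star_lin S) (a : gs_star_alg S k)) = dl_in (gs_star_lin S') (F a).
  rewrite {1}[a]matrix_sum_delta !linear_sum; apply: eq_bigr => s _.
  rewrite !linear_sum; apply: eq_bigr => t _; rewrite !linearZ; congr (_ *: _).
  exact: (yE (s, t)).
have Finj : injective F.
  move=> a b ab; apply: (@gs_star_in_inj S k); apply: (bij_inj Hbij).
  by rewrite !HF ab.
have Fs : star_hom F.
  split=> [a b|a]; apply: (@gs_star_in_inj S' l).
    by rewrite -HF -lim_star_mulE HM !HF lim_star_mulE.
  by rewrite -HF -lim_starE Hs HF lim_starE.
have Fin a : a \in @in_cycle4 C (gs_size S k) -> F a \in @in_cycle4 C (gs_size S' l).
  move=> /in_cycle4_entryP aA; rewrite /F /= /F0; apply: rpred_sum => s _; apply: rpred_sum => t _.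
  have [ast|/aA->] := boolP (block_allowed (tagnat.sig1 s) (tagnat.sig1 t)); last first.
    by rewrite scale0r rpred0.
  (* In the limit both sides are the image of the same unit, once through [H] and once through
     [h]. *)
  apply: rpredZ; suff -> : y (s, t) = cycle4_val (gs_trans l1l (z (s, t))) by apply: cycle4_valP.
  apply: (@gs_star_in_inj S' l); rewrite -yE -lim_inclE dl_in_transition -zE -Hi lim_inclE.
  by rewrite -[cycle4_val _]/(\val (dA (s, t))) insubdK // cycle4_delta.
have [phi phiE] := starEmb_restrict Fin Fs Finj.
exists phi => a; apply: (@lim_incl_inj S').
by rewrite -Hi !lim_inclE HF phiE.
Qed.

Lemma represents_comp S S' h h' k l n (phi : starEmb C (gs_size S k) (gs_size S' l))
    (psi : starEmb C (gs_size S' l) (gs_size S n)) (le_kn : (k <= n)%N) :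
  represents h phi -> represents h' psi -> cancel h h' -> forall a, psi (phi a) = gs_trans le_kn a.
Proof.
move=> hphi hpsi hh' a; apply: (@gs_in_inj S n).
by rewrite -hpsi -hphi hh' /gs_trans dl_in_transition.
Qed.

(** Extending [phi0] by a connecting map, of kind [false], keeps its kind. Followed by [psi], the
    result is again a connecting map, so [factor_kind] gives both factors the same kind. *)
Lemma represents_kind S S' h h' b k0 k l0 l (phi0 : starEmb C (gs_size S k0) (gs_size S' l0))
    (psi : starEmb C (gs_size S' l) (gs_size S k)) :
    represents h phi0 -> represents h' psi -> cancel h h' -> (k0 < k)%N -> (l0 < l)%N ->
  has_kind b phi0 -> has_kind b psi.
Proof.
move=> hphi hpsi hh' k0k l0l kphi.
have [tau tauE ktau] := @gs_trans_emb S' _ _ (ltnW l0l) l0l.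
have [chi chiE] := starEmb_comp phi0 tau.
have kchi : has_kind b chi.
  rewrite -[b]addbF; apply: has_kind_ext (has_kind_comp kphi ktau) => a.
  by rewrite chiE.
have hchi : represents h chi.
  by move=> a; rewrite hphi chiE /= tauE /gs_trans dl_in_transition.
have [ga gaE kga] := @gs_trans_emb S _ _ (ltnW k0k) k0k.
have [a|c [kc kpsi]] := @factor_kind _ _ _ _ chi psi ga _ kga.
  by rewrite gaE; apply: represents_comp.
by rewrite (has_kind_inj kchi kc).
Qed.

End Systems.

Section Chains.
Variable C : numClosedFieldType.
Implicit Types S : genericSystem C.

(** The ladder is built by dependent choice; [P] and [P'] are the invariants carried along, so that
    both signs are served. *)
Lemma regular_chain S S' (P : forall k l, starEmb C (gs_size S k) (gs_size S' l) -> Prop)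
    (P' : forall l k, starEmb C (gs_size S' l) (gs_size S k) -> Prop) :
    (exists k l phi, P k l phi) ->
    (forall k l phi, P k l phi -> exists n psi, [/\ (k < n)%N, P' l n psi &
       forall (le_kn : (k <= n)%N) a, psi (phi a) = gs_trans le_kn a]) ->
    (forall l k psi, P' l k psi -> exists n phi, [/\ (l < n)%N, P k n phi &
       forall (le_ln : (l <= n)%N) a, phi (psi a) = gs_trans le_ln a]) ->
    (forall k l phi, P k l phi -> regular phi) ->
    (forall l k psi, P' l k psi -> regular psi) ->
  regularly_isomorphic S S'.
Proof.
move=> [k0 [l0 [phi0 P0]]] step step' reg reg'.
pose T := {k : nat & {l : nat & {phi | P k l phi}}}.
pose kk (x : T) := tag x; pose ll (x : T) := tag (tagged x).
pose ff (x : T) : starEmb C (gs_size S (kk x)) (gs_size S' (ll x)) := sval (tagged (tagged x)).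
have stepT (x : T) : exists y : T, exists g : starEmb C (gs_size S' (ll x)) (gs_size S (kk y)),
    [/\ (kk x < kk y)%N, (ll x < ll y)%N, regular g,
      forall (le : (kk x <= kk y)%N) a, g (ff x a) = gs_trans le a &
      forall (le : (ll x <= ll y)%N) a, ff y (g a) = gs_trans le a].
  case: x => k [l [phi Pphi]]; rewrite /ff /kk /ll /=.
  have [n [psi [kn P'psi pp]]] := step _ _ _ Pphi.
  have [m [chi [lm Pchi cp]]] := step' _ _ _ P'psi.
  exists (Tagged (fun k => {l : nat & {phi | P k l phi}})
    (Tagged (fun l => {phi | P n l phi}) (exist _ chi Pchi))), psi.
  by split=> //; apply: reg' P'psi.
have [next nextP] := choice stepT.
pose x0 : T := Tagged (fun k => {l : nat & {phi | P k l phi}})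
  (Tagged (fun l => {phi | P k0 l phi}) (exist _ phi0 P0)).
pose x i := iter i next x0.
pose g i := projT1 (cid (nextP (x i))); have gP i := projT2 (cid (nextP (x i))).
have p_incr i : (kk (x i) < kk (x i.+1))%N by case: (gP i).
have q_incr i : (ll (x i) < ll (x i.+1))%N by case: (gP i).
exists (fun i => kk (x i)), (fun i => ll (x i)), p_incr, q_incr, (fun i => ff (x i)), g.
split=> i.
- exact: reg (svalP (tagged (tagged (x i)))).
- by case: (gP i).
- by move=> a; case: (gP i) => _ _ _ H _; apply: H.
- by move=> a; case: (gP i) => _ _ _ _ H; apply: H.
Qed.

(** [phi0] and [psi0] compose to a connecting map, so they share a kind. Later maps are compared
    with the reference map of the opposite direction. *)
Lemma represents_uniform_kind S S' h H h' H' : @lim_iso C S S' h H -> @lim_iso C S' S h' H' ->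
    cancel h h' -> cancel h' h ->
  exists (b : bool) N,
    (forall k l (phi : starEmb C (gs_size S k) (gs_size S' l)),
       (N < k)%N -> (N < l)%N -> represents h phi -> has_kind b phi) /\
    (forall l k (psi : starEmb C (gs_size S' l) (gs_size S k)),
       (N < k)%N -> (N < l)%N -> represents h' psi -> has_kind b psi).
Proof.
move=> hI h'I hh' h'h.
have [l0 _ [phi0 rphi0]] := represents_exists 0 0 hI.
have [k0 k0_gt0 [psi0 rpsi0]] := represents_exists l0 1 h'I.
have [ga gaE kga] := @gs_trans_emb C S 0 k0 (leq0n k0) k0_gt0.
have [a|b [kphi0 kpsi0]] := @factor_kind C _ _ _ phi0 psi0 ga _ kga.
  by rewrite gaE; apply: represents_comp rphi0 rpsi0 hh' a.
exists b, (maxn k0 l0); split=> [k l phi|l k psi];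
  rewrite !gtn_max => /andP[k0k l0k] /andP[k0l l0l] r.
  exact: represents_kind rpsi0 r h'h l0l k0k kpsi0.
apply: represents_kind rphi0 r hh' _ l0l kphi0.
exact: leq_ltn_trans (leq0n k0) k0k.
Qed.

(** Anticommutation only makes multiplicities even. Going across, back and across again still
    represents [h], and a product of three even multiplicities is divisible by 4. *)
Lemma represents_balanced S S' h H h' H' N k l1 :
    @lim_iso C S S' h H -> @lim_iso C S' S h' H' -> cancel h h' -> cancel h' h ->
    (forall k l (phi : starEmb C (gs_size S k) (gs_size S' l)),
       (N < k)%N -> (N < l)%N -> represents h phi -> has_kind true phi) ->
    (forall l k (psi : starEmb C (gs_size S' l) (gs_size S k)),
       (N < k)%N -> (N < l)%N -> represents h' psi -> has_kind true psi) ->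
    (N < k)%N ->
  exists2 l, (l1 < l)%N && (N < l)%N & exists m (phi : starEmb C (gs_size S k) (gs_size S' l)),
    [/\ represents h phi, balanced m phi & (4 %| m)%N].
Proof.
move=> hI h'I hh' h'h K K' Nk.
have [l2 Nl2 [phi1 r1]] := represents_exists k N.+1 hI.
have [k2 Nk2 [psi r2]] := represents_exists l2 N.+1 h'I.
have [l ll [phi2 r3]] := represents_exists k2 (maxn l1 N).+1 hI.
move: ll; rewrite gtn_max => /andP[l1l Nl]; exists l; first by rewrite l1l.
have [m1 o1 b1] := anticommutes_balanced (K _ _ _ Nk Nl2 r1).
have [m2 o2 b2] := anticommutes_balanced (K' _ _ _ Nk2 Nl2 r2).
have [m3 o3 b3] := anticommutes_balanced (K _ _ _ Nk2 Nl r3).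
have [chi chiE] := starEmb_comp phi1 psi; have [phi phiE] := starEmb_comp chi phi2.
exists (m1 * m2 * m3)%N, phi; split.
- by move=> a; rewrite phiE /= chiE /= -r3 -r2 -r1 hh'.
- apply: balanced_ext (balanced_comp (balanced_comp b1 b2) b3) => a.
  by rewrite phiE /= chiE.
apply: dvdn_mulr; rewrite (_ : 4 = 2 * 2)%N //; apply: dvdn_mul; by rewrite dvdn2.
Qed.

Lemma star_regularly_isomorphic S S' :
  star_extendibly_isomorphic S S' -> regularly_isomorphic S S'.
Proof.
move=> [h [H hI]]; have [h' [H' [h'I hh' h'h]]] := lim_iso_inv hI.
have [[] [N [K K']]] := represents_uniform_kind hI h'I hh' h'h.
  (* Sign -1. A rung is a commuting replacement [phi'] kept together with a representative [phi] of
     [h] of the same multiplicity; the next replacement is corrected against this pair. *)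
  pose P k l (phi' : starEmb C (gs_size S k) (gs_size S' l)) := [/\ (N < k)%N, (N < l)%N &
    exists m (phi : starEmb C (gs_size S k) (gs_size S' l)),
      [/\ represents h phi, balanced m phi & balanced_regular m phi']].
  pose P' l k (psi' : starEmb C (gs_size S' l) (gs_size S k)) := [/\ (N < l)%N, (N < k)%N &
    exists m (psi : starEmb C (gs_size S' l) (gs_size S k)),
      [/\ represents h' psi, balanced m psi & balanced_regular m psi']].
  apply: (@regular_chain S S' P P').
  - have [l /andP[_ Nl] [m [phi [rphi bphi m4]]]] :=
      represents_balanced 0 hI h'I hh' h'h K K' (ltnSn N).
    have [phi' bphi'] := balanced_regular_exists bphi m4.
    by exists N.+1, l, phi'; split=> //; exists m, phi.
  - move=> k l phi' [Nk Nl [m [phi [rphi bphi bphi']]]].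
    have [n /andP[kn Nn] [m' [psi [rpsi bpsi m4]]]] :=
      represents_balanced k h'I hI h'h hh' (fun k l phi Nk Nl => K' k l phi Nl Nk)
        (fun l k psi Nk Nl => K l k psi Nl Nk) Nl.
    have pp le_kn := represents_comp le_kn rphi rpsi hh'.
    have [ga gaE kga] := @gs_trans_emb C S k n (ltnW kn) kn.
    (* The composite of the representatives is a connecting map, although the symmetries of each
       factor anticommute. *)
    have kG : has_kind false (psi \o phi).
      by apply: has_kind_ext kga => a; rewrite gaE -pp.
    have [psi' bpsi' E] := balanced_regular_factor bphi bpsi m4 kG bphi'.
    exists n, psi'; split=> // [|le_kn a]; last by rewrite E -pp.
    by split=> //; exists m', psi.
  - move=> l k psi' [Nl Nk [m [psi [rpsi bpsi bpsi']]]].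
    have [n /andP[ln Nn] [m' [phi [rphi bphi m4]]]] :=
      represents_balanced l hI h'I hh' h'h K K' Nk.
    have pp le_ln := represents_comp le_ln rpsi rphi h'h.
    have [ga gaE kga] := @gs_trans_emb C S' l n (ltnW ln) ln.
    have kG : has_kind false (phi \o psi).
      by apply: has_kind_ext kga => a; rewrite gaE -pp.
    have [phi' bphi' E] := balanced_regular_factor bpsi bphi m4 kG bpsi'.
    exists n, phi'; split=> // [|le_ln a]; last by rewrite E -pp.
    by split=> //; exists m', phi.
  - by move=> k l phi [_ _ [m [? [_ _ /balanced_regular_kind/commutes_regular]]]].
  - by move=> l k psi [_ _ [m [? [_ _ /balanced_regular_kind/commutes_regular]]]].
(* Sign 1: the representatives themselves are regular. *)
pose P k l (phi : starEmb C (gs_size S k) (gs_size S' l)) :=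
  [/\ (N < k)%N, (N < l)%N & represents h phi].
pose P' l k (psi : starEmb C (gs_size S' l) (gs_size S k)) :=
  [/\ (N < l)%N, (N < k)%N & represents h' psi].
apply: (@regular_chain S S' P P').
- have [l Nl [phi r]] := represents_exists N.+1 N.+1 hI.
  by exists N.+1, l, phi.
- move=> k l phi [Nk Nl r].
  have [n kn [psi r']] := represents_exists l k.+1 h'I.
  exists n, psi; split=> // [|le_kn a]; last exact: represents_comp r r' hh' a.
  by split=> //; apply: ltn_trans Nk kn.
- move=> l k psi [Nl Nk r].
  have [n ln [phi r']] := represents_exists k l.+1 hI.
  exists n, phi; split=> // [|le_ln a]; last exact: represents_comp r r' h'h a.
  by split=> //; apply: ltn_trans Nl ln.
- by move=> k l phi [Nk Nl /(K _ _ _ Nk Nl)/commutes_regular].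
- by move=> l k psi [Nl Nk /(K' _ _ _ Nk Nl)/commutes_regular].
Qed.

End Chains.

Theorem theorem4p2 (R : realType) (S S' : genericSystem R[i]) :
  star_extendibly_isomorphic S S' <-> regularly_isomorphic S S'.
Proof.
by split; [apply: star_regularly_isomorphic | apply: regularly_isomorphic_star].
Qed.
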